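(* Let $T>0$ and $r>0$. Assume that, for some $\zeta\in(0,1)$, the strengthened CFL condition $$\Delta t\le \frac{\beta_0}{\beta_1}\,\frac{a^2}{\lambda^\star}\,(1-\zeta)\,h$$ holds. Then there exists $C$ depending only on $T,r,a,\eta,\xi,\Omega$ and $\zeta$ (but neither on $h$ nor on $\Delta t$) such that $$\sum_{n=0}^{N_T}\Delta t\sum_{(K,L)\in\mathcal E_r}|\sigma_{KL}|\,\big|G_{KL}(u_K^n,u_L^n)-f(u_K^n)\cdot n_{KL}\big|^2\le C .$$
   Context: System. $\Omega\subset\mathbb R^m$ is a convex bounded set; $f_\alpha\in C^2(\overline\Omega;\mathbb R^m)$ ($1\le\alpha\le d$) and each $Df_\alpha$ is diagonalizable with real eigenvalues. $\eta\in C^2(\overline\Omega;\mathbb R)$, $\eta\ge0$, satisfies $\mathrm{spec}(D^2\eta(u))\subset[\beta_0;\beta_1]$ for all $u\in\overline\Omega$, where $\beta_1\ge\beta_0>0$, and $\xi=(\xi_\alpha)_\alpha\in C^2(\overline\Omega;\mathbb R^d)$ satisfies $D\xi_\alpha(u)=D\eta(u)Df_\alpha(u)$ on $\Omega$. For $n\in\mathbb R^d$: $f(u)\cdot n=\sum_\alpha n_\alpha f_\alpha(u)\in\mathbb R^m$, $\xi(u)\cdot n=\sum_\alpha n_\alpha\xi_\alpha(u)$. Initial data $u_0:\mathbb R^d\to\Omega$ (measurable). Mesh. $\mathcal T$ is a family of disjoint polygonal/polyhedral connected cells of $\mathbb R^d$, the union of whose closures is $\mathbb R^d$; $h=\sup_{K\in\mathcal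 T}\mathrm{diam}(K)$, $0<h\le1$. $|K|$ is the $d$-dimensional Lebesgue measure of $K$, $\mathcal N(K)$ is the set of cells neighbouring $K$; for $L\in\mathcal N(K)$, $\sigma_{KL}$ is the common interface, $|\sigma_{KL}|$ its $(d-1)$-dimensional measure, $n_{KL}$ its unit normal from $K$ to $L$. There is $a>0$ with $|K|\ge ah^d$ and $\sum_{L\in\mathcal N(K)}|\sigma_{KL}|\le h^{d-1}/a$ for all $K\in\mathcal T$. For $r>0$, $\mathcal T_r=\{K\in\mathcal T:\ K\subset B(0,r)\}$, where $B(0,r)$ is the ball of radius $r$ centred at $0$, and $\mathcal E_r$ is the set of interfaces $\sigma_{KL}$ with $K,L\in\mathcal T_r$, $L\in\mathcal N(K)$; a sum over $(K,L)\in\mathcal E_r$ counts each interface once, with an arbitrary choice of orientation. Numerical fluxes. For each $K\in\mathcal T$, $L\in\mathcal N(K)$, $G_{KL}:\Omega^2\to\mathbb R^m$ is Lipschitz continuous, with $G_{KL}(u,v)=-G_{LK}(v,u)$ and $G_{KL}(u,u)=f(u)\cdot n_{KL}$. There is $\lambda^\star>0$ such that: (i) for all $\lambda>\lambda^\star$ and all $(u,v)\in\Omega^2$, $u-\frac1\lambda(G_{KL}(u,v)-f(u)\cdot n_{KL})\in\Omega$; (ii) there are Lipschitz continuous $\xi_{KL}:\Omega^2\to\mathbb R$ with $\xi_{KL}(u,v)=-\xi_{LK}(v,u)$ and, for all $\lambda\ge\lambda^\star$ and $(u,v)\in\Omega^2$, $$\xi_{KL}(u,v)-\xi(u)\cdot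 n_{KL}\le-\lambda\Big(\eta\big(u-\tfrac1\lambda(G_{KL}(u,v)-f(u)\cdot n_{KL})\big)-\eta(u)\Big).$$ Scheme. $\Delta t>0$, $t^n=n\Delta t$, $N_T=\max\{n\in\mathbb N:\ n\le T/\Delta t+1\}$. The unknowns satisfy $u_K^0=\frac1{|K|}\int_Ku_0\,dx$ and $\frac{u_K^{n+1}-u_K^n}{\Delta t}|K|+\sum_{L\in\mathcal N(K)}|\sigma_{KL}|G_{KL}(u_K^n,u_L^n)=0$; under the CFL condition all $u_K^n$ belong to $\Omega$.
   Formalization: The constant C is also allowed to depend on λ* (besides T, r, a, η, ξ, Ω, ζ): with f=0, ξ=0, η=u²/2, G=λ*(u−v)/2 and alternating data, the sum grows linearly in λ*, so no C independent of λ* exists. *)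

(* Defs.v *)
From HB Require Import structures.
From mathcomp Require Import all_boot all_order all_algebra.
From mathcomp Require Import all_classical all_reals all_analysis.

Set Implicit Arguments.
Unset Strict Implicit.
Unset Printing Implicit Defensive.

Import Order.TTheory GRing.Theory Num.Theory.
Import numFieldNormedType.Exports.

Local Open Scope classical_set_scope.
Local Open Scope ring_scope.

(* Matrices carry the sigma-algebra generated by the entries, i.e. the Borel
   sets of R^(m * n). *)
Definition measure_matrix_display : measure_display.
Proof. exact: default_measure_display. Qed.

Section measurable_matrix.
Context {R : realType} (m n : nat).

Definition entry_sets : set (set 'M[R]_(m, n)) :=
  [set A | exists i j, exists2 B : set (measurableTypeR R),
     measurable B & A = [set M : 'M[R]_(m, n) | B (M i j)]].

Let matrix_set0 : <<s entry_sets >> set0.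
Proof. exact: sigma_algebra0. Qed.

Let matrix_setC A : <<s entry_sets >> A -> <<s entry_sets >> (~` A).
Proof. by move=> mA; rewrite -setTD; exact: sigma_algebraCD. Qed.

Let matrix_bigcup (F : (set 'M[R]_(m, n))^nat) :
  (forall i, <<s entry_sets >> (F i)) -> <<s entry_sets >> (\bigcup_i (F i)).
Proof. exact: sigma_algebra_bigcup. Qed.

HB.instance Definition _ := @isMeasurable.Build measure_matrix_display
  'M[R]_(m, n) <<s entry_sets >> matrix_set0 matrix_setC matrix_bigcup.

End measurable_matrix.

Section lebesgue_row.
Context {R : realType}.

Definition row_cons n (p : measurableTypeR R * 'rV[R]_n) : 'rV[R]_n.+1 :=
  row_mx (p.1 : R)%:M p.2.

Lemma measurable_entry m n i j :
  measurable_fun setT (fun M : 'M[R]_(m, n) => M i j : measurableTypeR R).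
Proof.
move=> _ B mB; rewrite setTI; apply: sub_sigma_algebra.
by exists i, j, B.
Qed.

Lemma measurable_row_cons n : measurable_fun setT (@row_cons n).
Proof.
apply: (measurability (@entry_sets R 1 n.+1)) => //.
move=> _ [_ [i [j [B mB ->]]] <-]; rewrite (ord1 i).
suff mf : measurable_fun setT
    (fun p => row_cons p 0 j : measurableTypeR R) by exact: mf.
case: (split_ordP (m := 1) j) => k ->.
  rewrite (_ : (fun _ => _) = fst); first exact: measurable_fst.
  by apply: funext => p; rewrite /row_cons [LHS](@row_mxEl _ 1 1 n) ord1 mxE eqxx mulr1n.
rewrite (_ : (fun _ => _) = (fun p : _ * 'rV[R]_n => p.2 0 k)).
  exact: (measurableT_comp (measurable_entry _ _) measurable_snd).
by apply: funext => p; rewrite /row_cons [LHS](@row_mxEr _ 1 1 n).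
Qed.

Definition lebesgue_step n
    (mu : {sigma_finite_measure set 'rV[R]_n -> \bar R}) :
    set 'rV[R]_n.+1 -> \bar R :=
  pushforward (lebesgue_measure \x mu)%E (@row_cons n).

Section step.
Variables (n : nat) (mu : {sigma_finite_measure set 'rV[R]_n -> \bar R}).

Let mpre A : measurable A -> measurable (@row_cons n @^-1` A).
Proof.
by move=> mA; rewrite -[X in measurable X]setTI; exact: measurable_row_cons.
Qed.

Let lebesgue_step0 : lebesgue_step mu set0 = 0%E.
Proof. by rewrite /lebesgue_step /pushforward preimage_set0 measure0. Qed.

Let lebesgue_step_ge0 A : (0 <= lebesgue_step mu A)%E.
Proof. by rewrite /lebesgue_step /pushforward measure_ge0. Qed.

Let lebesgue_step_sigma_additive : semi_sigma_additive (lebesgue_step mu).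
Proof.
move=> F mF tF mUF; rewrite /lebesgue_step /pushforward preimage_bigcup.
apply: measure_semi_sigma_additive.
- by move=> k; exact: mpre.
- apply/trivIsetP => i j _ _ ij; rewrite -preimage_setI.
  by move/trivIsetP : tF => /(_ _ _ _ _ ij) ->//; rewrite preimage_set0.
- by rewrite -preimage_bigcup; exact: mpre.
Qed.

HB.instance Definition _ := isMeasure.Build _ _ _ (lebesgue_step mu)
  lebesgue_step0 lebesgue_step_ge0 lebesgue_step_sigma_additive.

Let lebesgue_step_sigma_finite : sigma_finite setT (lebesgue_step mu).
Proof.
have /sigma_finiteP[F [FT ndF Foo]] :=
  sigma_finiteT (@lebesgue_measure R : {sigma_finite_measure set _ -> \bar R}).
have /sigma_finiteP[G [GT ndG Goo]] := sigma_finiteT mu.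
pose g (v : 'rV[R]_n.+1) : measurableTypeR R * 'rV[R]_n :=
  (lsubmx (v : 'rV_(1 + n)) 0 0, rsubmx (v : 'rV_(1 + n))).
have gK : cancel (@row_cons n) g.
  by move=> [x v]; rewrite /g /row_cons row_mxKl row_mxKr mxE eqxx mulr1n.
have mg : measurable_fun setT g.
  apply/measurable_fun_pairP; split.
    rewrite (_ : _ \o _ = (fun v : 'rV[R]_(1 + n) => v 0 (lshift n 0))).
      exact: measurable_entry.
    by apply: funext => v /=; rewrite mxE.
  apply: (measurability (@entry_sets R 1 n)) => //.
  move=> _ [_ [i [j [B mB ->]]] <-].
  rewrite (_ : _ `&` _ = setT `&` (fun v : 'rV[R]_(1 + n) => v 0 (rshift 1 j)) @^-1` B).
    exact: (@measurable_entry 1 (1 + n)).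
  by apply/seteqP; split => v /=; rewrite mxE (ord1 i).
exists (fun k => g @^-1` (F k `*` G k)).
  apply/esym; rewrite -subTset => v _.
  have [k _ Fk] : (\bigcup_i F i) (g v).1 by rewrite -FT.
  have [l _ Gl] : (\bigcup_i G i) (g v).2 by rewrite -GT.
  exists (maxn k l) => //; split.
    by move: Fk; exact/subsetPset/ndF/leq_maxl.
  by move: Gl; exact/subsetPset/ndG/leq_maxr.
move=> k; have [[mF Fk] [mG Gk]] := (Foo k, Goo k); split.
  by rewrite -[X in measurable X]setTI; apply: mg => //; exact: measurableX.
rewrite /lebesgue_step /pushforward -comp_preimage.
rewrite (_ : g \o _ = id); last exact: funext.
by rewrite preimage_id product_measure1E// lte_mul_pinfty// ge0_fin_numE.
Qed.
HB.instance Definition _ := Measure_isSigmaFinite.Build _ _ _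
  (lebesgue_step mu) lebesgue_step_sigma_finite.
End step.

(* The d-dimensional Lebesgue measure: the d-fold product of the Lebesgue
   measure on the line. *)
Fixpoint lebesgue d : {sigma_finite_measure set 'rV[R]_d -> \bar R} :=
  match d with
  | 0 => dirac (0 : 'rV[R]_0)
  | d'.+1 => lebesgue_step (lebesgue d')
  end.

Lemma lebesgue_box d (l : 'I_d -> R) (b : 'I_d -> R) :
  (forall i, l i <= b i) ->
  lebesgue d [set x | forall i, l i <= x 0 i <= b i] =
  (\prod_i (b i - l i))%:E.
Proof.
elim: d l b => [|d IH] l b lb.
  by rewrite big_ord0 /= diracE mem_set //= => -[].
rewrite big_ord_recl /= /lebesgue_step /pushforward.
rewrite (_ : _ @^-1` _ = (`[l ord0, b ord0]%classic : set (measurableTypeR R)) `*`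
    [set x : 'rV[R]_d | forall i, l (lift ord0 i) <= x 0 i <= b (lift ord0 i)]).
  rewrite product_measure1E//.
  - rewrite IH// EFinM; congr (_ * _)%E.
    transitivity (lebesgue_measure (`[l ord0, b ord0]%classic : set R)) => //.
    rewrite lebesgue_measure_itv/= lte_fin lt_neqAle lb andbT.
    by case: eqVneq => [->|_]; rewrite ?subrr // EFinB.
  - rewrite (_ : [set x | _] = \bigcap_(i in [set: 'I_d])
        [set x : 'rV[R]_d | `[l (lift ord0 i), b (lift ord0 i)]%classic (x 0 i)]).
      apply: fin_bigcap_measurable => // i _.
      rewrite -[X in measurable X]setTI.
      exact: (@measurable_entry 1 d 0 i).
    apply/seteqP; split => x /= h i; first by move=> _ /=; rewrite in_itv/=.
    by have := h i I; rewrite /= in_itv/=.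
have r0 (p : measurableTypeR R * 'rV[R]_d) : row_cons p 0 ord0 = p.1 :> R.
  transitivity (row_cons p 0 (@lshift 1 d ord0 : 'I_d.+1)).
    by congr (row_cons p _ _); exact: val_inj.
  by rewrite /row_cons [LHS](@row_mxEl _ 1 1 d) mxE eqxx mulr1n.
have rS (p : measurableTypeR R * 'rV[R]_d) i : row_cons p 0 (lift ord0 i) = p.2 0 i.
  transitivity (row_cons p 0 (rshift 1 i : 'I_d.+1)).
    by congr (row_cons p _ _); exact: val_inj.
  by rewrite /row_cons [LHS](@row_mxEr _ 1 1 d).
apply/seteqP; split => [p /= h|p /= [h1 h2] i].
  split; first by have := h ord0; rewrite r0 in_itv.
  by move=> i; have := h (lift ord0 i); rewrite rS.
by case: (unliftP ord0 i) => [j|] ->; rewrite ?r0 ?rS // -in_itv.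
Qed.

End lebesgue_row.

Section euclidean.
Context {R : realType}.

(* The library norm `|x| on matrices is the sup norm. *)
Definition enorm m n (x : 'M[R]_(m, n)) : R :=
  Num.sqrt (\sum_i \sum_j x i j ^+ 2).

Definition dot d (x y : 'rV[R]_d) : R := \sum_i x 0 i * y 0 i.

Definition eball d (r : R) : set 'rV[R]_d := [set x | enorm x < r].

Definition diam d (K : set 'rV[R]_d) : \bar R :=
  ereal_sup [set (enorm (p.1 - p.2))%:E | p in K `*` K].

End euclidean.

Section regularity.
Context {R : realType} (m : nat).

(* g is of class C^2 on the set A, with gradient Dg (a row) and Hessian D2g.
   A need not be open, so that derivatives are taken within A; this is the
   usual C^2(closure Omega) for a convex Omega with interior.  There the
   symmetry of D2g is Schwarz's theorem; if Omega lies in a hyperplane, Dg and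
   D2g are not unique and a Hessian means a symmetric one. *)
Record is_C2_on (A : set 'cV[R]_m) (g : 'cV[R]_m -> R)
    (Dg : 'cV[R]_m -> 'rV[R]_m) (D2g : 'cV[R]_m -> 'M[R]_m) : Prop := {
  C2_gradient : forall u, A u ->
    (fun v => g v - g u - (Dg u *m (v - u)) 0 0)
      =o_ (within A (nbhs u)) (fun v => v - u) ;
  C2_hessian : forall u, A u ->
    (fun v => (Dg v - Dg u)^T - D2g u *m (v - u))
      =o_ (within A (nbhs u)) (fun v => v - u) ;
  C2_symmetric : forall u, A u -> (D2g u)^T = D2g u ;
  C2_continuous : {within A, continuous D2g} }.

End regularity.

Section mesh.
Context {R : realType} (d : nat).
Local Notation E := 'rV[R]_d.

(* Finite unions of finite intersections of open or closed half-spaces. *)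
Definition polyhedral (K : set E) : Prop :=
  exists s : seq (seq (E * R * bool)),
    K = [set x | has (all (fun c => dot c.1.1 x < c.1.2 ?<= if c.2)) s].

(* Near x, K and L are the two sides of the hyperplane through x orthogonal to
   n, K being on the side of - n. *)
Definition separates (K L : set E) (n x : E) : Prop :=
  \forall y \near x, (dot (y - x) n <= 0 -> closure K y) /\
                     (0 <= dot (y - x) n -> closure L y).

(* The common interface without its edges, which have dimension d - 2. *)
Definition interface (K L : set E) : set E :=
  [set x | exists2 n, enorm n = 1 & separates K L n x].

Definition unit_normal (K L : set E) (n : E) : Prop :=
  [/\ enorm n = 1,
      forall x, interface K L x -> separates K L n x &
      forall x y, interface K L x -> interface K L y -> dot (y - x) n = 0].

Definition vol (K : set E) : R := fine (lebesgue d K).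

(* (d-1)-dimensional measure of a subset S of a hyperplane with unit normal n:
   the volume of the right prism of height 1 over S. *)
Definition area (n : E) (S : set E) : R :=
  vol [set x | exists y t, [/\ S y, 0 <= t <= 1 & x = y + t *: n]].

Definition neighbours (cells : set (set E)) (K : set E) : set (set E) :=
  [set L | [/\ cells L, L <> K & interface K L !=set0]].

(* Sums over neighbours K are sums over a finite set: a mesh has finitely many
   cells in any bounded region, by mesh_size and mesh_volume. *)
Record is_mesh (cells : set (set E)) (nu : set E -> set E -> E) (h a : R) :
    Prop := {
  mesh_polyhedral : forall K, cells K -> polyhedral K ;
  mesh_connected : forall K, cells K -> connected K ;
  (* satisfied by open cells; cells may own part of their boundary but have
     no lower-dimensional pieces *)
  mesh_regular : forall K, cells K -> K `<=` closure K° ;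
  mesh_disjoint : forall K L, cells K -> cells L -> K <> L -> K `&` L = set0 ;
  mesh_cover : \bigcup_(K in cells) closure K = setT ;
  mesh_normal : forall K L, cells K -> neighbours cells K L ->
    unit_normal K L (nu K L) ;
  mesh_size : h%:E = ereal_sup [set diam K | K in cells] ;
  mesh_size_bounds : 0 < h <= 1 ;
  mesh_volume : forall K, cells K -> a * h ^+ d <= vol K ;
  mesh_perimeter : forall K, cells K ->
    \sum_(L \in neighbours cells K) area (nu K L) (interface K L)
      <= h ^+ d.-1 / a }.

Definition cells_in_ball (cells : set (set E)) (r : R) : set (set E) :=
  [set K | cells K /\ K `<=` eball r].

(* Er contains exactly one of (K, L) and (L, K) for each interface between
   cells K and L in the ball of radius r. *)
Definition oriented_interfaces (cells : set (set E)) (r : R)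
    (Er : set (set E * set E)) : Prop :=
  let adjacent K L := [/\ cells_in_ball cells r K, cells_in_ball cells r L &
                          neighbours cells K L] in
  (forall K L, Er (K, L) -> adjacent K L) /\
  (forall K L, adjacent K L -> (Er (K, L) <-> ~ Er (L, K))).

End mesh.

Section scheme.
Context {R : realType} (d m : nat).
Local Notation E := 'rV[R]_d.
Local Notation V := 'cV[R]_m.

Definition lipschitz2 (W : normedModType R) (A : set V) (G : V -> V -> W) :
    Prop :=
  exists k : R, k.-lipschitz_(A `*` A) (fun p => G p.1 p.2).

Definition fluxdot (f : 'I_d -> V -> V) (u : V) (n : E) : V :=
  \sum_alpha n 0 alpha *: f alpha u.

Definition entropydot (xi : 'I_d -> V -> R) (u : V) (n : E) : R :=
  \sum_alpha n 0 alpha * xi alpha u.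

Record is_numerical_flux (cells : set (set E)) (nu : set E -> set E -> E)
    (Omega : set V) (f : 'I_d -> V -> V) (G : set E -> set E -> V -> V -> V) :
    Prop := {
  flux_lipschitz : forall K L, cells K -> neighbours cells K L ->
    lipschitz2 Omega (G K L) ;
  flux_conservative : forall K L, cells K -> neighbours cells K L ->
    forall u v, Omega u -> Omega v -> G K L u v = - G L K v u ;
  flux_consistent : forall K L, cells K -> neighbours cells K L ->
    forall u, Omega u -> G K L u u = fluxdot f u (nu K L) }.

Definition flux_invariant (cells : set (set E)) (nu : set E -> set E -> E)
    (Omega : set V) (f : 'I_d -> V -> V) (lambda_star : R)
    (G : set E -> set E -> V -> V -> V) : Prop :=
  forall K L, cells K -> neighbours cells K L ->
  forall lambda, lambda_star < lambda -> forall u v, Omega u -> Omega v ->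
    Omega (u - lambda^-1 *: (G K L u v - fluxdot f u (nu K L))).

Record is_entropy_flux (cells : set (set E)) (nu : set E -> set E -> E)
    (Omega : set V) (f : 'I_d -> V -> V) (eta : V -> R)
    (xi : 'I_d -> V -> R) (lambda_star : R)
    (G : set E -> set E -> V -> V -> V) (X : set E -> set E -> V -> V -> R) :
    Prop := {
  entropy_flux_lipschitz : forall K L, cells K -> neighbours cells K L ->
    lipschitz2 Omega (X K L : V -> V -> R^o) ;
  entropy_flux_conservative : forall K L, cells K -> neighbours cells K L ->
    forall u v, Omega u -> Omega v -> X K L u v = - X L K v u ;
  entropy_flux_inequality : forall K L, cells K -> neighbours cells K L ->
    forall lambda, lambda_star <= lambda -> forall u v, Omega u -> Omega v ->
    X K L u v - entropydot xi u (nu K L) <=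
    - lambda * (eta (u - lambda^-1 *: (G K L u v - fluxdot f u (nu K L)))
                - eta u) }.

(* The values of the scheme lie in Omega, the domain of the fluxes. *)
Record is_scheme (cells : set (set E)) (nu : set E -> set E -> E)
    (Omega : set V) (G : set E -> set E -> V -> V -> V) (dt : R)
    (u0 : E -> V) (u : nat -> set E -> V) : Prop := {
  scheme_init : forall K, cells K ->
    u 0%N K = (vol K)^-1 *: \col_i \int[lebesgue d]_(x in K) u0 x i 0 ;
  scheme_domain : forall k K, cells K -> Omega (u k K) ;
  scheme_step : forall k K, cells K ->
    (vol K / dt) *: (u k.+1 K - u k K) +
    \sum_(L \in neighbours cells K)
       area (nu K L) (interface K L) *: G K L (u k K) (u k L) = 0 }.

(* max {k | k <= T / dt + 1} *)
Definition last_step (T dt : R) : nat := Num.truncn (T / dt + 1).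

End scheme.

(* Main.v *)
Require Import Defs.
From HB Require Import structures.
From mathcomp Require Import all_boot all_order all_algebra.
From mathcomp Require Import finmap.
From mathcomp Require Import all_classical all_reals all_analysis.
From mathcomp Require Import measurable_realfun ring lra.

Set Implicit Arguments.
Unset Strict Implicit.
Unset Printing Implicit Defensive.

Import Order.TTheory GRing.Theory Num.Theory.
Import numFieldNormedType.Exports.

Local Open Scope classical_set_scope.
Local Open Scope ring_scope.

(** The estimate is the entropy balance of the scheme, tested against a cut-off
    function.

    Let [g] be the flux difference [G K L u_K u_L - f(u_K).n] on a face. In one
    cell, Taylor's formula turns the time increment of [eta u_K] into
    [Deta u_K] applied to the update, plus at most [b1 / 2] times its square.
    The entropy inequality of the numerical flux, together with the lower bound
    [b0] of the Hessian, bounds the entropy flux by [Deta u_K] applied to [g],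
    minus a multiple of [b0 |g|^2]. By the Cauchy-Schwarz inequality the square
    of the update is at most a sum of the [|g|^2] over the faces, and the
    strengthened CFL condition makes it smaller than the gain by a fixed
    fraction. What remains is [cell_entropy_inequality]: the entropy of the
    cell decreases, up to the entropy fluxes through its faces, by a multiple of
    the sum of the [|g|^2].

    This computation replaces [G] by [g] in the scheme, and removes the exact
    entropy fluxes, because the outer normals of a cell weighted by the areas of
    its faces sum up to zero ([sum_area_normal]). With interfaces described only
    as the points where two cells lie locally on both sides of a hyperplane,
    that identity is proved by moving the cell. Translations by [t e] and by
    [- t e] sweep the same volume out of the cell. To first order in [t] the
    first volume is the sum of those of the oblique prisms of direction [t e]
    over the faces [sigma] with [e.n > 0], and the second one is the same sum
    for [- t e], over the faces with [e.n < 0]. The volume of an oblique prism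
    is [t (e.n) area sigma] ([vol_prism_shear]). The prisms over slightly smaller
    faces are disjoint and contained in the swept set ([swept_ge]); conversely
    a swept point has left the cell through a face or through the intersection
    of two transverse hyperplanes ([swept_le]), and the translates of the
    latter along [e] have measure zero. That no other boundary point exists is
    [boundary_interface].

    To sum over the cells, each cell is weighted by a Lipschitz cut-off that
    equals 1 on the ball of radius [r] and vanishes outside the ball of radius
    [r + 1]. The entropy fluxes are antisymmetric, so after summation by parts
    they are multiplied by differences of the cut-off between neighbours, of
    size [h]. The number of cells is [O(h^-d)] and their perimeters are
    [O(h^(d-1))], hence the whole flux term is bounded independently of [h].
    The sum over the time steps telescopes.

    The constant may not depend on the bound [beta0] of the spectrum that comes
    with the scheme. If no positive lower bound of the spectrum exists there is
    nothing to prove; otherwise one such bound is fixed beforehand, and the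
    larger of it and [beta0] is used for the scheme. *)

(** * Euclidean geometry of row vectors *)

Section dot_product.
Context {R : realType} (d : nat).
Implicit Types (x y z : 'rV[R]_d) (c : R).

Lemma dotC x y : dot x y = dot y x.
Proof. by apply: eq_bigr => i _; rewrite mulrC. Qed.

Lemma dotDl x y z : dot (x + y) z = dot x z + dot y z.
Proof. by rewrite -big_split; apply: eq_bigr => i _; rewrite mxE mulrDl. Qed.

Lemma dotZl c x y : dot (c *: x) y = c * dot x y.
Proof. by rewrite mulr_sumr; apply: eq_bigr => i _; rewrite mxE mulrA. Qed.

Lemma dotNl x y : dot (- x) y = - dot x y.
Proof. by rewrite -scaleN1r dotZl mulN1r. Qed.

Lemma dotBl x y z : dot (x - y) z = dot x z - dot y z.
Proof. by rewrite dotDl dotNl. Qed.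

Lemma dot0l x : dot 0 x = 0.
Proof. by rewrite -(scale0r 0) dotZl mul0r. Qed.

Lemma dotDr x y z : dot x (y + z) = dot x y + dot x z.
Proof. by rewrite dotC dotDl !(dotC x). Qed.

Lemma dotZr c x y : dot x (c *: y) = c * dot x y.
Proof. by rewrite dotC dotZl dotC. Qed.

Lemma dotNr x y : dot x (- y) = - dot x y.
Proof. by rewrite dotC dotNl dotC. Qed.

Lemma dotBr x y z : dot x (y - z) = dot x y - dot x z.
Proof. by rewrite dotDr dotNr. Qed.

Lemma dot_ge0 x : 0 <= dot x x.
Proof. by apply: sumr_ge0 => i _; rewrite -expr2 sqr_ge0. Qed.

Lemma dot_eq0 x : dot x x = 0 -> x = 0.
Proof.
move=> x0; apply/rowP => i; rewrite mxE.
have /psumr_eq0P/(_ i isT)/eqP := x0.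
by rewrite -expr2 sqrf_eq0 => /(_ (fun j _ => sqr_ge0 _))/eqP.
Qed.

Lemma enorm_row x : enorm x = Num.sqrt (dot x x).
Proof. by rewrite /enorm big_ord1; congr Num.sqrt; apply: eq_bigr. Qed.

Lemma sqr_enorm_row x : enorm x ^+ 2 = dot x x.
Proof. by rewrite enorm_row sqr_sqrtr// dot_ge0. Qed.

End dot_product.

Section euclidean_norm.
Context {R : realType}.

Lemma enorm_ge0 m n (x : 'M[R]_(m, n)) : 0 <= enorm x.
Proof. exact: sqrtr_ge0. Qed.

Lemma enorm0 m n : enorm (0 : 'M[R]_(m, n)) = 0.
Proof.
rewrite /enorm big1 ?sqrtr0// => i _.
by rewrite big1// => j _; rewrite mxE expr0n.
Qed.

Lemma sqr_enorm m n (x : 'M[R]_(m, n)) :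
  enorm x ^+ 2 = \sum_i \sum_j x i j ^+ 2.
Proof. by rewrite sqr_sqrtr//; do 2![apply: sumr_ge0 => ? _]; exact: sqr_ge0. Qed.

Lemma sqr_enorm_col m (x : 'cV[R]_m) : enorm x ^+ 2 = \sum_i x i 0 ^+ 2.
Proof. by rewrite sqr_enorm; apply: eq_bigr => i _; rewrite big_ord1. Qed.

Lemma enormZ m n (c : R) (x : 'M[R]_(m, n)) : enorm (c *: x) = `|c| * enorm x.
Proof.
rewrite /enorm -sqrtr_sqr -sqrtrM ?sqr_ge0//; congr Num.sqrt.
rewrite mulr_sumr; apply: eq_bigr => i _; rewrite mulr_sumr.
by apply: eq_bigr => j _; rewrite mxE exprMn.
Qed.

Lemma enormN m n (x : 'M[R]_(m, n)) : enorm (- x) = enorm x.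
Proof. by rewrite -scaleN1r enormZ normrN1 mul1r. Qed.

Lemma enorm_distC m n (x y : 'M[R]_(m, n)) : enorm (x - y) = enorm (y - x).
Proof. by rewrite -enormN opprB. Qed.

Lemma enorm_entry m n (x : 'M[R]_(m, n)) i j : `|x i j| <= enorm x.
Proof.
rewrite -sqrtr_sqr ler_sqrt; last first.
  by do 2![apply: sumr_ge0 => ? _]; exact: sqr_ge0.
rewrite (bigD1 i)//= (bigD1 j)//= -addrA lerDl addr_ge0//.
  by apply: sumr_ge0 => ? _; exact: sqr_ge0.
by do 2![apply: sumr_ge0 => ? _]; exact: sqr_ge0.
Qed.

Lemma norm_le_enorm m n (x : 'M[R]_(m, n)) : `|x| <= enorm x.
Proof.
have [->|x0] := eqVneq x 0; first by rewrite normr0 enorm0.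
have /mx_norm_neq0[i] : mx_norm x != 0.
  by apply: contra_neq x0; exact: mx_norm_eq0.
by rewrite -[ `|x| ]/(mx_norm x) => ->; exact: enorm_entry.
Qed.

Lemma enorm_le_norm m n (x : 'M[R]_(m, n)) : enorm x <= (m * n)%:R * `|x|.
Proof.
have nx0 : 0 <= (m * n)%:R * `|x| by rewrite mulr_ge0.
rewrite -(ler_pXn2r (n := 2)) ?nnegrE ?enorm_ge0// sqr_enorm.
have le i j : x i j ^+ 2 <= `|x| ^+ 2.
  rewrite -real_normK ?num_real// ler_pXn2r ?nnegrE//.
  rewrite -[leRHS]/(mx_norm x) mx_normrE.
  exact: (le_bigmax _ (fun ij : 'I_m * 'I_n => `|x ij.1 ij.2|) (i, j)).
apply: (@le_trans _ _ (\sum_(i < m) \sum_(j < n) `|x| ^+ 2)).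
  by apply: ler_sum => i _; apply: ler_sum => j _; exact: le.
rewrite !sumr_const !card_ord -mulrnA -[leLHS]mulr_natl (mulnC n) exprMn.
apply: ler_wpM2r; first exact: sqr_ge0.
by rewrite -natrX ler_nat -mulnn; case: (m * n)%N => // k; rewrite leq_pmulr.
Qed.

Lemma cauchy_schwarz d (x y : 'rV[R]_d) : dot x y <= enorm x * enorm y.
Proof.
have [->|y0] := eqVneq y 0; first by rewrite dotC dot0l enorm0 mulr0.
have yy : 0 < dot y y.
  rewrite lt_neqAle dot_ge0 andbT eq_sym; apply: contra_neq y0; exact: dot_eq0.
have := dot_ge0 (x - (dot x y / dot y y) *: y).
rewrite !(dotBl, dotBr, dotZl, dotZr) (dotC y x).
set a := dot x x; set b := dot x y; set c := dot y y in yy *.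
rewrite [leRHS](_ : _ = (a * c - b ^+ 2) / c); last first.
  by field; rewrite gt_eqF.
rewrite pmulr_lge0 ?invr_gt0// subr_ge0 => h.
apply: (le_trans (ler_norm _)).
rewrite -(ler_pXn2r (n := 2)) ?nnegrE ?mulr_ge0 ?enorm_ge0//.
by rewrite real_normK ?num_real// exprMn !sqr_enorm_row.
Qed.

Lemma cauchy_schwarz_abs d (x y : 'rV[R]_d) : `|dot x y| <= enorm x * enorm y.
Proof.
rewrite ler_norml cauchy_schwarz andbT lerNl -dotNl.
by rewrite -(enormN x) cauchy_schwarz.
Qed.

Lemma ler_enormD d (x y : 'rV[R]_d) : enorm (x + y) <= enorm x + enorm y.
Proof.
rewrite -(ler_pXn2r (n := 2)) ?nnegrE ?addr_ge0 ?enorm_ge0//.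
rewrite sqr_enorm_row sqrrD !sqr_enorm_row !(dotDl, dotDr) (dotC y x).
have := cauchy_schwarz x y; lra.
Qed.

Lemma ler_enorm_dist d (x y z : 'rV[R]_d) :
  enorm (x - z) <= enorm (x - y) + enorm (y - z).
Proof. by rewrite (_ : x - z = (x - y) + (y - z)) ?ler_enormD// addrA subrK. Qed.

Lemma enorm_eq0 d (x : 'rV[R]_d) : enorm x = 0 -> x = 0.
Proof. by move=> x0; apply: dot_eq0; rewrite -sqr_enorm_row x0 expr0n. Qed.

Lemma enorm_gt0 d (x : 'rV[R]_d) : x != 0 -> 0 < enorm x.
Proof.
by move=> x0; rewrite lt_neqAle enorm_ge0 andbT eq_sym; apply: contra_neq x0;
  exact: enorm_eq0.
Qed.

(** Neighbourhoods are defined with the supremum norm; the geometry of the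
    mesh uses Euclidean balls. *)
Lemma nearE_enorm d (x : 'rV[R]_d) (P : set 'rV[R]_d) :
  nbhs x P <-> exists2 e : R, 0 < e & forall y, enorm (y - x) < e -> P y.
Proof.
split=> [/nbhs_normP[e /= e0 xP]|[e e0 xP]].
  exists e => // y yx; apply: xP; rewrite /ball_ /= distrC.
  exact: le_lt_trans (norm_le_enorm _) yx.
apply/(@nbhs_normP _ _ x P); exists (e / (d.+1)%:R) => /=; first by rewrite divr_gt0.
move=> y; rewrite /ball_ /= => yx; apply: xP.
rewrite enorm_distC; apply: (le_lt_trans (enorm_le_norm _)).
move: yx; rewrite ltr_pdivlMr// mulrC; apply: le_lt_trans.
by rewrite ler_wpM2r// ler_nat mul1n.
Qed.

Lemma closureP_enorm d (A : set 'rV[R]_d) (x : 'rV[R]_d) :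
  closure A x <-> forall e : R, 0 < e -> exists2 y, A y & enorm (y - x) < e.
Proof.
split=> [xA e e0|xA B /nearE_enorm[e e0 eB]].
  have [] := xA [set y | enorm (y - x) < e]; first by apply/nearE_enorm; exists e.
  by move=> y [Ay yx]; exists y.
by have [y Ay yx] := xA _ e0; exists y; split => //; exact: eB.
Qed.

Lemma openP_enorm d (A : set 'rV[R]_d) :
  open A <-> forall x, A x -> exists2 e : R, 0 < e & forall y, enorm (y - x) < e -> A y.
Proof.
rewrite openE; split=> [oA x /oA /nearE_enorm//|oA x /oA xA].
exact/nearE_enorm.
Qed.

End euclidean_norm.

(** * Lebesgue measure in dimension d *)

Section lebesgue_theory.
Context {R : realType} (d : nat).
Local Notation E := 'rV[R]_d.
Implicit Types (A B : set E) (x v w : E).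

Definition box (l b : 'I_d -> R) : set E := [set x | forall i, l i <= x 0 i <= b i].

Definition cube (c : R) : set E := box (fun=> - c) (fun=> c).

Lemma measurable_entry_preimage (i : 'I_d) (B : set (measurableTypeR R)) :
  measurable B -> measurable [set x : E | B (x 0 i)].
Proof. by move=> mB; apply: sub_sigma_algebra; exists 0, i, B. Qed.

Lemma measurable_box l b : measurable (box l b).
Proof.
rewrite (_ : box l b = \bigcap_(i in [set: 'I_d]) [set x : E | `[l i, b i]%classic (x 0 i)]).
  by apply: fin_bigcap_measurable => // i _; apply: measurable_entry_preimage.
apply/seteqP; split => x /= h i; first by move=> _ /=; rewrite in_itv/=.
by have := h i I; rewrite /= in_itv.
Qed.

Lemma lebesgue_box0 l b i : b i < l i -> lebesgue d (box l b) = 0%E.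
Proof.
move=> bl; rewrite (_ : box l b = set0) ?measure0//.
apply/seteqP; split => // x /(_ i) /andP[lx xb].
by have := le_lt_trans (le_trans lx xb) bl; rewrite ltxx.
Qed.

Lemma cube_cover : \bigcup_(k : nat) cube k%:R = [set: E].
Proof.
apply/seteqP; split => // x _.
exists (Num.bound `|x|) => // i.
have xk : `|x 0 i| < (Num.bound `|x|)%:R.
  apply: le_lt_trans (archi_boundP _) => //.
  rewrite -[leRHS]/(mx_norm x) mx_normrE.
  exact: (le_bigmax _ (fun ij : 'I_1 * 'I_d => `|x ij.1 ij.2|) (0, i)).
by rewrite -ler_norml ltW.
Qed.

(** A Borel set of one coordinate is generated by half lines, and a half line in
    one coordinate is a countable union of boxes. *)
Lemma measurable_boxes :
  (@measurable _ E) = <<s [set A | exists l b, A = box l b] >>.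
Proof.
apply/seteqP; split; last first.
  apply: smallest_sub; first exact: sigma_algebra_measurable.
  by move=> _ [l [b ->]]; exact: measurable_box.
apply: smallest_sub; first exact: smallest_sigma_algebra.
move=> _ [i0 [i [B mB ->]]]; rewrite (ord1 i0) {i0}.
set G := <<s _ >>.
pose GT : measurableType _ := g_sigma_algebraType [set A | exists l b, A = box l b].
have mi : measurable_fun setT (fun x : GT => (x : E) 0 i : measurableTypeR R).
  apply: measurability; first exact: RGenCInfty.measurableE.
  move=> _ [_ [c ->] <-]; rewrite setTI.
  rewrite (_ : _ @^-1` _ = \bigcup_k box (fun j => if j == i then c else - k%:R)
      (fun=> k%:R)).
    apply: bigcup_measurable => k _; apply: sub_sigma_algebra.
    by do 2!eexists; reflexivity.
  apply/seteqP; split => x /=.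
    rewrite in_itv/= andbT => cx.
    have [k _ xk] : (\bigcup_k cube k%:R) x by rewrite cube_cover.
    exists k => // j; have /andP[h1 h2] := xk j.
    by rewrite h2 andbT; case: eqP => [->|].
  by case=> k _ /(_ i); rewrite eqxx in_itv/= andbT => /andP[].
by rewrite -[X in G X]setTI; exact: mi.
Qed.

Lemma measurable_shift v : measurable_fun setT (fun x => x + v).
Proof.
apply: (measurability (@entry_sets R 1 d)) => //.
move=> _ [_ [i [j [B mB ->]]] <-]; rewrite setTI (ord1 i).
rewrite (_ : _ @^-1` _ = [set x : E | ((fun r : R => r + v 0 j) @^-1` B) (x 0 j)]).
  apply: measurable_entry_preimage; rewrite -[X in measurable X]setTI.
  by apply: (measurable_funD _ _ _ mB) => //; exact: measurable_cst.
by apply/seteqP; split => x /=; rewrite mxE.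
Qed.

Lemma measurable_translate A v : measurable A -> measurable [set x | A (x - v)].
Proof.
by move=> mA; rewrite -[X in measurable X]setTI; exact: measurable_shift.
Qed.

Lemma box_translate l b v :
  [set x | box l b (x - v)] = box (fun i => l i + v 0 i) (fun i => b i + v 0 i).
Proof.
by apply/seteqP; split => x /= h i; have := h i; rewrite !mxE; lra.
Qed.

(** Both measures agree on boxes, which are stable under intersection and
    generate the sigma-algebra. *)
Lemma lebesgue_translate A v : measurable A ->
  lebesgue d [set x | A (x - v)] = lebesgue d A.
Proof.
move=> mA.
pose m2 := [the {measure set E -> \bar R} of
  pushforward (lebesgue d) (fun x : E => x - v)].
pose G := [set A | exists l b, A = box l b].
apply/esym.
apply: (@measure_unique _ _ _ G (fun k => cube k%:R) measurable_boxes _ _ _ _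
  (m2 (measurable_shift (- v)))) => //.
- move=> _ _ [l [b ->]] [l' [b' ->]].
  exists (fun i => Num.max (l i) (l' i)), (fun i => Num.min (b i) (b' i)).
  apply/seteqP; split => x /= h.
    by move=> i; case: h => /(_ i) h1 /(_ i) h2; rewrite ge_max le_min; lra.
  by split => i; have := h i; rewrite ge_max le_min; lra.
- by move=> k; do 2!eexists; reflexivity.
- exact: cube_cover.
- move=> _ [l [b ->]].
  rewrite -[RHS]/(lebesgue d [set x | box l b (x - v)]) box_translate.
  have [lb|] := pselect (forall i, l i <= b i).
    transitivity (\prod_i (b i - l i))%:E; first exact: lebesgue_box.
    rewrite lebesgue_box => [|i]; last by rewrite lerD2r.
    by congr (_%:E); apply: eq_bigr => i _; ring.
  move=> /existsNP[i /negP]; rewrite -ltNge => bl.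
  transitivity (0%E : \bar R); first exact: lebesgue_box0 bl.
  by rewrite (@lebesgue_box0 _ _ i)// ltrD2r.
- move=> k; rewrite [ltLHS]lebesgue_box ?ltry// => i.
  by rewrite -subr_ge0 opprK addr_ge0.
Qed.

(** An open set is the union of the boxes with rational corners that it
    contains. *)
Lemma open_measurable_row A : open A -> measurable A.
Proof.
move=> /openP_enorm oA.
pose lo (p : 'rV[rat]_d * nat) i : R := ratr (p.1 0 i).
pose hi (p : 'rV[rat]_d * nat) i : R := ratr (p.1 0 i) + p.2.+1%:R^-1.
pose F p := if `[< box (lo p) (hi p) `<=` A >] then box (lo p) (hi p) else set0.
rewrite (_ : A = \bigcup_p F p).
  apply: countable_bigcupT_measurable => // p; rewrite /F.
  by case: ifP => // _; exact: measurable_box.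
apply/seteqP; split => [x Ax|x [p _]]; last first.
  by rewrite /F; case: ifPn => // /asboolP pA /pA.
have [e e0 xeA] := oA _ Ax.
have e'0 : 0 < e / (1 * d.+1)%:R by rewrite divr_gt0// mul1n.
have [k ke] : exists k : nat, k.+1%:R^-1 < e / (1 * d.+1)%:R.
  exists (Num.truncn (e / (1 * d.+1)%:R)^-1).
  rewrite invf_plt ?posrE//.
  exact: truncnS_gt.
have /(_ _)/cid q_ i : exists q : rat, x 0 i - k.+1%:R^-1 <= ratr q <= x 0 i.
  have /rat_in_itvoo[q] : x 0 i - k.+1%:R^-1 < x 0 i by rewrite ltrBlDr ltrDl.
  by rewrite in_itv/= => /andP[h1 h2]; exists q; rewrite !ltW.
exists (\row_i sval (q_ i), k) => //; rewrite /F.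
have xbox : box (lo (\row_i sval (q_ i), k)) (hi (\row_i sval (q_ i), k)) x.
  move=> i; rewrite /lo /hi/= mxE; case: (q_ i) => q /=.
  by move: (k.+1%:R^-1 : R) => t; lra.
rewrite asboolT// => y ybox; apply: xeA.
apply: (le_lt_trans (enorm_le_norm _)).
apply: (@le_lt_trans _ _ ((1 * d.+1)%:R * k.+1%:R^-1)); last first.
  by rewrite mulrC -ltr_pdivlMr// mul1n.
apply: ler_pM => //; first by rewrite !mul1n ler_nat.
rewrite -[leLHS]/(mx_norm (y - x)) mx_normrE; apply/bigmax_leP; split=> // -[i j] _ /=.
rewrite (ord1 i) !mxE ler_norml.
have := xbox j; have := ybox j; rewrite /lo /hi/= mxE.
by move: (ratr _) => s; move: (k.+1%:R^-1 : R) => t; lra.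
Qed.

Lemma closed_measurable_row A : closed A -> measurable A.
Proof.
move=> cA; rewrite -(setCK A); apply: measurableC.
by apply: open_measurable_row; rewrite openC.
Qed.

Lemma eball_sub_cube c : @eball R d c `<=` cube c.
Proof.
move=> x xc i; rewrite -ler_norml; apply: (le_trans (enorm_entry _ _ _)).
exact: ltW.
Qed.

Definition bounded_measurable A := measurable A /\ exists c, A `<=` cube c.

Lemma lebesgue_bounded_fin A : bounded_measurable A -> lebesgue d A \is a fin_num.
Proof.
move=> [mA [c Ac]]; rewrite ge0_fin_numE//.
apply: (@le_lt_trans _ _ (lebesgue d (cube `|c|))).
  rewrite le_measure ?inE//; first exact: measurable_box.
  move=> x /Ac xc i; have := xc i; have := ler_norm c; lra.
rewrite lebesgue_box ?ltry// => i; rewrite -subr_ge0 opprK addr_ge0//.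
Qed.

Lemma volE A : bounded_measurable A -> (vol A)%:E = lebesgue d A.
Proof. by move=> bA; rewrite fineK// lebesgue_bounded_fin. Qed.

Lemma vol_ge0 A : 0 <= vol A.
Proof. exact: fine_ge0. Qed.

Lemma bounded_measurable_sub A B :
  measurable A -> A `<=` B -> bounded_measurable B -> bounded_measurable A.
Proof. by move=> mA AB [_ [c Bc]]; split=> //; exists c => x /AB/Bc. Qed.

Lemma vol_le A B : measurable A -> A `<=` B -> bounded_measurable B -> vol A <= vol B.
Proof.
move=> mA AB bB; rewrite -lee_fin !volE//; last exact: bounded_measurable_sub bB.
by rewrite le_measure ?inE//; exact: bB.1.
Qed.

Lemma bounded_measurable_translate A v :
  bounded_measurable A -> bounded_measurable [set x | A (x - v)].
Proof.
move=> [mA [c Ac]]; split; first exact: measurable_translate.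
exists (c + enorm v) => x /Ac xc i; have := xc i; rewrite !mxE.
have := enorm_entry v 0 i; rewrite ler_norml; lra.
Qed.

Lemma vol_translate A v : measurable A -> vol [set x | A (x - v)] = vol A.
Proof. by move=> mA; rewrite /vol lebesgue_translate. Qed.

Lemma volU A B : bounded_measurable A -> bounded_measurable B -> A `&` B = set0 ->
  vol (A `|` B) = vol A + vol B.
Proof.
move=> bA bB AB; rewrite /vol measureU ?fineD//; try exact: lebesgue_bounded_fin.
  exact: bA.1.
exact: bB.1.
Qed.

Lemma vol_fin_bigcup (I : choiceType) (D : set I) (F : I -> set E) :
  finite_set D -> trivIset D F -> (forall i, D i -> bounded_measurable (F i)) ->
  vol (\bigcup_(i in D) F i) = \sum_(i \in D) vol (F i).
Proof.
move=> fD tF bF; rewrite {1}/vol measure_fin_bigcup//; last by move=> i /bF[].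
rewrite (eq_fsbigr (fun i => (vol (F i))%:E)) ?fsumEFin// => i /set_mem/bF bFi.
by rewrite volE.
Qed.

(** The null set absorbs the points that are swept through the edges of a cell. *)
Lemma vol_sub_fsum (I : choiceType) (D : set I) (F : I -> set E) A N :
  finite_set D -> (forall i, D i -> bounded_measurable (F i)) ->
  bounded_measurable A -> measurable N -> lebesgue d N = 0%E ->
  A `<=` (\bigcup_(i in D) F i) `|` N -> vol A <= \sum_(i \in D) vol (F i).
Proof.
move=> fD bF bA mN N0 AFN.
have [mA _] := bA.
rewrite -lee_fin -fsumEFin// volE//.
rewrite (eq_fsbigr (fun i => lebesgue d (F i))); last first.
  by move=> i /set_mem Di; rewrite volE//; exact: bF.
rewrite (measureDI _ mA mN) [X in (_ + X)%E](_ : _ = 0%E) ?adde0.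
  apply: content_sub_fsum => //; [by move=> i /bF[] | exact: measurableD |].
  by move=> x [/AFN[]].
by apply: subset_measure0 N0 => //; exact: measurableI.
Qed.

Lemma vol_nondecreasing_cvg (F : nat -> set E) :
  (forall k, measurable (F k)) -> nondecreasing_seq F ->
  bounded_measurable (\bigcup_k F k) ->
  vol (F k) @[k --> \oo] --> vol (\bigcup_k F k).
Proof.
move=> mF ndF bF.
apply: fine_cvg; rewrite volE//.
by apply: nondecreasing_cvg_mu => //; exact: bF.1.
Qed.

Lemma lebesgue_bigcup0 (I : choiceType) (D : set I) (F : I -> set E) :
  finite_set D -> (forall i, D i -> measurable (F i)) ->
  (forall i, D i -> lebesgue d (F i) = 0%E) ->
  lebesgue d (\bigcup_(i in D) F i) = 0%E.
Proof.
move=> fD mF F0; apply/eqP; rewrite -measure_le0.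
apply: (@le_trans _ _ (\sum_(i \in D) lebesgue d (F i))%E).
  by apply: content_sub_fsum => //; exact: fin_bigcup_measurable.
by rewrite fsbig1// => i /F0.
Qed.

Lemma dot_continuous v : continuous (fun x : E => dot x v).
Proof.
move=> x; have Fx : Filter (nbhs x) := nbhs_filter x.
apply/cvgrPdist_lt => e e0; apply/nearE_enorm.
have v1 : 0 < enorm v + 1 by rewrite ltr_wpDl ?enorm_ge0.
exists (e / (enorm v + 1)); first by rewrite divr_gt0.
move=> y yx; rewrite -dotBl.
apply: (le_lt_trans (cauchy_schwarz_abs _ _)).
rewrite enorm_distC; move: yx; rewrite ltr_pdivlMr//; apply: le_lt_trans.
by rewrite ler_wpM2l ?enorm_ge0// lerDl.
Qed.

Lemma closed_hyperplane v c : closed [set x : E | dot x v = c].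
Proof.
apply: (@closed_comp _ _ (fun x : E => dot x v) [set c]).
  by move=> x _; exact: dot_continuous.
exact: closed_eq.
Qed.

Lemma hyperplane_null v c : v != 0 -> lebesgue d [set x : E | dot x v = c] = 0%E.
Proof.
move=> v0; set H := [set x | _].
have mH : measurable H by apply: closed_measurable_row; exact: closed_hyperplane.
have vv : 0 < dot v v.
  rewrite lt_neqAle dot_ge0 andbT eq_sym; apply: contra_neq v0; exact: dot_eq0.
have Hk k : vol (H `&` cube k%:R) = 0.
  set A := H `&` _.
  have bA : bounded_measurable A.
    by split; [apply: measurableI => //; exact: measurable_box | exists k%:R => x []].
  (* the translates of A by v / (j + 1) are disjoint and stay in a bounded set *)
  pose F (j : nat) := [set x | A (x - (j.+1%:R^-1 : R) *: v)].
  pose c' := k%:R + enorm v.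
  have bound n : vol A *+ n <= vol (cube c').
    have <- : vol (\bigcup_(j in `I_n) F j) = vol A *+ n.
      rewrite vol_fin_bigcup//; last 2 first.
      - apply/trivIsetP => i j _ _ ij; apply/seteqP; split => // x [[+ _] [+ _]].
        rewrite /H/= !dotBl !dotZl => h1 h2.
        have /eqP : (i.+1%:R^-1 - j.+1%:R^-1) * dot v v = 0.
          by have /addrI/oppr_inj e := etrans h1 (esym h2); rewrite mulrBl e subrr.
        rewrite mulf_eq0 (gt_eqF vv) orbF subr_eq0 => /eqP/invr_inj/eqP.
        by rewrite eqr_nat eqSS (negbTE ij).
      - by move=> j _; exact: bounded_measurable_translate.
      rewrite (eq_fsbigr (fun=> vol A)) => [|j _]; last first.
        by rewrite vol_translate//; exact: bA.1.
      rewrite fsbig_finite//= big_const_seq iter_addr_0 count_predT.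
      by rewrite (card_fset_set (card_eqxx `I_n)).
    apply: vol_le.
    - apply: fin_bigcup_measurable => // j _.
      by apply: measurable_translate; exact: bA.1.
    - move=> x [j _ [_ /= xk]] i; have := xk i; rewrite /c' /= !mxE.
      have : `|j.+1%:R^-1 * v 0 i| <= enorm v.
        rewrite normrM ger0_norm ?invr_ge0//.
        apply: le_trans (enorm_entry v 0 i).
        by rewrite ler_piMl// invf_le1 ?ler1n.
      by rewrite ler_norml; move: (j.+1%:R^-1 * v 0 i) => t; lra.
    - by split; [exact: measurable_box | exists c'].
  apply/eqP; rewrite eq_le vol_ge0 andbT leNgt; apply/negP => A0.
  have := bound (Num.truncn (vol (cube c') / vol A)).+1.
  rewrite leNgt -mulr_natl -ltr_pdivrMr//.
  by rewrite truncnS_gt.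
have <- : \bigcup_k (H `&` cube k%:R) = H by rewrite -setI_bigcupr cube_cover setIT.
set F := fun k : nat => H `&` cube k%:R.
have mF k : measurable (F k) by apply: measurableI => //; exact: measurable_box.
have <- : limn (lebesgue d \o F) = lebesgue d (\bigcup_k F k).
  apply/cvg_lim => //; apply: nondecreasing_cvg_mu => //.
    exact: bigcupT_measurable.
  move=> k l kl; apply/subsetPset; apply: setIS => x xk i; have := xk i.
  have : k%:R <= l%:R :> R by rewrite ler_nat.
  lra.
have -> : (lebesgue d \o F) = cst 0%E.
  apply/funext => k; rewrite /= -volE ?Hk//.
  by split => //; exists k%:R => x [].
exact: lim_cst.
Qed.

End lebesgue_theory.

(** * Volumes of prisms *)

(** A nonnegative additive function is monotone, and a monotone function that is
    linear on the rational numbers is linear. *)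
Lemma additive_ge0_linear {R : realType} (g : R -> R) :
  (forall t, 0 < t -> 0 <= g t) ->
  (forall s t, 0 < s -> 0 < t -> g (s + t) = g s + g t) ->
  forall t, 0 < t -> g t = t * g 1.
Proof.
move=> g0 gD.
have gM n t : 0 < t -> g (n.+1%:R * t) = n.+1%:R * g t.
  move=> t0; elim: n => [|n IH]; first by rewrite !mul1r.
  by rewrite -natr1 !mulrDl !mul1r gD ?IH// mulr_gt0.
have gmono s t : 0 < s -> s <= t -> g s <= g t.
  move=> s0; rewrite le_eqVlt => /predU1P[->//|st].
  by rewrite -(subrK s t) gD ?subr_gt0// lerDr g0// subr_gt0.
move=> t t0; apply/eqP; rewrite -subr_eq0; apply/negPn/negP => gt.
have d0 : 0 < `|g t - t * g 1| by rewrite normr_gt0.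
pose n := Num.truncn (g 1 / `|g t - t * g 1|).
have : g 1 < n.+1%:R * `|g t - t * g 1|.
  by rewrite -ltr_pdivrMr// truncnS_gt.
apply/negP; rewrite -leNgt -[X in X * _]ger0_norm// -normrM mulrBr -gM// mulrA.
have nt0 : 0 < n.+1%:R * t by rewrite mulr_gt0.
have /andP[kl ku] := truncn_itv (ltW nt0).
set k := Num.truncn _ in kl ku.
have g10 := g0 _ ltr01.
have lo : k%:R * g 1 <= g (n.+1%:R * t).
  case: k kl {ku} => [_|k kl]; first by rewrite mul0r g0.
  by rewrite -gM// mulr1 gmono.
have up : g (n.+1%:R * t) <= k.+1%:R * g 1 by rewrite -gM// mulr1 gmono// ltW.
have lo' : k%:R * g 1 <= n.+1%:R * t * g 1 by rewrite ler_wpM2r.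
have up' : n.+1%:R * t * g 1 <= k.+1%:R * g 1 by rewrite ler_wpM2r// ltW.
have kS : k.+1%:R * g 1 = k%:R * g 1 + g 1 by rewrite -natr1 mulrDl mul1r.
move: lo up lo' up'; rewrite ler_norml kS.
move: (k%:R * g 1) (g _) (_ * g 1) => p q q'; lra.
Qed.

Section prism.
Context {R : realType} {d : nat}.
Local Notation E := 'rV[R]_d.
Implicit Types (S : set E) (x v w n : E) (c t : R).

(** Half-open in the direction of [v], so that prisms over the same base stack
    without overlap. *)
Definition prism S v : set E := [set x | exists y t, [/\ S y, 0 < t <= 1 & x = y + t *: v]].

Lemma prism_translateD S v (s t : R) : 0 < s -> 0 < t ->
  prism S ((s + t) *: v) =
  prism S (s *: v) `|` [set x | prism S (t *: v) (x - s *: v)].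
Proof.
move=> s0 t0; have st0 : 0 < s + t by rewrite addr_gt0.
apply/seteqP; split => x.
  move=> [y [q [Sy /andP[q0 q1] ->]]].
  have [qs|qs] := leP (q * (s + t)) s.
    left; exists y, (q * (s + t) / s); split=> //.
      by rewrite divr_gt0 ?mulr_gt0// ler_pdivrMr// mul1r.
    by rewrite !scalerA; congr (_ + _ *: _); field; rewrite gt_eqF.
  right; exists y, ((q * (s + t) - s) / t); split=> //.
    rewrite divr_gt0 ?subr_gt0// ler_pdivrMr// mul1r.
    by rewrite lerBlDl -[leRHS]mul1r ler_pM2r.
  rewrite -addrA !scalerA -scalerBl; congr (_ + _ *: _).
  by field; rewrite gt_eqF.
case=> -[y [q [Sy /andP[q0 q1]]]].
  move=> ->; exists y, (q * s / (s + t)); split=> //.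
    rewrite divr_gt0 ?mulr_gt0// ler_pdivrMr// mul1r.
    by apply: (@le_trans _ _ s); [rewrite ler_piMl// ltW|rewrite lerDl ltW].
  by rewrite !scalerA; congr (_ + _ *: _); field; rewrite gt_eqF.
move=> /(canRL (subrK _)) ->; exists y, ((q * t + s) / (s + t)); split=> //.
  rewrite divr_gt0 ?addr_gt0 ?mulr_gt0// ler_pdivrMr// mul1r addrC.
  by rewrite lerD2l ler_piMl// ltW.
by rewrite -addrA !scalerA -scalerDl; congr (_ + _ *: _); field; rewrite gt_eqF.
Qed.

Lemma prism_sub_cube S v c : S `<=` cube c -> prism S v `<=` cube (c + enorm v).
Proof.
move=> Sc _ [y [t [/Sc yc /andP[t0 t1] ->]]] i; have := yc i; rewrite /= !mxE.
have : `|t * v 0 i| <= enorm v.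
  rewrite normrM gtr0_norm//; apply: le_trans (enorm_entry v 0 i).
  by rewrite ler_piMl.
by rewrite ler_norml; move: (t * v 0 i) => r; lra.
Qed.

Lemma prism_subset S S' v : S `<=` S' -> prism S v `<=` prism S' v.
Proof. by move=> SS' x [y [t [/SS' ? ? ?]]]; exists y, t. Qed.

Lemma prism_bigcup (F : nat -> set E) v : prism (\bigcup_k F k) v = \bigcup_k prism (F k) v.
Proof.
apply/seteqP; split => x; first by move=> [y [t [[k _ Fy] ? ?]]]; exists k => //; exists y, t.
by move=> [k _ [y [t [Fy ? ?]]]]; exists y, t; split=> //; exists k.
Qed.

Section transverse.
Variables (n : E) (c : R).
Local Notation H := [set x : E | dot x n = c].

Lemma prism_disjoint S v (s t : R) : S `<=` H -> 0 < dot v n -> 0 < s -> 0 < t ->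
  prism S (s *: v) `&` [set x | prism S (t *: v) (x - s *: v)] = set0.
Proof.
move=> SH vn s0 t0; apply/seteqP; split => // x [].
move=> [y [q [/SH yc /andP[q0 q1] ->]]] [z [p [/SH zc /andP[p0 p1]]]].
move=> /(congr1 (fun x => dot x n)); rewrite !(dotBl, dotDl, dotZl) yc zc => e.
have : 0 < p * (t * dot v n) by rewrite !mulr_gt0.
have : 0 <= (1 - q) * (s * dot v n).
  by rewrite mulr_ge0 ?subr_ge0// ltW// mulr_gt0.
by move: e; rewrite mulrBl mul1r; lra.
Qed.

Lemma measurable_prism S v : S `<=` H -> 0 < dot v n -> closed S ->
  measurable (prism S v).
Proof.
move=> SH vn cS.
pose s x := (dot x n - c) / dot v n.
have cs : continuous s.
  move=> x; have Fx : Filter (nbhs x) := nbhs_filter x.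
  by apply: cvgMl; apply: cvgB; [exact: dot_continuous | exact: cvg_cst].
rewrite (_ : prism S v = (s @^-1` [set y | 0 < y] `&` s @^-1` [set y | y <= 1]) `&`
    (fun x => x - s x *: v) @^-1` S).
  apply: measurableI; first apply: measurableI.
  - apply: open_measurable_row; apply: open_comp; first by move=> x _; exact: cs.
    exact: open_gt.
  - apply: closed_measurable_row; apply: closed_comp; first by move=> x _; exact: cs.
    exact: closed_le.
  - apply: closed_measurable_row; apply: closed_comp => // x _.
    have Fx : Filter (nbhs x) := nbhs_filter x.
    by apply: cvgB => //; apply: cvgZr_tmp; exact: cs.
apply/seteqP; split => x.
  move=> [y [t [Sy /andP[t0 t1] ->]]] /=.
  have -> : s (y + t *: v) = t.
    by rewrite /s dotDl dotZl (SH _ Sy); field; rewrite gt_eqF.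
  by rewrite t0 t1 addrK.
by rewrite /= => -[[s0 s1] ?]; exists (x - s x *: v), (s x);
  rewrite s0 s1 subrK.
Qed.

Lemma bounded_measurable_prism S v : S `<=` H -> 0 < dot v n -> closed S ->
  (exists b, S `<=` cube b) -> bounded_measurable (prism S v).
Proof.
move=> SH vn cS [b Sb]; split; first exact: measurable_prism.
by exists (b + enorm v); exact: prism_sub_cube.
Qed.

(** The layers [F k] exhaust the base [S] from inside, at distance [1 / (k + 1)]
    from its relative boundary: closed sets make the base measurable, and the
    distance leaves room for a shear. *)
Record inner_regular S (F : nat -> set E) : Prop := {
  ir_hyperplane : S `<=` H ;
  ir_bounded : exists b, S `<=` cube b ;
  ir_closed : forall k, closed (F k) ;
  ir_nondecreasing : nondecreasing_seq F ;
  ir_cover : \bigcup_k F k = S ;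
  ir_radius : forall k x y, F k x -> dot y n = c -> enorm (y - x) < k.+1%:R^-1 ->
    S y }.

Section inner_regular_prism.
Variables (S : set E) (F : nat -> set E).
Hypothesis SF : inner_regular S F.

Lemma inner_regular_sub k : F k `<=` S.
Proof. by rewrite -(ir_cover SF); exact: bigcup_sup. Qed.

Lemma bounded_measurable_layer k v : 0 < dot v n -> bounded_measurable (prism (F k) v).
Proof.
move=> vn; have FS := @inner_regular_sub k; apply: bounded_measurable_prism => //.
- exact: subset_trans FS (ir_hyperplane SF).
- exact: ir_closed SF k.
- by have [b Sb] := ir_bounded SF; exists b; exact: subset_trans Sb.
Qed.

Lemma bounded_measurable_inner_regular v : 0 < dot v n -> bounded_measurable (prism S v).
Proof.
move=> vn; split; last first.
  by have [b Sb] := ir_bounded SF; exists (b + enorm v); exact: prism_sub_cube.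
rewrite -(ir_cover SF) prism_bigcup; apply: bigcupT_measurable => k.
by case: (@bounded_measurable_layer k v vn).
Qed.

Lemma vol_prism_layer_cvg v : 0 < dot v n ->
  vol (prism (F k) v) @[k --> \oo] --> vol (prism S v).
Proof.
move=> vn; have /vol_nondecreasing_cvg : forall k, measurable (prism (F k) v).
  by move=> k; case: (@bounded_measurable_layer k v vn).
rewrite -prism_bigcup (ir_cover SF); apply.
  move=> k l kl; apply/subsetPset; apply: prism_subset.
  by apply/subsetPset; exact: ir_nondecreasing SF _ _ kl.
exact: bounded_measurable_inner_regular.
Qed.

End inner_regular_prism.

Lemma vol_prismZ S v t : S `<=` H -> 0 < dot v n ->
  (forall t : R, 0 < t -> bounded_measurable (prism S (t *: v))) -> 0 < t ->
  vol (prism S (t *: v)) = t * vol (prism S v).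
Proof.
move=> SH vn bS t0; rewrite -[in RHS](scale1r v).
apply: (@additive_ge0_linear R (fun t => vol (prism S (t *: v)))) => //.
  by move=> *; exact: vol_ge0.
move=> s q s0 q0; rewrite prism_translateD// volU//.
- by rewrite vol_translate//; case: (bS q q0).
- exact: bS.
- by apply: bounded_measurable_translate; exact: bS.
- exact: prism_disjoint.
Qed.

Lemma dotZ_gt0 v t : 0 < dot v n -> 0 < t -> 0 < dot (t *: v) n.
Proof. by move=> vn t0; rewrite dotZl mulr_gt0. Qed.

(** Cut both prisms into [N] slices. In one slice the two directions differ by at
    most [enorm (v - w) / N], so a thin prism over a layer at a larger distance
    from the relative boundary is contained in the thin prism over the whole
    base in the other direction. *)
Lemma vol_prism_shear_le S F v w : inner_regular S F -> 0 < dot v n ->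
  dot w n = dot v n -> vol (prism S v) <= vol (prism S w).
Proof.
move=> SF vn wv; have wn : 0 < dot w n by rewrite wv.
rewrite -(cvg_lim _ (vol_prism_layer_cvg SF vn))//.
apply: limr_le; first by apply/cvg_ex; eexists; exact: (vol_prism_layer_cvg SF vn).
apply: nearW => k.
pose N := (Num.truncn (enorm (v - w) * k.+1%:R)).+1.
have N0 : 0 < N%:R^-1 :> R by rewrite invr_gt0.
rewrite -(ler_pM2l N0) -!vol_prismZ//; last first.
- by move=> t t0; apply: bounded_measurable_layer (SF) _ _ _; exact: dotZ_gt0.
- exact: subset_trans (inner_regular_sub SF (k := k)) (ir_hyperplane SF).
- move=> t t0; apply: bounded_measurable_inner_regular (SF) _ _; exact: dotZ_gt0.
- exact: ir_hyperplane SF.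
apply: vol_le.
- by case: (bounded_measurable_layer SF k (dotZ_gt0 vn N0)).
- move=> x [y [t [Fy t01 ->]]].
  exists (y + (t * N%:R^-1) *: (v - w)), t; split => //; last first.
    by rewrite scalerBr !scalerA -addrA subrK.
  apply: (ir_radius SF Fy).
    rewrite dotDl dotZl dotBl wv subrr mulr0 addr0.
    exact: (ir_hyperplane SF) (inner_regular_sub SF Fy).
  rewrite addrC addKr enormZ ger0_norm ?mulr_ge0 ?ltW//; last by case/andP: t01.
  case/andP: t01 => t0 t1.
  apply: (@le_lt_trans _ _ (N%:R^-1 * enorm (v - w))).
    by rewrite ler_wpM2r ?enorm_ge0// ler_piMl// ltW.
  rewrite ltr_pdivrMl// ltr_pdivlMr// /N; exact: truncnS_gt.
- apply: bounded_measurable_inner_regular (SF) _ _; exact: dotZ_gt0.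
Qed.

(** The oblique prism is sheared into the right prism of direction
    [dot v n *: n], whose volume is proportional to its height. *)
Lemma vol_prism_shear S F v : enorm n = 1 -> inner_regular S F -> 0 < dot v n ->
  vol (prism S v) = dot v n * vol (prism S n).
Proof.
move=> n1 SF vn.
have nn : dot n n = 1 by rewrite -sqr_enorm_row n1 expr1n.
have n0 : 0 < dot n n by rewrite nn.
rewrite -vol_prismZ//; last 2 first.
- exact: ir_hyperplane SF.
- by move=> t t0; apply: bounded_measurable_inner_regular (SF) _ _; exact: dotZ_gt0.
apply/eqP; rewrite eq_le; apply/andP; split; apply: vol_prism_shear_le (SF) _ _.
- by [].
- by rewrite dotZl nn mulr1.
- by rewrite dotZl nn mulr1.
- by rewrite dotZl nn mulr1.
Qed.

Lemma inner_regular_measurable S F : inner_regular S F -> measurable S.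
Proof.
move=> SF; rewrite -(ir_cover SF); apply: bigcupT_measurable => k.
by apply: closed_measurable_row; exact: ir_closed SF k.
Qed.

Lemma closed_prismE S F : 0 < dot n n -> inner_regular S F ->
  let P := [set x | exists y t, [/\ S y, 0 <= t <= 1 & x = y + t *: n]] in
  P = prism S n `|` S.
Proof.
move=> n0 SF; apply/seteqP; split => x.
  move=> [y [t [Sy /andP[t0 t1] ->]]]; have [t0'|t0'] := ltP 0 t.
    by left; exists y, t; rewrite t0'.
  by right; rewrite (@le_anti _ _ t 0) ?t0 ?t0'// scale0r addr0.
case=> [[y [t [Sy /andP[t0 t1] ->]]]|Sx]; first by exists y, t; rewrite ltW.
by exists x, 0; rewrite lexx ler01 scale0r addr0.
Qed.

(** The two prisms differ by the base, which lies in a hyperplane. *)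
Lemma area_prism S F : enorm n = 1 -> inner_regular S F -> area n S = vol (prism S n).
Proof.
move=> n1 SF; have n0 : 0 < dot n n by rewrite -sqr_enorm_row n1 expr1n.
have SH := ir_hyperplane SF; have mS := inner_regular_measurable SF.
have n_neq0 : n != 0 by apply: contra_ltN n0 => /eqP ->; rewrite dot0l.
rewrite /area (closed_prismE n0 SF) volU.
- rewrite [X in _ + X](_ : _ = 0) ?addr0// /vol.
  by rewrite (@subset_measure0 _ _ _ _ _ H)//; [
    apply: closed_measurable_row; exact: closed_hyperplane | exact: hyperplane_null].
- exact: bounded_measurable_inner_regular SF _ n0.
- by split=> //; exact: ir_bounded SF.
- apply/seteqP; split => // x [[y [t [/SH yc /andP[t0 _] ->]]] /SH].
  rewrite /= dotDl dotZl yc => e.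
  have : 0 < t * dot n n by rewrite mulr_gt0.
  by move: e; lra.
Qed.

Lemma measurable_closed_prism S F : 0 < dot n n -> inner_regular S F ->
  measurable [set x | exists y t, [/\ S y, 0 <= t <= 1 & x = y + t *: n]].
Proof.
move=> n0 SF; rewrite (closed_prismE n0 SF); apply: measurableU.
  by case: (bounded_measurable_inner_regular SF n0).
exact: inner_regular_measurable SF.
Qed.

(** The prisms on the two sides of the base are translates of each other. *)
Lemma areaN S F : enorm n = 1 -> inner_regular S F -> area (- n) S = area n S.
Proof.
move=> n1 SF; have n0 : 0 < dot n n by rewrite -sqr_enorm_row n1 expr1n.
rewrite /area -[in RHS](vol_translate (- n)); last exact: measurable_closed_prism SF.
congr vol; apply/seteqP; split => x [y [t [Sy /andP[t0 t1] e]]];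
  exists y, (1 - t); rewrite subr_ge0 t1 gerBl t0; split=> //.
  by rewrite e opprK scalerBl scale1r scalerN [RHS]addrA addrAC.
by rewrite scalerN scalerBl scale1r opprB addrA -e opprK addrK.
Qed.

End transverse.
End prism.

(** * Polyhedra and meshes *)

Section half_spaces.
Context {R : realType} {d : nat}.
Local Notation E := 'rV[R]_d.
Implicit Types (x y z nu : E) (c : E * R * bool).

Definition half_space c : pred E := fun x => dot c.1.1 x < c.1.2 ?<= if c.2.

Lemma measurable_half_space c : measurable [set x | half_space c x].
Proof.
case: c => -[n r] [] /=.
  rewrite (_ : [set x | _] = (fun x => dot x n) @^-1` [set y | y <= r]).
    apply: closed_measurable_row; apply: closed_comp; last exact: closed_le.
    by move=> x _; exact: dot_continuous.
  by apply/seteqP; split => x; rewrite /half_space/= dotC.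
rewrite (_ : [set x | _] = (fun x => dot x n) @^-1` [set y | y < r]).
  apply: open_measurable_row; apply: open_comp; last exact: open_lt.
  by move=> x _; exact: dot_continuous.
by apply/seteqP; split => x; rewrite /half_space/= dotC.
Qed.

Definition polyhedron (s : seq (seq (E * R * bool))) : pred E :=
  fun x => has (all (half_space^~ x)) s.

Lemma measurable_polyhedron s : measurable [set x | polyhedron s x].
Proof.
elim: s => [|s0 s IH].
  by rewrite (_ : [set x | _] = set0); [exact: measurable0|apply/seteqP; split].
rewrite (_ : [set x | _] = [set x | all (half_space^~ x) s0] `|` [set x | polyhedron s x]).
  apply: measurableU => //; elim: s0 {IH} => [|c s0 IH].
    by rewrite (_ : [set x | _] = setT); [exact: measurableT|apply/seteqP; split].
  rewrite (_ : [set x | _] = [set x | half_space c x] `&` [set x | all (half_space^~ x) s0]).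
    by apply: measurableI => //; exact: measurable_half_space.
  by apply/seteqP; split => x /=; [move/andP|move=> -[-> ->]].
by apply/seteqP; split => x /=; rewrite /polyhedron/=; [move/orP|move=> [->|->]//; rewrite orbT].
Qed.

(** The local structure of a polyhedron at a point where all the active
    constraints have normals parallel to [nu]: only the side matters, and not
    the point. The positive product says that [y] and [z] lie strictly on the
    same side. *)
Definition side_constant x nu (b : pred E) := exists2 e : R, 0 < e &
  forall y z, enorm (y - x) < e -> enorm (z - x) < e ->
    0 < dot (y - x) nu * dot (z - x) nu -> b y = b z.

Lemma side_constant_op (op : bool -> bool -> bool) x nu (b b' : pred E) :
  side_constant x nu b -> side_constant x nu b' ->
  side_constant x nu (fun y => op (b y) (b' y)).
Proof.
move=> [e e0 be] [e' e'0 be']; exists (Num.min e e'); first by rewrite lt_min e0.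
move=> y z; rewrite !lt_min => /andP[y1 y2] /andP[z1 z2] yz.
by rewrite (be y z)// (be' y z).
Qed.

Lemma side_constant_cst x nu (b : bool) : side_constant x nu (fun=> b).
Proof. by exists 1. Qed.

Lemma side_constant_half_space x nu c :
  (dot c.1.1 x = c.1.2 -> exists t, c.1.1 = t *: nu) ->
  side_constant x nu (half_space c).
Proof.
case: c => -[n r] b /=; have [nx|nx] := eqVneq (dot n x) r.
  move=> /(_ nx)[t nt]; exists 1 => // y z _ _.
  have sideE w : half_space (n, r, b) w = (t * dot (w - x) nu < 0 ?<= if b).
    rewrite /half_space/= -nx -dotZr -nt dotBl dotC (dotC n) (dotC x).
    by case: b; rewrite /= ?subr_le0 ?subr_lt0 (dotC w).
  rewrite !sideE; set p := dot (y - x) nu; set q := dot (z - x) nu => pq.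
  have q0 : q != 0 by apply: contraTneq pq => ->; rewrite mulr0 ltxx.
  have p0 : p != 0 by apply: contraTneq pq => ->; rewrite mul0r ltxx.
  have pq0 : 0 < p / q.
    by rewrite (_ : p / q = p * q / q ^+ 2); [rewrite divr_gt0 ?exprn_even_gt0|field].
  have -> : t * p = (p / q) * (t * q) by field.
  by case: b {sideE}; rewrite /= ?(pmulr_rle0 _ pq0) ?(pmulr_rlt0 _ pq0).
move=> _; have n1 : 0 < enorm n + 1 by rewrite ltr_wpDl ?enorm_ge0.
have nx0 : 0 < `|dot n x - r| by rewrite normr_gt0 subr_eq0.
exists (`|dot n x - r| / (enorm n + 1)); first by rewrite divr_gt0.
suff sideE y : enorm (y - x) < `|dot n x - r| / (enorm n + 1) ->
    half_space (n, r, b) y = (dot n x < r).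
  by move=> y z yx zx _; rewrite !sideE.
rewrite ltr_pdivlMr// => yx.
have : `|dot n (y - x)| < `|dot n x - r|.
  apply: (le_lt_trans (cauchy_schwarz_abs _ _)); rewrite mulrC.
  by apply: le_lt_trans yx; rewrite ler_wpM2l ?enorm_ge0// lerDl.
rewrite dotBr /half_space/= => h.
have [nxr|rnx|/eqP] := ltgtP (dot n x) r; last by rewrite (negbTE nx).
  move: h; rewrite (ltr0_norm (_ : dot n x - r < 0)) ?subr_lt0// ltr_norml => /andP[_ h].
  by case: b => /=; lra.
move: h; rewrite (gtr0_norm (_ : 0 < dot n x - r)) ?subr_gt0// ltr_norml => /andP[h _].
by case: b => /=; apply/negbTE; rewrite -?ltNge -?leNgt; lra.
Qed.

Lemma side_constant_polyhedron x nu (s : seq (seq (E * R * bool))) :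
  (forall c, c \in flatten s -> dot c.1.1 x = c.1.2 -> exists t, c.1.1 = t *: nu) ->
  side_constant x nu (polyhedron s).
Proof.
elim: s => [|s0 s IH] sx; first exact: side_constant_cst.
apply: side_constant_op; last by apply: IH => c cs; apply: sx; rewrite mem_cat cs orbT.
have {sx IH} : forall c, c \in s0 -> dot c.1.1 x = c.1.2 -> exists t, c.1.1 = t *: nu.
  by move=> c cs; apply: sx; rewrite mem_cat cs.
elim: s0 => [|c s0 IH] sx; first exact: side_constant_cst.
apply: side_constant_op; last by apply: IH => c' cs; apply: sx; rewrite inE cs orbT.
by apply: side_constant_half_space; apply: sx; rewrite inE eqxx.
Qed.

End half_spaces.

Section mesh_facts.
Context {R : realType} {d : nat}.
Local Notation E := 'rV[R]_d.
Variables (cells : set (set E)) (nu : set E -> set E -> E) (h a : R).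
Hypotheses (mesh : is_mesh cells nu h a) (a0 : 0 < a).
Implicit Types (K L : set E) (x y z v e : E) (c : R).

Lemma mesh_size_gt0 : 0 < h. Proof. by case/andP: (mesh_size_bounds mesh). Qed.
Let h0 := mesh_size_gt0.

Lemma cell_measurable K : cells K -> measurable K.
Proof. by move=> /(mesh_polyhedral mesh)[s ->]; exact: measurable_polyhedron. Qed.

Lemma cell_diam K x y : cells K -> K x -> K y -> enorm (x - y) <= h.
Proof.
move=> cK Kx Ky; rewrite -lee_fin (mesh_size mesh).
apply: (@le_trans _ _ (diam K)); last by apply: ereal_sup_ubound; exists K.
by apply: ereal_sup_ubound; exists (x, y).
Qed.

Lemma cell_vol_gt0 K : cells K -> 0 < vol K.
Proof.
move=> /(mesh_volume mesh); apply: lt_le_trans.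
by rewrite mulr_gt0 ?exprn_gt0.
Qed.

Lemma cell_nonempty K : cells K -> K !=set0.
Proof.
move=> cK; apply/set0P/eqP => K0; have := cell_vol_gt0 cK.
by rewrite K0 /vol measure0 ltxx.
Qed.

(** In dimension 0 all the cells have diameter 0, and [h] is positive. *)
Lemma mesh_dim_gt0 : (0 < d)%N.
Proof.
rewrite lt0n; apply/eqP => d0; have := h0.
rewrite -lte_fin (mesh_size mesh) ltNge => /negP; apply.
apply: ub_ereal_sup => _ [K cK <-]; apply: ub_ereal_sup => _ [p _ <-].
rewrite lee_fin (_ : p.1 - p.2 = 0) ?enorm0//.
by apply/rowP => i; exfalso; move: i; rewrite d0 => -[].
Qed.

Lemma cell_bounded_measurable K : cells K -> bounded_measurable K.
Proof.
move=> cK; split; first exact: cell_measurable.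
have [x Kx] := cell_nonempty cK; exists (h + enorm x + 1) => y Ky.
apply: eball_sub_cube; rewrite /eball/=.
apply: (@le_lt_trans _ _ (h + enorm x)); last by rewrite ltrDl.
by rewrite -(subrK x y); apply: (le_trans (ler_enormD _ _)); rewrite lerD2r (cell_diam cK).
Qed.

Lemma cells_disjoint K L x : cells K -> cells L -> K x -> L x -> K = L.
Proof.
move=> cK cL Kx Lx; apply: contrapT => KL.
by have : (K `&` L) x by []; rewrite (mesh_disjoint mesh cK cL KL).
Qed.

Lemma sum_vol_cells (D : set (set E)) c : finite_set D -> D `<=` cells_in_ball cells c ->
  \sum_(K \in D) vol K <= vol (cube c : set E).
Proof.
move=> fD Dc; rewrite -vol_fin_bigcup//; last 2 first.
- apply/trivIsetP => K L DK DL KL; apply: (mesh_disjoint mesh).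
  + by case: (Dc _ DK).
  + by case: (Dc _ DL).
  + exact/eqP.
- by move=> K /Dc[cK _]; exact: cell_bounded_measurable.
apply: vol_le.
- by apply: fin_bigcup_measurable => // K /Dc[cK _]; exact: cell_measurable.
- move=> x [K DK Kx]; apply: eball_sub_cube; exact: (Dc K DK).2.
- by split; [exact: measurable_box | exists c].
Qed.

Lemma card_cells (D : set (set E)) c : finite_set D -> D `<=` cells_in_ball cells c ->
  #|` fset_set D|%:R * (a * h ^+ d) <= vol (cube c : set E).
Proof.
move=> fD Dc; apply: le_trans (sum_vol_cells fD Dc).
rewrite fsbig_finite//= mulr_natl.
have -> : (a * h ^+ d) *+ #|` fset_set D| = \sum_(K <- fset_set D) a * h ^+ d.
  by rewrite big_const_seq iter_addr_0 count_predT.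
rewrite big_seq [leRHS]big_seq; apply: ler_sum => K.
by rewrite in_fset_set// => /set_mem/Dc[cK _]; exact: mesh_volume mesh _ cK.
Qed.

(** The cells are disjoint and have a volume bounded below. *)
Lemma finite_cells_in_ball c : finite_set (cells_in_ball cells c).
Proof.
apply: contrapT => /infinite_set_fset inf.
have ah : 0 < a * h ^+ d by rewrite mulr_gt0 ?exprn_gt0.
have [B Bc sB] := inf (Num.truncn (vol (cube c : set E) / (a * h ^+ d))).+1.
have := card_cells (finite_fset B) Bc; rewrite set_fsetK -ler_pdivlMr// leNgt.
move/negP; apply; apply: (lt_le_trans (truncnS_gt _)).
by rewrite ler_nat.
Qed.

Lemma finite_cells_meeting c : finite_set [set K | cells K /\ K `&` eball c !=set0].
Proof.
apply: sub_finite_set (finite_cells_in_ball (c + h)) => K [cK [x [Kx xc]]].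
split=> // y Ky; rewrite /eball/= -(subrK x y).
apply: (le_lt_trans (ler_enormD _ _)); rewrite addrC.
by rewrite ltr_leD// (cell_diam cK).
Qed.

(** An open set contained in the closure of a cell meets the interior of that
    cell, because the cell lies in the closure of its interior; hence the
    closures of two distinct cells have no common interior. *)
Lemma closure_cells_overlap K L (U : set E) z : cells K -> cells L ->
  open U -> U z -> U `<=` closure K -> U `<=` closure L -> K = L.
Proof.
move=> cK cL oU Uz UK UL.
have [y [Ky Uy]] := UK z Uz U (open_nbhs_nbhs (conj oU Uz)).
have [w [wK Uw]] := mesh_regular mesh cK Ky (open_nbhs_nbhs (conj oU Uy)).
have /(_ K°)[] := UL w Uw.
  by apply: open_nbhs_nbhs; split; [exact: open_interior|].
move=> v [Lv /interior_subset Kv]; exact: cells_disjoint cK cL Kv Lv.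
Qed.

End mesh_facts.

(** * Interfaces *)

Section interfaces.
Context {R : realType} {d : nat}.
Local Notation E := 'rV[R]_d.
Variables (cells : set (set E)) (nu : set E -> set E -> E) (h a : R).
Hypotheses (mesh : is_mesh cells nu h a) (a0 : 0 < a).
Implicit Types (K L : set E) (x y z v e n : E) (c : R).

Lemma separatesP K L n x : separates K L n x <->
  exists2 e : R, 0 < e & forall y, enorm (y - x) < e ->
    (dot (y - x) n <= 0 -> closure K y) /\ (0 <= dot (y - x) n -> closure L y).
Proof. exact: nearE_enorm. Qed.

Lemma separatesN K L n x : separates K L n x -> separates L K (- n) x.
Proof.
move=> /separatesP[e e0 KL]; apply/separatesP; exists e => // y /KL[yK yL].
by rewrite dotNr oppr_le0 oppr_ge0.
Qed.

Lemma open_side n x : open [set y : E | 0 < dot (y - x) n].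
Proof.
rewrite (_ : [set y | _] = (fun y => dot y n) @^-1` [set r | dot x n < r]).
  by apply: open_comp; [move=> y _; exact: dot_continuous | exact: open_gt].
by apply/seteqP; split => y /=; rewrite dotBl subr_gt0.
Qed.

Lemma open_eball_at (x : E) (r : R) : open [set y : E | enorm (y - x) < r].
Proof.
apply/openP_enorm => y /= yx; exists (r - enorm (y - x)); first by rewrite subr_gt0.
move=> z; rewrite ltrBrDr; apply: le_lt_trans; exact: ler_enorm_dist.
Qed.

Lemma side_point_norm n x (s : R) : enorm n = 1 -> enorm (x + s *: n - x) = `|s|.
Proof. by move=> n1; rewrite addrC addKr enormZ n1 mulr1. Qed.

(** With two distinct normals, the direction [n' - n] points into a wedge that
    both closures contain. *)
Lemma separates_normal_uniq K L n n' x : cells K -> cells L -> K <> L ->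
  enorm n = 1 -> enorm n' = 1 -> separates K L n x -> separates K L n' x -> n = n'.
Proof.
move=> cK cL KL n1 n1' /separatesP[e e0 s] /separatesP[e' e'0 s'].
apply/eqP/negPn/negP => nn'.
have w0 : 0 < enorm (n' - n) by rewrite enorm_gt0// subr_eq0 eq_sym.
have nn : dot n n = 1 by rewrite -sqr_enorm_row n1 expr1n.
have nn'1 : dot n' n' = 1 by rewrite -sqr_enorm_row n1' expr1n.
have lt1 : dot n n' < 1.
  have : 0 < enorm (n' - n) ^+ 2 by rewrite exprn_gt0.
  by rewrite sqr_enorm_row !(dotBl, dotBr) nn nn'1 (dotC n' n); lra.
pose r := Num.min e e'; have r0 : 0 < r by rewrite lt_min e0.
pose t := r / 2 / enorm (n' - n); have t0 : 0 < t by rewrite !divr_gt0.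
pose U := [set y | 0 < dot (y - x) (- n)] `&` [set y | 0 < dot (y - x) n'] `&`
  [set y | enorm (y - x) < r].
apply: KL; apply: (closure_cells_overlap mesh (U := U) (z := x + t *: (n' - n))) => //.
- by do 2?apply: openI; [exact: open_side..|exact: open_eball_at].
- rewrite /U/= addrC addKr !dotZl dotNr !dotBl nn nn'1 (dotC n' n).
  split; [split|].
  + by rewrite pmulr_rgt0// opprB subr_gt0.
  + by rewrite pmulr_rgt0// subr_gt0.
  + rewrite enormZ gtr0_norm// /t divfK ?gt_eqF//; lra.
- move=> y [[/= yn _]]; rewrite /r lt_min => /andP[/s[+ _] _]; apply.
  by move: yn; rewrite dotNr; lra.
- by move=> y [[/= _ yn']]; rewrite /r lt_min => /andP[_ /s'[_ +]]; apply; exact: ltW.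
Qed.

Lemma interface_sym K L : interface K L = interface L K.
Proof.
by apply/seteqP; split => x [n n1 /separatesN s]; exists (- n) => //; rewrite enormN.
Qed.

Lemma neighbours_sym K L : cells K -> neighbours cells K L -> neighbours cells L K.
Proof. by move=> cK [cL LK]; rewrite interface_sym => ?; split=> //; exact/nesym. Qed.

Lemma nu_sym K L : cells K -> neighbours cells K L -> nu L K = - nu K L.
Proof.
move=> cK KL; have [cL LK [x xKL]] := KL.
have [n1 s _] := mesh_normal mesh cK KL.
have [n1' s' _] := mesh_normal mesh cL (neighbours_sym cK KL).
apply: (separates_normal_uniq cL cK LK _ _ (x := x)) => //.
- by rewrite enormN.
- by apply: s'; rewrite interface_sym.
- by apply: separatesN; exact: s.
Qed.

(** The points of the interface around which the two cells are the two sides of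
    the hyperplane within a uniform radius; they keep away from the edges. *)
Definition layer K L n c (k : nat) : set E :=
  [set x | dot x n = c /\ forall y, enorm (y - x) < k.+1%:R^-1 ->
    (dot (y - x) n <= 0 -> closure K y) /\ (0 <= dot (y - x) n -> closure L y)].

Lemma interface_inner_regular K L : cells K -> neighbours cells K L ->
  exists c, inner_regular (nu K L) c (interface K L) (layer K L (nu K L) c).
Proof.
move=> cK KL; have [cL LK [x0 x0KL]] := KL.
have [n1 sn plane] := mesh_normal mesh cK KL.
set n := nu K L in n1 sn plane *.
have hyp : interface K L `<=` [set x | dot x n = dot x0 n].
  by move=> x xKL; apply/eqP; rewrite -subr_eq0 -dotBl plane.
exists (dot x0 n); split => //.
- have [_ [b Kb]] := cell_bounded_measurable mesh a0 cK.
  exists (b + 1) => x /sn/separatesP[e e0 /(_ x)[]].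
    by rewrite subrr enorm0.
  rewrite subrr dot0l lexx => /(_ isT)/closureP_enorm/(_ 1 ltr01)[y /Kb yb yx] _ i.
  have := yb i; have := le_lt_trans (enorm_entry _ 0 i) yx.
  by rewrite !mxE ltr_norml; lra.
- move=> k; have r0 : 0 < k.+1%:R^-1 :> R by rewrite invr_gt0.
  move=> x /closureP_enorm xF.
  have xn : dot x n = dot x0 n.
    apply: (@closed_hyperplane R d n (dot x0 n)); apply/closureP_enorm => e /xF[y [yn _] yx].
    by exists y.
  split=> // y yx.
  have [|z [zn zF] zx] := xF (k.+1%:R^-1 - enorm (y - x)); first by rewrite subr_gt0.
  have -> : dot (y - x) n = dot (y - z) n by rewrite !dotBl xn zn.
  apply: zF; apply: (le_lt_trans (ler_enorm_dist _ x _)).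
  by rewrite (enorm_distC x) -ltrBrDl.
- move=> k l kl; apply/subsetPset => x [xn xk]; split=> // y yx; apply: xk.
  by apply: lt_le_trans yx _; rewrite lef_pV2 ?posrE// ler_nat.
- apply/seteqP; split => [x [k _ [xn xk]]|x xKL].
    exists n => //; by apply/separatesP; exists k.+1%:R^-1.
  have /separatesP[e e0 xe] := sn _ xKL.
  exists (Num.truncn e^-1) => //; split; first exact: hyp.
  move=> y yx; apply: xe; apply: (lt_trans yx).
  by rewrite invf_plt ?posrE//; exact: truncnS_gt.
- move=> k x y [xn xk] yn yx; exists n => //; apply/separatesP.
  exists (k.+1%:R^-1 - enorm (y - x)); first by rewrite subr_gt0.
  move=> z zy; have -> : dot (z - y) n = dot (z - x) n by rewrite !dotBl xn yn.
  apply: xk; apply: (le_lt_trans (ler_enorm_dist _ y _)).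
  by rewrite -ltrBrDr.
Qed.

Lemma area_sym K L : cells K -> neighbours cells K L ->
  area (nu L K) (interface L K) = area (nu K L) (interface K L).
Proof.
move=> cK KL; have [c reg] := interface_inner_regular cK KL.
have [n1 _ _] := mesh_normal mesh cK KL.
by rewrite (nu_sym cK KL) interface_sym; exact: areaN reg.
Qed.

Lemma area_ge0 n (S : set E) : 0 <= area n S.
Proof. exact: vol_ge0. Qed.

Lemma finite_neighbours K : cells K -> finite_set (neighbours cells K).
Proof.
move=> cK; have [x Kx] := cell_nonempty mesh a0 cK.
have [h0 _] := andP (mesh_size_bounds mesh).
apply: sub_finite_set (finite_cells_meeting mesh a0 (enorm x + h + 3)) => L [cL _].
case=> z [n _ /separatesP[e e0 /(_ z)]].
rewrite subrr enorm0 dot0l lexx => /(_ e0)[/(_ isT) zK /(_ isT) zL].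
split=> //.
have /closureP_enorm/(_ 1 ltr01)[y Ly yz] := zL.
have /closureP_enorm/(_ 1 ltr01)[w Kw wz] := zK.
exists y; split=> //; rewrite /eball/=.
have := ler_enorm_dist y z w; have := ler_enorm_dist y w x; have := cell_diam mesh cK Kw Kx.
have := ler_enormD (y - x) x; rewrite subrK (enorm_distC z w).
by lra.
Qed.

End interfaces.

(** * The boundary of a cell *)

Section boundary.
Context {R : realType} {d : nat}.
Local Notation E := 'rV[R]_d.
Variables (cells : set (set E)) (nu : set E -> set E -> E) (h a : R).
Hypotheses (mesh : is_mesh cells nu h a) (a0 : 0 < a).
Implicit Types (K L : set E) (x y z v n : E).

(** A hyperplane is given by a normal and an offset. *)
Definition crossing (p q : E * R) x :=
  [/\ p.1 != 0, q.1 != 0, ~ (exists t, q.1 = t *: p.1) &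
      dot p.1 x = p.2 /\ dot q.1 x = q.2].

(** The cell has interior points close to [z], hence points off the hyperplane
    through [z] orthogonal to [n]. *)
Lemma half_ball_in_cell K n z (r : R) : cells K -> enorm n = 1 -> 0 < r ->
  (forall y y', enorm (y - z) < r -> enorm (y' - z) < r ->
    0 < dot (y - z) n * dot (y' - z) n -> K y -> K y') ->
  closure K z ->
  let side s := forall y, enorm (y - z) < r -> 0 < s * dot (y - z) n -> K y in
  side 1 \/ side (-1).
Proof.
move=> cK n1 r0 Kr zK side.
have nn : dot n n = 1 by rewrite -sqr_enorm_row n1 expr1n.
have /closureP_enorm/(_ r r0)[y Ky yz] := zK.
have oI : nbhs y [set y | enorm (y - z) < r].
  by apply: open_nbhs_nbhs; split=> //; exact: open_eball_at.
have [w [wK /= wz]] := mesh_regular mesh cK Ky oI.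
have /nearE_enorm[e e0 we] : nbhs w K by exact: wK.
(* a point of K off the hyperplane through z orthogonal to n *)
have [w' [Kw' w'z w'n]] : exists w', [/\ K w', enorm (w' - z) < r & dot (w' - z) n != 0].
  have [wn|wn] := eqVneq (dot (w - z) n) 0; last by exists w; split=> //; exact: interior_subset.
  pose t := Num.min e (r - enorm (w - z)) / 2.
  have t0 : 0 < t by rewrite divr_gt0// lt_min e0 subr_gt0.
  have te : t < e /\ t < r - enorm (w - z).
    have : Num.min e (r - enorm (w - z)) <= e by rewrite ge_min lexx.
    have : Num.min e (r - enorm (w - z)) <= r - enorm (w - z) by rewrite ge_min lexx orbT.
    by move: t0; rewrite /t; lra.
  have wt : enorm (w + t *: n - w) = t by rewrite side_point_norm// gtr0_norm.
  exists (w + t *: n); split.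
  - by apply: we; rewrite wt; case: te.
  - apply: (le_lt_trans (ler_enorm_dist _ w _)); rewrite wt; case: te => _; lra.
  - by rewrite addrAC dotDl wn add0r dotZl nn mulr1 gt_eqF.
have [w'lt|w'gt|/eqP] := ltgtP (dot (w' - z) n) 0; last by rewrite (negbTE w'n).
  right => x xz; rewrite mulN1r oppr_gt0 => xn; apply: (Kr w') => //.
  by rewrite nmulr_rgt0.
by left => x xz; rewrite mul1r => xn; apply: (Kr w') => //; rewrite mulr_gt0.
Qed.

Lemma half_ball_closure (A : set E) n z (r : R) : enorm n = 1 -> 0 < r ->
  (forall y, enorm (y - z) < r -> 0 < dot (y - z) n -> A y) ->
  forall y, enorm (y - z) < r -> 0 <= dot (y - z) n -> closure A y.
Proof.
move=> n1 r0 Ar y yz yn; apply/closureP_enorm => e e0.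
have nn : dot n n = 1 by rewrite -sqr_enorm_row n1 expr1n.
pose t := Num.min e (r - enorm (y - z)) / 2.
have t0 : 0 < t by rewrite divr_gt0// lt_min e0 subr_gt0.
have te : t < e /\ t < r - enorm (y - z).
  have : Num.min e (r - enorm (y - z)) <= e by rewrite ge_min lexx.
  have : Num.min e (r - enorm (y - z)) <= r - enorm (y - z) by rewrite ge_min lexx orbT.
  by move: t0; rewrite /t; lra.
have yt : enorm (y + t *: n - y) = t by rewrite side_point_norm// gtr0_norm.
exists (y + t *: n); last by rewrite yt; case: te.
apply: Ar.
  apply: (le_lt_trans (ler_enorm_dist _ y _)); rewrite yt; case: te => _; lra.
by rewrite addrAC dotDl dotZl nn mulr1 ltr_wpDl.
Qed.

(** Near a point [z] of the closure of [K] that lies on a single hyperplane, each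
    of the two open half balls is contained in a cell: the closures of finitely
    many cells cover it, and a cell that meets it contains it. One of these two
    cells is [K], and the other one is a neighbour of [K] unless [z] is interior
    to the closure of [K]. *)
Lemma boundary_interface K : cells K -> exists Q : seq (E * R), forall z,
  closure K z -> ~ (closure K)° z ->
  (exists2 L, neighbours cells K L & interface K L z) \/
  (exists p q, [/\ p \in Q, q \in Q & crossing p q z]).
Proof.
move=> cK; have [x0 Kx0] := cell_nonempty mesh a0 cK.
pose near := [set L | cells L /\ L `&` eball (enorm x0 + h + 3) !=set0].
have fnear : finite_set near by exact: finite_cells_meeting mesh a0 _.
have /choice[S_ S_E] : forall L, exists s, cells L -> L = [set x | polyhedron s x].
  move=> L; have [/(mesh_polyhedral mesh)[s Ls]|nL] := pselect (cells L); last by exists [::].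
  by exists s.
pose C := flatten [seq flatten (S_ L) | L <- fset_set near].
exists [seq c.1 | c <- C] => z zK znI.
apply: contrapT => /not_orP[noL noQ].
have parallel p q : p \in C -> q \in C -> p.1.1 != 0 -> q.1.1 != 0 ->
    dot p.1.1 z = p.1.2 -> dot q.1.1 z = q.1.2 -> exists t, q.1.1 = t *: p.1.1.
  move=> pC qC p0 q0 pz qz; apply: contrapT => npar; apply: noQ.
  exists p.1, q.1; split; [exact: map_f|exact: map_f|by split].
have [n n1 act] : exists2 n : E, enorm n = 1 & forall c, c \in C -> dot c.1.1 z = c.1.2 ->
    exists t, c.1.1 = t *: n.
  have [[p [pC p0 pz]]|noact] :=
    pselect (exists p, [/\ p \in C, p.1.1 != 0 & dot p.1.1 z = p.1.2]).
    have p1 : enorm p.1.1 != 0 by rewrite gt_eqF// enorm_gt0.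
    exists ((enorm p.1.1)^-1 *: p.1.1).
      by rewrite enormZ ger0_norm ?invr_ge0 ?enorm_ge0// mulVf.
    move=> c cC cz; have [->|c0] := eqVneq c.1.1 0; first by exists 0; rewrite scale0r.
    have [t ->] := parallel _ _ pC cC p0 c0 pz cz.
    by exists (t * enorm p.1.1); rewrite scalerA mulfK.
  have d0 := mesh_dim_gt0 mesh.
  exists (delta_mx 0 (Ordinal d0)).
    rewrite enorm_row /dot (bigD1 (Ordinal d0))//= big1 ?addr0 => [|i /negbTE ne].
      by rewrite !mxE !eqxx mulr1 sqrtr1.
    by rewrite !mxE eqxx ne mul0r.
  move=> c cC cz; exists 0; rewrite scale0r; apply/eqP/negPn/negP => c0.
  by apply: noact; exists c.
have nn : dot n n = 1 by rewrite -sqr_enorm_row n1 expr1n.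
(* a radius that suits all the cells nearby *)
have [r [r0 r1 nearr]] : exists r : R, [/\ 0 < r, r <= 1 & forall L, near L -> forall y y',
    enorm (y - z) < r -> enorm (y' - z) < r -> 0 < dot (y - z) n * dot (y' - z) n -> L y -> L y'].
  have : forall L, L \in fset_set near -> near L by move=> L; rewrite in_fset_set// => /set_mem.
  have : {subset C <= C} by [].
  suff: forall s : seq (set E), (forall L, L \in s -> near L) ->
      {subset flatten [seq flatten (S_ L) | L <- s] <= C} ->
      exists r : R, [/\ 0 < r, r <= 1 & forall L, L \in s -> forall y y',
      enorm (y - z) < r -> enorm (y' - z) < r -> 0 < dot (y - z) n * dot (y' - z) n -> L y -> L y'].
    move=> /(_ (fset_set near)) H h1 h2; have [r [r0 r1 rP]] := H h2 h1.
    by exists r; split=> // L nL; apply: rP; rewrite in_fset_set// mem_set.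
  elim=> [|L s IH] sn sC; first by exists 1.
  have [||r [r0 r1 rs]] := IH.
  - by move=> L' L's; apply: sn; rewrite inE L's orbT.
  - by move=> c cs; apply: sC; rewrite /= mem_cat cs orbT.
  have [cL _] : near L by apply: sn; rewrite inE eqxx.
  have [|e e0 Le] := @side_constant_polyhedron R d z n (S_ L).
    by move=> c cL'; apply: act; apply: sC; rewrite /= mem_cat cL'.
  exists (Num.min r e); split; [by rewrite lt_min r0 | by rewrite ge_min r1 |].
  move=> L'; rewrite inE => /predU1P[->|L's] y y';
    rewrite !lt_min => /andP[y1 y2] /andP[y'1 y'2] yy'.
    by rewrite (S_E L cL)/= (Le y y').
  exact: rs.
have zx0 : enorm (z - x0) < h + 1.
  have /closureP_enorm/(_ 1 ltr01)[y Ky yz] := zK.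
  have := ler_enorm_dist z y x0; rewrite (enorm_distC z y).
  by have := cell_diam mesh cK Ky Kx0; lra.
have near_near L y : cells L -> L y -> enorm (y - z) < 1 -> near L.
  move=> cL Ly yz; split=> //; exists y; split=> //; rewrite /eball/=.
  by have := ler_enorm_dist y z x0; have := ler_enormD (y - x0) x0; rewrite subrK; lra.
have nearK : near K.
  have /closureP_enorm/(_ 1 ltr01)[y Ky yz] := zK; exact: near_near Ky yz.
(* the half ball on the side s is contained in some cell *)
have cover s : s * s = 1 -> exists2 L, cells L &
    forall y, enorm (y - z) < r -> 0 < s * dot (y - z) n -> L y.
  move=> ss; have s1 : `|s| = 1.
    by apply/eqP; rewrite -sqrp_eq1// real_normK ?num_real// expr2 ss.
  pose w := z + (r / 2 * s) *: n.
  have wz : enorm (w - z) < r by rewrite side_point_norm// normrM s1 mulr1 gtr0_norm; lra.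
  have wn : 0 < s * dot (w - z) n.
    by rewrite addrC addKr dotZl nn mulr1 mulrCA ss; lra.
  have [L cL Lw] : exists2 L, cells L & closure L w.
    by have : (\bigcup_(K in cells) closure K) w by rewrite (mesh_cover mesh).
  pose U := [set y | enorm (y - z) < r] `&` [set y : E | 0 < dot (y - z) (s *: n)].
  have [y [Ly [yz yn]]] : L `&` U !=set0.
    apply: Lw; apply: open_nbhs_nbhs; split; last by split=> //=; rewrite dotZr.
    by apply: openI; [exact: open_eball_at | exact: open_side].
  exists L => // x xz xn; apply: (nearr L _ y) => //.
    by apply: near_near Ly _ => //; apply: lt_le_trans yz r1.
  move: yn; rewrite /= dotZr => yn.
  have : 0 < (s * dot (y - z) n) * (s * dot (x - z) n) by rewrite mulr_gt0.
  by rewrite mulrACA ss mul1r.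
have cover1 (s : R) : s * s = 1 ->
    (forall y, enorm (y - z) < r -> 0 < s * dot (y - z) n -> K y) -> False.
  move=> ss Ks; have [|L cL Ls] := cover (- s); first by rewrite mulrNN.
  have s1 : `|s| = 1.
    by apply/eqP; rewrite -sqrp_eq1// real_normK ?num_real// expr2 ss.
  have ns1 : enorm (s *: n) = 1 by rewrite enormZ s1 mul1r.
  have clK y : enorm (y - z) < r -> 0 <= s * dot (y - z) n -> closure K y.
    rewrite -dotZr; apply: half_ball_closure => // w wz; rewrite dotZr; exact: Ks.
  have clL y : enorm (y - z) < r -> s * dot (y - z) n <= 0 -> closure L y.
    move=> yz yn; apply: (@half_ball_closure _ (- s *: n) z r) => //.
    - by rewrite enormZ normrN s1 mul1r.
    - by move=> w wz; rewrite dotZr; exact: Ls.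
    - by rewrite dotZr mulNr oppr_ge0.
  have [LK|LK] := pselect (L = K).
    apply: znI; apply/nearE_enorm; exists r => // y yz.
    have [/clK|/ltW/clL] := leP 0 (s * dot (y - z) n); first exact.
    by rewrite LK; exact.
  have KL : interface K L z.
    exists (- (s *: n)); first by rewrite enormN.
    apply/separatesP; exists r => // y yz; rewrite dotNr dotZr oppr_le0 oppr_ge0.
    by split=> yn; [exact: clK | exact: clL].
  by apply: noL; exists L => //; split=> //; exists z.
have [] := half_ball_in_cell cK n1 r0 (nearr K nearK) zK.
  by apply: cover1; rewrite mulr1.
by apply: cover1; rewrite mulrNN mulr1.
Qed.

End boundary.

(** * The discrete divergence theorem *)

Section divergence.
Context {R : realType} {d : nat}.
Local Notation E := 'rV[R]_d.
Variables (cells : set (set E)) (nu : set E -> set E -> E) (h a : R).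
Hypotheses (mesh : is_mesh cells nu h a) (a0 : 0 < a).
Implicit Types (K L M : set E) (x y z v e n : E).

Definition swept M v : R := vol [set x | M (x - v) /\ ~ M x].

(** The two swept sets are [M + v] and [M - v] without [M]; the intersections
    of these translates with [M] are translates of each other. *)
Lemma sweptN M v : bounded_measurable M -> swept M (- v) = swept M v.
Proof.
move=> bM; have mM := bM.1.
have bT w := bounded_measurable_translate w bM.
have sweptE w : swept M w = vol M - vol ([set x | M (x - w)] `&` M).
  have mD : measurable ([set x | M (x - w)] `\` M) by apply: measurableD => //; case: (bT w).
  have mI : measurable ([set x | M (x - w)] `&` M) by apply: measurableI => //; case: (bT w).
  rewrite -[in RHS](vol_translate w mM).
  rewrite -[X in vol X - _](setDUK (A := [set x | M (x - w)] `&` M)) //.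
  rewrite volU; first by rewrite addrAC subrr add0r; congr vol; apply/seteqP; split => x /=; tauto.
  - by apply: bounded_measurable_sub (bT w).
  - by apply: bounded_measurable_sub (bT w); [apply: measurableD => //; case: (bT w)|].
  - by rewrite setDE setICA setICr setI0.
rewrite !sweptE; congr (_ - _).
rewrite -(vol_translate v); last by apply: measurableI => //; case: (bT (- v)).
by congr vol; apply/seteqP; split => x /=; rewrite opprK subrK => -[].
Qed.

Definition flux K e L : R := dot e (nu K L) * area (nu K L) (interface K L).
Definition outflow K e : set (set E) := [set L | neighbours cells K L /\ 0 < dot e (nu K L)].

Lemma finite_outflow K e : cells K -> finite_set (outflow K e).
Proof.
by move=> cK; apply: sub_finite_set (finite_neighbours mesh a0 cK) => L [].
Qed.

Lemma bounded_measurable_closure K : cells K -> bounded_measurable (closure K).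
Proof.
move=> cK; split; first by apply: closed_measurable_row; exact: closed_closure.
have [_ [b Kb]] := cell_bounded_measurable mesh a0 cK; exists (b + 1) => x.
move=> /closureP_enorm/(_ 1 ltr01)[y /Kb yb yx] i; have := yb i.
have := le_lt_trans (enorm_entry _ 0 i) yx.
by rewrite !mxE ltr_norml; lra.
Qed.

Lemma bounded_measurable_interface_prism K L e : cells K -> outflow K e L ->
  bounded_measurable (prism (interface K L) e).
Proof.
move=> cK [KL eKL]; have [c reg] := interface_inner_regular mesh a0 cK KL.
exact: bounded_measurable_inner_regular reg _ eKL.
Qed.

Lemma vol_interface_prism K L e t : cells K -> outflow K e L -> 0 < t ->
  vol (prism (interface K L) (t *: e)) = t * flux K e L.
Proof.
move=> cK [KL eKL] t0; have [c reg] := interface_inner_regular mesh a0 cK KL.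
have [n1 _ _] := mesh_normal mesh cK KL.
rewrite (vol_prism_shear n1 reg) ?(dotZ_gt0 eKL)//.
by rewrite /flux (area_prism n1 reg) dotZl mulrA.
Qed.

(** A hyperplane that contains the translates along [e] of the intersection of
    two transverse hyperplanes: the combination [w] of the two normals is
    orthogonal to [e], and if it vanishes both hyperplanes are parallel to
    [e]. *)
Definition crossing_shadow e (pq : (E * R) * (E * R)) : set E :=
  let: (p, q) := pq in
  let w := dot e q.1 *: p.1 - dot e p.1 *: q.1 in
  if w == 0 then [set x | dot x p.1 = p.2]
  else [set x | dot x w = dot e q.1 * p.2 - dot e p.1 * q.2].

Lemma crossing_shadowP e p q z t : crossing p q z ->
  crossing_shadow e (p, q) (z + t *: e).
Proof.
move=> [p0 q0 npar [zp zq]]; rewrite /crossing_shadow; case: ifPn => [/eqP w0|w0] /=.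
  have pe : dot e p.1 = 0.
    apply: contrapT => /eqP pe; apply: npar; exists (dot e q.1 / dot e p.1).
    move/eqP: w0; rewrite subr_eq0 => /eqP/(congr1 (fun x => (dot e p.1)^-1 *: x)).
    by rewrite !scalerA mulVf// scale1r mulrC.
  by rewrite dotDl dotZl pe mulr0 addr0 dotC.
rewrite dotDl dotZl !dotBr !dotZr (dotC z) (dotC z) zp zq; ring.
Qed.

Lemma measurable_crossing_shadow e pq : measurable (crossing_shadow e pq).
Proof.
case: pq => p q; rewrite /crossing_shadow; case: ifP => _;
  by apply: closed_measurable_row; exact: closed_hyperplane.
Qed.

Lemma crossing_shadow_null e p q : p.1 != 0 -> lebesgue d (crossing_shadow e (p, q)) = 0%E.
Proof.
by move=> p0; rewrite /crossing_shadow; case: ifPn => w0; exact: hyperplane_null.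
Qed.

(** On its way out, a swept point leaves the closure of the cell for the last
    time at a boundary point: on an interface, where [e] must point outwards,
    or on a crossing of two hyperplanes, whose translates have measure zero. *)
Lemma swept_le K e t : cells K -> 0 < t ->
  swept (closure K) (t *: e) <= t * \sum_(L \in outflow K e) flux K e L.
Proof.
move=> cK t0; have [Q QP] := boundary_interface mesh a0 cK.
have fO := finite_outflow e cK.
pose PQ := [seq pq <- allpairs pair Q Q | pq.1.1 != 0].
pose N := \bigcup_(pq in [set` PQ]) crossing_shadow e pq.
have tO L : outflow K e L -> outflow K (t *: e) L.
  by move=> [KL eKL]; split=> //; exact: dotZ_gt0.
rewrite mulr_fsumr//.
rewrite (eq_fsbigr (fun L => vol (prism (interface K L) (t *: e)))); last first.
  by move=> L /set_mem OL; rewrite vol_interface_prism.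
have bM := bounded_measurable_closure cK.
have cM : closed (closure K) := @closed_closure _ K.
apply: (vol_sub_fsum (N := N)) => //.
- by move=> L OL; apply: bounded_measurable_interface_prism => //; exact: tO.
- rewrite (_ : [set x | _] = [set x | closure K (x - t *: e)] `\` closure K)//.
  have bT := bounded_measurable_translate (t *: e) bM.
  by apply: bounded_measurable_sub (bT) => //; apply: measurableD; [case: bT|case: bM].
- by apply: fin_bigcup_measurable => // pq _; exact: measurable_crossing_shadow.
- apply: lebesgue_bigcup0; first exact: finite_seq.
    by move=> pq _; exact: measurable_crossing_shadow.
  by move=> [p q]; rewrite /= mem_filter => /andP[p0 _]; exact: crossing_shadow_null.
move=> x [xK xnK].
(* z is the last point of the closure of K on the segment from x - t e to x *)
pose A := [set s : R | 0 <= s <= t /\ closure K (x - t *: e + s *: e)].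
have A0 : A 0 by split; rewrite ?lexx ?ltW// scale0r addr0.
have supA : has_sup A by split; [exists 0|exists t => s [/andP[]]].
set s := sup A; have s0 : 0 <= s by apply: ub_le_sup => //; case: supA.
have st : s <= t by apply: ge_sup => // [|y [/andP[]]//]; exists 0.
have As : closure K (x - t *: e + s *: e).
  apply: cM; apply/closureP_enorm => r r0.
  have e1 : 0 < enorm e + 1 by rewrite ltr_wpDl ?enorm_ge0.
  have [s' [s't Ks'] s's] := sup_adherent (divr_gt0 r0 e1) supA.
  exists (x - t *: e + s' *: e) => //.
  rewrite opprD addrACA subrr add0r -scalerBl enormZ.
  have s's0 : s' <= s by apply: ub_le_sup => //; case: supA.
  rewrite distrC ger0_norm ?subr_ge0//.
  apply: (@le_lt_trans _ _ ((s - s') * (enorm e + 1))).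
    by rewrite ler_wpM2l ?subr_ge0// lerDl.
  by rewrite -ltr_pdivlMr// ltrBlDl -ltrBlDr.
set z := x - t *: e + s *: e in As.
have after q : s < q -> q <= t -> ~ closure K (z + (q - s) *: e).
  move=> sq qt; rewrite /z -[in X in closure K X]addrA -scalerDl addrCA subrr addr0 => Kq.
  have : A q by split=> //; rewrite qt (le_trans s0)// ltW.
  by move/(ub_le_sup (proj2 supA)); rewrite leNgt sq.
have xz : x = z + (t - s) *: e.
  by rewrite /z -addrA -scalerDl addrCA subrr addr0 subrK.
have {}st : s < t.
  rewrite lt_neqAle st andbT; apply: contra_notN xnK => /eqP st'.
  by rewrite xz st' subrr scale0r addr0.
have small r : 0 < r -> exists q, [/\ s < q, q <= t & enorm ((q - s) *: e) < r].
  move=> r0; have e1 : 0 < enorm e + 1 by rewrite ltr_wpDl ?enorm_ge0.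
  pose q := s + Num.min (t - s) (r / (enorm e + 1)).
  have m0 : 0 < Num.min (t - s) (r / (enorm e + 1)).
    by rewrite lt_min subr_gt0 st divr_gt0.
  exists q; split.
  - by rewrite ltrDl.
  - by rewrite -lerBrDl ge_min lexx.
  rewrite addrC addKr enormZ gtr0_norm//.
  apply: (@lt_le_trans _ _ (Num.min (t - s) (r / (enorm e + 1)) * (enorm e + 1))).
    by rewrite ltr_pM2l// ltrDl.
  by rewrite -ler_pdivlMr// ge_min lexx orbT.
have znI : ~ (closure K)° z.
  move=> /nearE_enorm[r r0 zr]; have [q [sq qt qr]] := small r r0.
  by apply: (after q) => //; apply: zr; rewrite addrC addKr.
have [[L KL zL]|[p [q [pQ qQ pqz]]]] := QP z As znI; [left|right].
  have [n1 sn _] := mesh_normal mesh cK KL.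
  exists L; last first.
    exists z, ((t - s) / t); split=> //.
      by rewrite divr_gt0 ?subr_gt0// ler_pdivrMr// mul1r gerBl.
    by rewrite scalerA divfK ?gt_eqF.
  split=> //; rewrite ltNge; apply/negP => en.
  have /separatesP[r r0 zr] := sn z zL; have [q [sq qt qr]] := small r r0.
  apply: (after q) => //; apply: (zr _ _).1; rewrite addrC addKr// dotZl.
  by rewrite pmulr_rle0// subr_gt0.
exists (p, q); last by rewrite xz; exact: crossing_shadowP.
rewrite /= mem_filter /=; case: pqz => -> _ _ _ /=.
by apply/allpairsP; exists (p, q).
Qed.


Lemma layer_prism_inside K L n c k v x : cells K -> neighbours cells K L ->
  0 < dot v n -> enorm v < k.+1%:R^-1 -> prism (layer K L n c k) v x ->
  closure K (x - v) /\ exists U : set E, [/\ open U, U x & U `<=` closure L].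
Proof.
move=> cK KL vn vk [y [q [[yn yk] /andP[q0 q1] xE]]]; split.
  have -> : x - v = y + (1 - q) *: (- v).
    by rewrite xE scalerN scalerBl scale1r opprB addrA addrAC.
  apply: (yk _ _).1; rewrite addrC addKr.
    rewrite enormZ enormN ger0_norm ?subr_ge0//.
    by apply: le_lt_trans vk; rewrite ler_piMl ?enorm_ge0// gerBl ltW.
  by rewrite dotZl dotNl mulrN oppr_le0 mulr_ge0 ?subr_ge0// ltW.
exists ([set z | enorm (z - y) < k.+1%:R^-1] `&` [set z | 0 < dot (z - y) n]); split.
- by apply: openI; [exact: open_eball_at|exact: open_side].
- split; rewrite /= xE addrC addKr; last by rewrite dotZl mulr_gt0.
  rewrite enormZ gtr0_norm//; apply: le_lt_trans vk.
  by rewrite ler_piMl ?enorm_ge0.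
- by move=> z [/yk[_ +] zn]; apply; exact: ltW.
Qed.

(** While the translation is shorter than the radius of the layer, the prisms
    over the layers stay in the neighbours, so that they are disjoint and
    outside the cell, and they come from the cell. *)
Lemma swept_ge K e k t (c : set E -> R) : cells K ->
  (forall L, neighbours cells K L -> inner_regular (nu K L) (c L) (interface K L)
    (layer K L (nu K L) (c L))) ->
  0 < t -> enorm (t *: e) < k.+1%:R^-1 ->
  t * \sum_(L \in outflow K e) vol (prism (layer K L (nu K L) (c L) k) e) <=
  swept (closure K) (t *: e).
Proof.
move=> cK reg t0 tk; have fO := finite_outflow e cK.
pose P L := prism (layer K L (nu K L) (c L) k) (t *: e).
have bP L : outflow K e L -> bounded_measurable (P L).
  by move=> [KL eKL]; apply: bounded_measurable_layer (reg L KL) _ _ _; exact: dotZ_gt0.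
rewrite mulr_fsumr//.
rewrite (eq_fsbigr (fun L => vol (P L))) => [|L /set_mem[KL eKL]]; last first.
  rewrite (@vol_prismZ _ _ (nu K L) (c L))//.
  - exact: subset_trans (@inner_regular_sub _ _ _ _ _ _ (reg L KL) k) (ir_hyperplane (reg L KL)).
  - move=> q q0; apply: bounded_measurable_layer (reg L KL) _ _ _; exact: dotZ_gt0.
have inside L x : outflow K e L -> P L x -> closure K (x - t *: e) /\
    exists U : set E, [/\ open U, U x & U `<=` closure L].
  move=> [KL eKL]; apply: layer_prism_inside => //; exact: dotZ_gt0.
rewrite -vol_fin_bigcup//; last first.
  apply/trivIsetP => L L' OL OL' /eqP LL'; apply/seteqP; split => // x [PL PL'].
  have [_ [U [oU Ux UL]]] := inside L x OL PL.
  have [_ [U' [oU' Ux' UL']]] := inside L' x OL' PL'.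
  apply: LL'; apply: (closure_cells_overlap mesh (U := U `&` U') (z := x)).
  - by case: OL => -[].
  - by case: OL' => -[].
  - exact: openI.
  - by [].
  - by move=> z [/UL].
  - by move=> z [_ /UL'].
have bM := bounded_measurable_closure cK.
have bT := bounded_measurable_translate (t *: e) bM.
apply: vol_le; first by apply: fin_bigcup_measurable => // L /bP[].
  move=> x [L OL PL]; have [xK [U [oU Ux UL]]] := inside L x OL PL; split=> // Kx.
  have [[cL LK _] _] := OL; apply: LK.
  have [y [Ky Uy]] := Kx U (open_nbhs_nbhs (conj oU Ux)).
  have [w [wK Uw]] := mesh_regular mesh cK Ky (open_nbhs_nbhs (conj oU Uy)).
  apply: (closure_cells_overlap mesh (U := U `&` K°) (z := w)) => //.
  - by apply: openI => //; exact: open_interior.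
  - by move=> z [/UL].
  - by move=> z [_ /interior_subset]; exact: subset_closure.
rewrite (_ : [set x | _] = [set x | closure K (x - t *: e)] `\` closure K)//.
by apply: bounded_measurable_sub (bT) => //; apply: measurableD; [case: bT|case: bM].
Qed.

(** The volumes swept by [t e] and by [- t e] agree; the first one is bounded
    above by the faces, the second one is bounded below by their layers, which
    exhaust them. *)
Lemma outflow_le K e : cells K ->
  \sum_(L \in outflow K (- e)) flux K (- e) L <= \sum_(L \in outflow K e) flux K e L.
Proof.
move=> cK; have fO := finite_outflow (- e) cK.
have /choice[c reg] : forall L, exists c, neighbours cells K L ->
    inner_regular (nu K L) c (interface K L) (layer K L (nu K L) c).
  move=> L; have [KL|nKL] := pselect (neighbours cells K L); last by exists 0.
  by have [c ?] := interface_inner_regular mesh a0 cK KL; exists c.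
pose V k := \sum_(L \in outflow K (- e)) vol (prism (layer K L (nu K L) (c L) k) (- e)).
have cvgV : V k @[k --> \oo] --> \sum_(L \in outflow K (- e)) flux K (- e) L.
  rewrite /V fsbig_finite//=.
  rewrite (_ : (fun k => _) = (fun k => \sum_(L <- fset_set (outflow K (- e)))
      vol (prism (layer K L (nu K L) (c L) k) (- e)))); last first.
    by apply/funext => k; rewrite fsbig_finite.
  rewrite big_seq; under eq_fun do rewrite big_seq.
  apply: cvg_big; first exact: add_continuous.
  move=> L; rewrite in_fset_set// => /set_mem OL; have [KL eKL] := OL.
  rewrite -[flux _ _ _]mul1r -vol_interface_prism// scale1r.
  exact: vol_prism_layer_cvg (reg L KL) _ eKL.
rewrite -(cvg_lim _ cvgV)//; apply: limr_le.
  by apply/cvg_ex; eexists; exact: cvgV.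
apply: nearW => k.
pose t := k.+1%:R^-1 / (enorm e + 1).
have e1 : 0 < enorm e + 1 by rewrite ltr_wpDl ?enorm_ge0.
have t0 : 0 < t by rewrite divr_gt0 ?invr_gt0.
rewrite -(ler_pM2l t0); apply: le_trans (swept_le e cK t0).
rewrite -(sweptN (t *: e) (bounded_measurable_closure cK)) -scalerN.
apply: swept_ge => //; rewrite scalerN enormN enormZ gtr0_norm//.
rewrite /t -mulrA gtr_pMr ?invr_gt0// ltr_pdivrMl// mulr1.
by rewrite ltrDl.
Qed.

Lemma sum_flux_outflow K e : cells K ->
  \sum_(L \in neighbours cells K) flux K e L =
  \sum_(L \in outflow K e) flux K e L - \sum_(L \in outflow K (- e)) flux K (- e) L.
Proof.
move=> cK; have fN := finite_neighbours mesh a0 cK.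
rewrite (fsbigID [set L | 0 < dot e (nu K L)])//=; congr (_ + _).
rewrite -[LHS]opprK; congr (- _).
rewrite -[LHS]mulN1r mulr_fsumr.
rewrite [RHS](fsbig_widen _ (neighbours cells K `&` ~` [set L | 0 < dot e (nu K L)]))/=.
- by apply: eq_fsbigr => L _; rewrite /flux dotNl; ring.
- move=> L [KL]; rewrite dotNl oppr_gt0 => eL; split=> //=; apply/negP.
  by rewrite -leNgt ltW.
- move=> L [[KL /negP] + nO]; rewrite -leNgt le_eqVlt => /predU1P[eL|eL].
    by rewrite /= /flux dotNl eL oppr0 mul0r.
  by case: nO; split=> //; rewrite dotNl oppr_gt0.
Qed.

(** The divergence theorem for a constant field: what flows in along [e] flows
    out, by [outflow_le] for [e] and for [- e]. *)
Lemma sum_area_normal K e : cells K ->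
  \sum_(L \in neighbours cells K) area (nu K L) (interface K L) * dot e (nu K L) = 0.
Proof.
move=> cK; transitivity (\sum_(L \in neighbours cells K) flux K e L).
  by apply: eq_fsbigr => L _; rewrite /flux mulrC.
rewrite sum_flux_outflow//; apply/eqP; rewrite subr_eq0 eq_le outflow_le// andbT.
by have := outflow_le (- e) cK; rewrite opprK.
Qed.

End divergence.

(** * Taylor's formula with spectral bounds *)

Section rayleigh.
Context {R : realType} {m : nat}.
Implicit Types (A : 'M[R]_m) (v w : 'rV[R]_m).

Lemma dot_mulmx A v w : dot (v *m A) w = (v *m A *m w^T) 0 0.
Proof. by rewrite [RHS]mxE; apply: eq_bigr => i _; rewrite [w^T _ _]mxE. Qed.

Lemma dot_mulmx_sym A v w : A^T = A -> dot (w *m A) v = dot (v *m A) w.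
Proof.
move=> sA; rewrite !dot_mulmx.
rewrite (_ : (w *m A *m v^T) 0 0 = (w *m A *m v^T)^T 0 0); last by rewrite [RHS]mxE.
by rewrite !trmx_mul trmxK sA mulmxA.
Qed.

(** On the unit sphere the quadratic form attains its minimum, at an
    eigenvector: otherwise a small move along [g], the defect of the eigenvalue
    equation, would decrease the Rayleigh quotient. *)
Lemma rayleigh_ge A b : A^T = A -> (forall l, eigenvalue A l -> b <= l) ->
  forall w, b * dot w w <= dot (w *m A) w.
Proof.
move=> sA evA w; have [->|w0] := eqVneq w 0; first by rewrite mul0mx !dot0l mulr0.
pose S := [set v : 'rV[R]_m | dot v v = 1].
have cdot : continuous (fun v : 'rV[R]_m => dot v v).
  move=> v; have Fv : Filter (nbhs v) := nbhs_filter v.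
  apply: cvg_big; first exact: add_continuous.
  by move=> i _; apply: cvgM; exact: coord_continuous.
have cq : continuous (fun v : 'rV[R]_m => dot (v *m A) v).
  move=> v; have Fv : Filter (nbhs v) := nbhs_filter v.
  apply: cvg_big; first exact: add_continuous.
  move=> i _; apply: cvgM; last exact: coord_continuous.
  suff: continuous (fun v => (v *m A) 0 i) by exact.
  rewrite (_ : (fun v => _) = (fun v : 'rV[R]_m => \sum_j v 0 j * A j i)).
    move=> x; have Fx : Filter (nbhs x) := nbhs_filter x.
    apply: cvg_big; first exact: add_continuous.
    by move=> j _; apply: cvgMl; exact: coord_continuous.
  by apply/funext => x; rewrite mxE.
have cS : compact S.
  apply: bounded_closed_compact; last first.
    by apply: (@closed_comp _ _ (fun v : 'rV[R]_m => dot v v) [set 1]) => [v _|];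
      [exact: cdot|exact: closed_eq].
  exists 1; split=> // x x1 v /= vS; apply: le_trans (ltW x1).
  by apply: (le_trans (norm_le_enorm _)); rewrite enorm_row vS sqrtr1.
have ww : 0 < dot w w.
  rewrite lt_neqAle dot_ge0 andbT eq_sym; apply: contra_neq w0; exact: dot_eq0.
have S0 : S !=set0.
  exists ((enorm w)^-1 *: w); rewrite /S/= dotZl dotZr -sqr_enorm_row.
  by field; rewrite gt_eqF// enorm_gt0.
have [v /set_mem vS vmin] := EVT_min_rV S0 cS (continuous_subspaceT cq).
set mu := dot (v *m A) v in vmin.
have B_ge0 x : 0 <= dot (x *m A) x - mu * dot x x.
  have [->|x0] := eqVneq x 0; first by rewrite mul0mx !dot0l mulr0 subr0.
  have x1 := enorm_gt0 x0.
  have /vmin : (enorm x)^-1 *: x \in S.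
    by apply: mem_set; rewrite /S/= dotZl dotZr -sqr_enorm_row; field; rewrite gt_eqF.
  rewrite -scalemxAl dotZl dotZr mulrA -expr2 exprVn sqr_enorm_row mulrC.
  by rewrite ler_pdivlMr ?subr_ge0// -sqr_enorm_row exprn_gt0.
have [g gE] : exists g, g = v *m A - mu *: v by eexists.
have g0 : g = 0.
  apply: dot_eq0; apply/eqP; rewrite eq_le dot_ge0 andbT leNgt; apply/negP => gg.
  set B := dot (g *m A) g - mu * dot g g; have B0 : 0 <= B := B_ge0 g.
  pose s := dot g g / (B + 1).
  have s0 : 0 < s by rewrite divr_gt0// ltr_wpDl.
  have := B_ge0 (v - s *: g).
  have -> : dot ((v - s *: g) *m A) (v - s *: g) -
      mu * dot (v - s *: g) (v - s *: g) = s * (s * B - 2 * dot g g).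
    rewrite mulmxBl -scalemxAl !(dotBl, dotBr, dotZl, dotZr) -/mu vS.
    rewrite (dot_mulmx_sym v g sA) (dotC g v) /B.
    have -> : dot g g = dot (v *m A) g - mu * dot v g by rewrite {1}gE dotBl dotZl.
    ring.
  rewrite pmulr_rge0// subr_ge0 leNgt; apply/negP/negPn.
  have : s * B <= dot g g.
    by rewrite /s mulrAC ler_pdivrMr ?ltr_wpDl// ler_pM2l// lerDl.
  by move: gg; lra.
have /evA : eigenvalue A mu.
  apply/eigenvalueP; exists v; first by apply/eqP; rewrite -subr_eq0 -gE g0.
  by apply/eqP => v0; move: vS; rewrite /S/= v0 dot0l => /esym/eqP; rewrite oner_eq0.
move=> bmu; have := B_ge0 w; rewrite subr_ge0; apply: le_trans.
by rewrite ler_wpM2r ?dot_ge0.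
Qed.

Lemma rayleigh_le A b : A^T = A -> (forall l, eigenvalue A l -> l <= b) ->
  forall w, dot (w *m A) w <= b * dot w w.
Proof.
move=> sA evA w.
have := @rayleigh_ge (- A) (- b) _ _ w; rewrite mulmxN dotNl mulNr lerN2; apply.
  by rewrite linearN/= sA.
move=> l /eigenvalueP[v vA v0]; rewrite lerNl; apply: evA.
apply/eigenvalueP; exists v => //.
by rewrite scaleNr -vA mulmxN opprK.
Qed.

End rayleigh.

Section one_variable.
Context {R : realType}.
Implicit Types (g : R -> R) (s t : R).

(** Differentiability on [0, 1], one-sided at the end points: along a segment of
    a closed convex set, the functions are only differentiable within the set. *)
Definition derivative01 g g1 := forall t, 0 <= t <= 1 -> forall e, 0 < e ->
  exists2 r : R, 0 < r & forall s, 0 <= s <= 1 -> `|s - t| < r ->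
    `|g s - g t - g1 t * (s - t)| <= e * `|s - t|.

Lemma derivative01D g g1 f f1 : derivative01 g g1 -> derivative01 f f1 ->
  derivative01 (fun t => g t + f t) (fun t => g1 t + f1 t).
Proof.
move=> dg df t t01 e e0; have e2 : 0 < e / 2 by rewrite divr_gt0.
have [r r0 gr] := dg t t01 _ e2; have [q q0 fq] := df t t01 _ e2.
exists (Num.min r q); first by rewrite lt_min r0.
move=> s s01; rewrite lt_min => /andP[sr sq].
rewrite (_ : _ - _ - _ = (g s - g t - g1 t * (s - t)) + (f s - f t - f1 t * (s - t))); last by ring.
apply: (le_trans (ler_normD _ _)); have := gr s s01 sr; have := fq s s01 sq; lra.
Qed.

Lemma derivative01N g g1 : derivative01 g g1 ->
  derivative01 (fun t => - g t) (fun t => - g1 t).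
Proof.
move=> dg t t01 e e0; have [r r0 gr] := dg t t01 e e0; exists r => // s s01 st.
rewrite (_ : _ - _ - _ = - (g s - g t - g1 t * (s - t))); last by ring.
by rewrite normrN; exact: gr.
Qed.

Lemma derivative01_quadratic (a b c : R) :
  derivative01 (fun t => a + b * t + c * t ^+ 2) (fun t => b + 2 * c * t).
Proof.
move=> t _ e e0; exists (e / (`|c| + 1)); first by rewrite divr_gt0// ltr_wpDl.
move=> s _ st.
rewrite (_ : _ - _ - _ = c * (s - t) * (s - t)); last by ring.
rewrite !normrM ler_wpM2r//; move: st; rewrite ltr_pdivlMr ?ltr_wpDl// mulrC => /ltW.
by apply: le_trans; rewrite ler_wpM2r// lerDl.
Qed.

Lemma derivative01_nondecreasing g g1 : derivative01 g g1 ->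
  (forall t, 0 <= t <= 1 -> 0 <= g1 t) ->
  forall s t, 0 <= s -> s <= t -> t <= 1 -> g s <= g t.
Proof.
move=> dg g1_ge0 s t s0 st t1.
have [x||c] := @MVT_segment R g g1 s t st.
- rewrite in_itv/= => /andP[sx xt].
  have x01 : 0 <= x <= 1 by rewrite !ltW ?(le_lt_trans s0)// (lt_le_trans xt).
  have cvg_g1 : (fun q => q^-1 *: ((g \o shift x) (q *: 1) - g x)) @ 0^' --> g1 x.
    apply/cvgrPdist_le => e e0.
    have [r r0 gr] := dg x x01 e e0.
    have d0 : 0 < Num.min r (Num.min (x - s) (t - x)).
      by rewrite !lt_min r0 !subr_gt0 sx.
    near=> q.
    have q0 : q != 0 by near: q; exact: nbhs_dnbhs_neq.
    have : `|q| < Num.min r (Num.min (x - s) (t - x)).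
      by near: q; exact: dnbhs0_lt.
    rewrite !lt_min => /and3P[qr qs qt].
    have qE : q *: 1 = q :> R by rewrite -[LHS]/(q * 1) mulr1.
    have := gr (q + x); rewrite addrK => /(_ _ qr).
    rewrite /= qE /GRing.scale/= => gq.
    have {}gq : `|g (q + x) - g x - g1 x * q| <= e * `|q|.
      by apply: gq; move: qs qt; rewrite !ltr_norml; move: x01; lra.
    have -> : g1 x - q^-1 * (g (q + x) - g x) = - (q^-1 * (g (q + x) - g x - g1 x * q)).
      by field.
    by rewrite normrN normrM normfV mulrC ler_pdivrMr ?normr_gt0.
  apply: DeriveDef; first by apply/cvg_ex; exists (g1 x).
  exact: cvg_lim cvg_g1.
- apply/subspace_continuousP => x; rewrite /= in_itv/= => /andP[sx xt].
  have x01 : 0 <= x <= 1 by rewrite (le_trans s0)//= (le_trans xt).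
  apply/cvgrPdist_le => e e0.
  have [r r0 gr] := dg x x01 1 ltr01.
  have c0 : 0 < `|g1 x| + 1 by rewrite ltr_wpDl.
  rewrite near_withinE; near=> q; rewrite /= in_itv/= => /andP[sq qt].
  have q01 : 0 <= q <= 1 by rewrite (le_trans s0)//= (le_trans qt).
  have : `|x - q| < Num.min r (e / (`|g1 x| + 1)).
    near: q; apply: cvgr_dist_lt => //.
    by rewrite lt_min r0 divr_gt0.
  rewrite lt_min distrC => /andP[qr]; rewrite ltr_pdivlMr// => qe.
  have := gr q q01 qr; rewrite mul1r => gq.
  rewrite distrC (_ : g q - g x = (g q - g x - g1 x * (q - x)) + g1 x * (q - x)); last by ring.
  apply: (le_trans (ler_normD _ _)); rewrite normrM.
  by move: qe; rewrite mulrDr mulr1 [_ * `|g1 x|]mulrC; lra.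
- rewrite in_itv/= => /andP[sc ct] e; rewrite -subr_ge0 e mulr_ge0 ?subr_ge0//.
  by apply: g1_ge0; rewrite (le_trans s0)//= (le_trans ct).
Unshelve. all: by end_near. Qed.

(** Subtract the quadratic polynomial with second derivative [k] and integrate
    the sign of the second derivative twice. *)
Lemma taylor01_ge g g1 g2 k : derivative01 g g1 -> derivative01 g1 g2 ->
  (forall t, 0 <= t <= 1 -> k <= g2 t) -> k / 2 <= g 1 - g 0 - g1 0.
Proof.
move=> dg dg1 kg2.
pose f1 t := g1 t + (- g1 0 + - k * t + 0 * t ^+ 2).
pose f t := g t + (- g 0 + - g1 0 * t + - (k / 2) * t ^+ 2).
have df1 := derivative01D dg1 (derivative01_quadratic (- g1 0) (- k) 0).
have df := derivative01D dg (derivative01_quadratic (- g 0) (- g1 0) (- (k / 2))).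
have f1_ge0 t : 0 <= t <= 1 -> 0 <= f1 t.
  move=> /andP[t0 t1].
  have := derivative01_nondecreasing df1 _ (lexx 0) t0 t1.
  have h : forall x, 0 <= x <= 1 -> 0 <= g2 x + (- k + 2 * 0 * x).
    by move=> x /kg2; lra.
  by move=> /(_ h); rewrite -/(f1 t); lra.
have := derivative01_nondecreasing df _ (lexx 0) ler01 (lexx 1).
have h : forall x, 0 <= x <= 1 -> 0 <= g1 x + (- g1 0 + 2 * - (k / 2) * x).
  by move=> x /f1_ge0; rewrite /f1; lra.
by move=> /(_ h); lra.
Qed.

End one_variable.

Section C2.
Context {R : realType} {m : nat}.
Local Notation V := 'cV[R]_m.
Implicit Types (A Omega : set V) (u v w : V).

Lemma littleo_withinP (W W' : normedModType R) (A : set W) (u : W) (f : W -> W') :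
  f =o_ (within A (nbhs u)) (fun y => y - u) ->
  forall e, 0 < e -> exists2 r : R, 0 < r &
    forall y, A y -> `|y - u| < r -> `|f y| <= e * `|y - u|.
Proof.
move=> /eqoP fo e e0; have := fo e e0; rewrite near_withinE => /nbhs_normP[r /= r0 fr].
by exists r => // y Ay yu; apply: fr => //=; rewrite /ball_/= distrC.
Qed.

Lemma norm_mulmx_row_col (x : 'rV[R]_m) v : `|(x *m v) 0 0| <= m%:R * `|x| * `|v|.
Proof.
rewrite mxE; apply: (le_trans (ler_norm_sum _ _ _)).
apply: (@le_trans _ _ (\sum_(i < m) `|x| * `|v|)).
  apply: ler_sum => i _; rewrite normrM; apply: ler_pM => //.
    rewrite -[leRHS]/(mx_norm x) mx_normrE.
    exact: (le_bigmax _ (fun ij : 'I_1 * 'I_m => `|x ij.1 ij.2|) (0, i)).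
  rewrite -[leRHS]/(mx_norm v) mx_normrE.
  exact: (le_bigmax _ (fun ij : 'I_m * 'I_1 => `|v ij.1 ij.2|) (i, 0)).
by rewrite sumr_const card_ord -[leLHS]mulr_natl mulrA.
Qed.

Lemma norm_trmx p q (x : 'M[R]_(p, q)) : `|x^T| = `|x|.
Proof.
have le p' q' (y : 'M[R]_(p', q')) : `|y^T| <= `|y|.
  rewrite -[leLHS]/(mx_norm y^T) mx_normrE; apply/bigmax_leP; split=> // -[i j] _ /=.
  rewrite mxE -[leRHS]/(mx_norm y) mx_normrE.
  exact: (le_bigmax _ (fun ij : 'I_p' * 'I_q' => `|y ij.1 ij.2|) (j, i)).
by apply/eqP; rewrite eq_le le -{1}[x]trmxK le.
Qed.

Section segment.
Variables (A : set V) (g : V -> R) (Dg : V -> 'rV[R]_m) (D2g : V -> 'M[R]_m).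
Hypothesis gC2 : is_C2_on A g Dg D2g.
Variables u w : V.
Hypothesis uwA : forall t : R, 0 <= t <= 1 -> A (u + t *: (w - u)).
Let p (t : R) := u + t *: (w - u).

Let pB s t : p s - p t = (s - t) *: (w - u).
Proof. by rewrite /p opprD addrACA subrr add0r -scalerBl. Qed.

Lemma derivative01_gradient :
  derivative01 (fun t => g (p t)) (fun t => (Dg (p t) *m (w - u)) 0 0).
Proof.
move=> t t01 e e0; have d0 : 0 < `|w - u| + 1 by rewrite ltr_wpDl.
have [r r0 gr] := littleo_withinP (C2_gradient gC2 (uwA t01)) (divr_gt0 e0 d0).
exists (r / (`|w - u| + 1)); first by rewrite divr_gt0.
move=> s s01; rewrite ltr_pdivlMr// => st.
have /(gr _ (uwA s01)) : `|p s - p t| < r.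
  by rewrite pB normrZ; apply: le_lt_trans st; rewrite ler_wpM2l// lerDl.
rewrite -/(p s) -/(p t) pB -scalemxAr mxE normrZ => ge.
rewrite [_ * (s - t)]mulrC; apply: le_trans ge _.
rewrite (_ : _ * _ = e * `|s - t| * (`|w - u| / (`|w - u| + 1))); last by ring.
by rewrite ler_piMr ?mulr_ge0 ?(ltW e0)// ler_pdivrMr// mul1r lerDl.
Qed.

Lemma derivative01_hessian :
  derivative01 (fun t => (Dg (p t) *m (w - u)) 0 0)
    (fun t => dot ((w - u)^T *m D2g (p t)) (w - u)^T).
Proof.
move=> t t01 e e0.
have c0 : 0 < m%:R * `|w - u| * `|w - u| + 1 by rewrite ltr_wpDl// !mulr_ge0.
have d0 : 0 < `|w - u| + 1 by rewrite ltr_wpDl.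
have [r r0 gr] := littleo_withinP (C2_hessian gC2 (uwA t01)) (divr_gt0 e0 c0).
exists (r / (`|w - u| + 1)); first by rewrite divr_gt0.
move=> s s01; rewrite ltr_pdivlMr// => st.
have /(gr _ (uwA s01)) : `|p s - p t| < r.
  by rewrite pB normrZ; apply: le_lt_trans st; rewrite ler_wpM2l// lerDl.
rewrite -/(p s) -/(p t) pB normrZ; set X := (X in `|X| <= _) => Xle.
rewrite (_ : _ - _ - _ = (X^T *m (w - u)) 0 0); last first.
  have -> : X^T = Dg (p s) - Dg (p t) - (D2g (p t) *m ((s - t) *: (w - u)))^T.
    by apply/matrixP => i j; rewrite !mxE.
  have subE (M N : 'M[R]_1) : (M - N) 0 0 = M 0 0 - N 0 0 by rewrite !mxE.
  rewrite !mulmxBl !subE; congr (_ - _).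
  rewrite -scalemxAr linearZ/= -scalemxAl [RHS]mxE mulrC; congr (_ * _).
  by rewrite dot_mulmx trmxK trmx_mul (C2_symmetric gC2 (uwA t01)).
apply: (le_trans (norm_mulmx_row_col _ _)); rewrite norm_trmx.
apply: (@le_trans _ _ (m%:R * (e / (m%:R * `|w - u| * `|w - u| + 1) *
    (`|s - t| * `|w - u|)) * `|w - u|)).
  by rewrite ler_wpM2r// ler_wpM2l.
rewrite (_ : _ * _ * _ = e * `|s - t| * ((m%:R * `|w - u| * `|w - u|) /
    (m%:R * `|w - u| * `|w - u| + 1))); last by ring.
by rewrite ler_piMr ?mulr_ge0 ?(ltW e0)// ler_pdivrMr// mul1r lerDl.
Qed.

End segment.

Lemma convex_segment Omega u w t : convex_set Omega -> Omega u -> Omega w ->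
  0 <= t <= 1 -> Omega (u + t *: (w - u)).
Proof.
move=> cO Ou Ow /andP[t0 t1].
have /set_mem : t *: w + (1 - t) *: u \in Omega.
  exact: cO w u (Itv01 t0 t1) (mem_set Ow) (mem_set Ou).
by rewrite scalerBl scale1r scalerBr addrCA.
Qed.

Lemma enorm_trmx p q (x : 'M[R]_(p, q)) : enorm x^T = enorm x.
Proof.
rewrite /enorm exchange_big/=; congr Num.sqrt; apply: eq_bigr => i _.
by apply: eq_bigr => j _; rewrite mxE.
Qed.

Lemma taylor_ge A (g : V -> R) Dg D2g u w b : is_C2_on A g Dg D2g ->
  (forall t : R, 0 <= t <= 1 -> A (u + t *: (w - u))) ->
  (forall v l, A v -> eigenvalue (D2g v) l -> b <= l) ->
  b / 2 * enorm (w - u) ^+ 2 <= g w - g u - (Dg u *m (w - u)) 0 0.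
Proof.
move=> gC2 uwA ev.
have dg := derivative01_gradient gC2 uwA.
have dg1 := derivative01_hessian gC2 uwA.
have := taylor01_ge dg dg1 (k := b * enorm (w - u) ^+ 2).
have [-> ->] : u + 1 *: (w - u) = w /\ u + 0 *: (w - u) = u.
  by rewrite scale1r addrC subrK scale0r addr0.
rewrite mulrAC; apply => t t01.
rewrite -[enorm _]enorm_trmx sqr_enorm_row; apply: rayleigh_ge.
  exact: C2_symmetric gC2 _ (uwA t t01).
by move=> l; exact: ev (uwA t t01).
Qed.

Lemma taylor_le A (g : V -> R) Dg D2g u w b : is_C2_on A g Dg D2g ->
  (forall t : R, 0 <= t <= 1 -> A (u + t *: (w - u))) ->
  (forall v l, A v -> eigenvalue (D2g v) l -> l <= b) ->
  g w - g u - (Dg u *m (w - u)) 0 0 <= b / 2 * enorm (w - u) ^+ 2.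
Proof.
move=> gC2 uwA ev.
have dg := derivative01N (derivative01_gradient gC2 uwA).
have dg1 := derivative01N (derivative01_hessian gC2 uwA).
have := taylor01_ge dg dg1 (k := - (b * enorm (w - u) ^+ 2)).
have [-> ->] : u + 1 *: (w - u) = w /\ u + 0 *: (w - u) = u.
  by rewrite scale1r addrC subrK scale0r addr0.
have h : forall t : R, 0 <= t <= 1 ->
    - (b * enorm (w - u) ^+ 2) <= - dot ((w - u)^T *m D2g (u + t *: (w - u))) (w - u)^T.
  move=> t t01; rewrite lerN2 -[enorm _]enorm_trmx sqr_enorm_row; apply: rayleigh_le.
    exact: C2_symmetric gC2 _ (uwA t t01).
  by move=> l; exact: ev (uwA t t01).
by move=> /(_ h); lra.
Qed.

(** A function differentiable within [A] is continuous on [A], and [A] is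
    compact. *)
Lemma C2_bounded A (g : V -> R) Dg D2g : is_C2_on A g Dg D2g ->
  bounded_set A -> closed A -> exists2 M, 0 <= M & forall v, A v -> `|g v| <= M.
Proof.
move=> gC2 bA clA.
have ctr : continuous (fun x : 'rV[R]_m => x^T : V).
  move=> x; have Fx : Filter (nbhs x) := nbhs_filter x.
  apply/cvgrPdist_lt => e e0; apply/(@nbhs_normP _ _ x); exists e => //= y.
  by rewrite /ball_ /= -linearB/= norm_trmx.
pose B := [set x : 'rV[R]_m | A x^T].
have cB : compact B.
  apply: bounded_closed_compact; last by apply: closed_comp => // x _; exact: ctr.
  have [M [Mr MA]] := bA; exists M; split=> // r /MA Ar x Bx.
  by rewrite /= -norm_trmx; exact: Ar.
have cg : {within B, continuous (fun x : 'rV[R]_m => g x^T : R^o)}.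
  apply/subspace_continuousP => x Bx; apply/cvgrPdist_le => e e0.
  have [r r0 gr] := littleo_withinP (C2_gradient gC2 Bx) ltr01.
  have c0 : 0 < m%:R * `|Dg x^T| + 1 by rewrite ltr_wpDl// mulr_ge0.
  rewrite near_withinE; apply/(@nbhs_normP _ _ x).
  exists (Num.min r (e / (m%:R * `|Dg x^T| + 1))) => /=.
    by rewrite lt_min r0 divr_gt0.
  move=> y; rewrite /ball_ /=.
  have -> : `|x - y| = `|y^T - x^T| by rewrite -linearB norm_trmx distrC.
  rewrite lt_min => /andP[yr].
  rewrite ltr_pdivlMr// => ye By.
  have := gr _ By yr; rewrite mul1r => gy.
  rewrite distrC -(subrK ((Dg x^T *m (y^T - x^T)) 0 0) (g y^T - g x^T)).
  apply: (le_trans (ler_normD _ _)).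
  have := norm_mulmx_row_col (Dg x^T) (y^T - x^T).
  by move: ye; rewrite mulrDr mulr1 [_ * (m%:R * _)]mulrC; lra.
have [M [Mr MB]] := compact_bounded (continuous_compact cg cB).
exists (`|M| + 1); first by rewrite addr_ge0.
move=> v Av; apply: (MB (`|M| + 1)).
  by rewrite (le_lt_trans (ler_norm M))// ltrDl.
by exists v^T; rewrite /B/= trmxK.
Qed.

End C2.

(** * The discrete entropy inequality *)

Section weighted_sums.
Context {R : realType}.

(** By induction: adding a term adds to the difference of the two sides a
    multiple of [A x^2 + Q - 2 S x], a quadratic polynomial whose discriminant
    is nonpositive by the induction hypothesis. *)
Lemma weighted_cauchy_schwarz (I : eqType) (s : seq I) (c x : I -> R) :
  (forall i, i \in s -> 0 <= c i) ->
  (\sum_(i <- s) c i * x i) ^+ 2 <= (\sum_(i <- s) c i) * \sum_(i <- s) c i * x i ^+ 2.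
Proof.
elim: s => [|i s IH] c0; first by rewrite !big_nil expr0n mul0r.
have {}IH := IH (fun j js => c0 j (mem_behead (s := i :: s) js)).
have ci : 0 <= c i by apply: c0; rewrite inE eqxx.
have A0 : 0 <= \sum_(j <- s) c j.
  by rewrite big_seq sumr_ge0// => j js; apply: c0; rewrite inE js orbT.
rewrite !big_cons; move: IH A0.
set S := \sum_(j <- s) _ * _; set A := \sum_(j <- s) c j; set Q := \sum_(j <- s) _ * _ ^+ 2.
move=> IH A0; have Q0 : 0 <= Q.
  by rewrite /Q big_seq sumr_ge0// => j js; rewrite mulr_ge0 ?sqr_ge0 ?c0// inE js orbT.
suff H : 0 <= A * x i ^+ 2 + Q - 2 * S * x i.
  rewrite -subr_ge0 [leRHS](_ : _ = A * Q - S ^+ 2 +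
      c i * (A * x i ^+ 2 + Q - 2 * S * x i)); last by ring.
  by rewrite addr_ge0 ?subr_ge0// mulr_ge0.
have [A1|A1] := ltP 0 A.
  rewrite -(pmulr_rge0 _ A1) [leRHS](_ : _ = (A * x i - S) ^+ 2 + (A * Q - S ^+ 2));
    last by ring.
  by rewrite addr_ge0 ?sqr_ge0// subr_ge0.
have A00 : A = 0 by apply/eqP; rewrite eq_le A0 A1.
move: IH; rewrite A00 !mul0r add0r => S0.
have -> : S = 0 by apply/eqP; rewrite -sqrf_eq0 eq_le S0 sqr_ge0.
by rewrite mulr0 mul0r subr0.
Qed.

Lemma enorm_weighted_sum (I : eqType) (s : seq I) m (c : I -> R) (g : I -> 'cV[R]_m) :
  (forall i, i \in s -> 0 <= c i) ->
  enorm (\sum_(i <- s) c i *: g i) ^+ 2 <=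
  (\sum_(i <- s) c i) * \sum_(i <- s) c i * enorm (g i) ^+ 2.
Proof.
move=> c0; rewrite sqr_enorm_col.
rewrite [X in _ * X](_ : _ = \sum_j \sum_(i <- s) c i * g i j 0 ^+ 2); last first.
  rewrite exchange_big/=; apply: eq_bigr => i _.
  by rewrite sqr_enorm_col mulr_sumr.
rewrite mulr_sumr; apply: ler_sum => j _.
rewrite summxE; under eq_bigr do rewrite mxE.
exact: weighted_cauchy_schwarz.
Qed.

(** By antisymmetry the sum is half of the sum of the [s i j] against the
    differences of the weight. *)
Lemma antisymmetric_sum_le (I : eqType) (F : seq I) (phi : I -> R) (s : I -> I -> R) c :
  (forall i j, i \in F -> j \in F -> s i j = - s j i) ->
  (forall i j, i \in F -> j \in F -> s i j != 0 -> `|phi i - phi j| <= 2 * c) ->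
  - (\sum_(i <- F) phi i * \sum_(j <- F) s i j) <= c * \sum_(i <- F) \sum_(j <- F) `|s i j|.
Proof.
move=> sA phiL; set S := (X in - X <= _).
have SE : S = \sum_(i <- F) \sum_(j <- F) phi i * s i j.
  by apply: eq_bigr => i _; rewrite mulr_sumr.
have S2 : S + S = \sum_(i <- F) \sum_(j <- F) (phi i - phi j) * s i j.
  rewrite {1}SE SE [X in _ + X]exchange_big -big_split/=.
  rewrite big_seq [RHS]big_seq; apply: eq_bigr => i iF.
  rewrite -big_split big_seq [RHS]big_seq; apply: eq_bigr => j jF /=.
  by rewrite (sA j i)//; ring.
have : - (S + S) <= (2 * c) * \sum_(i <- F) \sum_(j <- F) `|s i j|.
  rewrite S2 -sumrN mulr_sumr big_seq [leRHS]big_seq; apply: ler_sum => i iF.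
  rewrite -sumrN mulr_sumr big_seq [leRHS]big_seq; apply: ler_sum => j jF.
  apply: (le_trans (ler_norm _)); rewrite normrN normrM.
  by have [->|s0] := eqVneq (s i j) 0; [rewrite normr0 !mulr0|rewrite ler_wpM2r// phiL].
by rewrite -mulrA; lra.
Qed.

End weighted_sums.

Section cell_entropy.
Context {R : realType} {d m : nat}.
Local Notation E := 'rV[R]_d.
Local Notation V := 'cV[R]_m.
Variables (Omega : set V) (eta : V -> R) (Deta : V -> 'rV[R]_m) (D2eta : V -> 'M[R]_m)
  (xi : 'I_d -> V -> R) (f : 'I_d -> V -> V) (cells : set (set E))
  (nu : set E -> set E -> E) (h a b0 b1 zeta lambda_star dt : R)
  (G : set E -> set E -> V -> V -> V) (X : set E -> set E -> V -> V -> R)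
  (u0 : E -> V) (u : nat -> set E -> V).
Hypotheses (cO : convex_set Omega) (etaC2 : is_C2_on (closure Omega) eta Deta D2eta)
  (a0 : 0 < a) (zeta01 : 0 < zeta < 1) (l0 : 0 < lambda_star) (b1_gt0 : 0 < b1)
  (spec_ge : forall v l, closure Omega v -> eigenvalue (D2eta v) l -> b0 <= l)
  (spec_le : forall v l, closure Omega v -> eigenvalue (D2eta v) l -> l <= b1)
  (mesh : is_mesh cells nu h a)
  (inv : flux_invariant cells nu Omega f lambda_star G)
  (ent : is_entropy_flux cells nu Omega f eta xi lambda_star G X)
  (dt0 : 0 < dt) (scheme : is_scheme cells nu Omega G dt u0 u)
  (cfl : dt <= b0 / b1 * (a ^+ 2 / lambda_star) * (1 - zeta) * h).
Implicit Types (K L : set E) (v w : V).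

Let inO v w : Omega v -> Omega w -> forall t : R, 0 <= t <= 1 -> closure Omega (v + t *: (w - v)).
Proof. by move=> Ov Ow t t01; apply: subset_closure; exact: convex_segment. Qed.

Local Notation sigma K L := (area (nu K L) (interface K L)).
Local Notation gap K L v w := (G K L v w - fluxdot f v (nu K L)).

(** The invariance of the domain is only known for parameters larger than
    [lambda_star]; this one leaves half of the margin of the CFL condition. *)
Definition relaxed_lambda := lambda_star / (1 - zeta / 2).

Lemma relaxed_lambda_gt : lambda_star < relaxed_lambda.
Proof.
by rewrite ltr_pdivlMr; [rewrite gtr_pMr//|]; move: zeta01; lra.
Qed.

(** The gain [b0 |g|^2] comes from the strong convexity of [eta] between [v] and
    the state [v - g / lambda], which belongs to the domain. *)
Lemma entropy_flux_gap K L v w : cells K -> neighbours cells K L -> Omega v -> Omega w ->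
  X K L v w - entropydot xi v (nu K L) <=
  (Deta v *m gap K L v w) 0 0 -
  b0 / (2 * lambda_star) * (1 - zeta / 2) * enorm (gap K L v w) ^+ 2.
Proof.
move=> cK KL Ov Ow; set g := gap K L v w.
have lgt := relaxed_lambda_gt; set l := relaxed_lambda in lgt *.
have l_gt0 : 0 < l := lt_trans l0 lgt.
have Ov' : Omega (v - l^-1 *: g) := inv cK KL lgt Ov Ow.
have := entropy_flux_inequality ent cK KL (ltW lgt) Ov Ow; rewrite -/g.
have := taylor_ge etaC2 (inO Ov Ov') spec_ge.
rewrite addrAC subrr add0r enormN enormZ gtr0_norm ?invr_gt0//.
have -> : (Deta v *m - (l^-1 *: g)) 0 0 = - (l^-1 * (Deta v *m g) 0 0).
  by rewrite mulmxN -scalemxAr [LHS]mxE [X in - X]mxE.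
set p := eta _ - eta v; set q := (Deta v *m g) 0 0.
move=> T S; apply: (le_trans S); rewrite mulNr lerNl opprB.
have -> : b0 / (2 * lambda_star) * (1 - zeta / 2) * enorm g ^+ 2 - q =
    l * (b0 / 2 * (l^-1 * enorm g) ^+ 2 - l^-1 * q).
  rewrite /l /relaxed_lambda; field.
  by rewrite !gt_eqF//; move: zeta01; lra.
by rewrite ler_pM2l// lerBlDr; move: T; rewrite opprK.
Qed.

(** The scheme only involves the differences [G - f(u_K).n], since [f(u_K)] is
    constant in the cell and has no net flux through its boundary. *)
Lemma cell_update k K : cells K ->
  (vol K / dt) *: (u k.+1 K - u k K) =
  - \sum_(L \in neighbours cells K) sigma K L *: gap K L (u k K) (u k L).
Proof.
move=> cK; have fN := finite_neighbours mesh a0 cK.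
have /eqP := scheme_step scheme k cK; rewrite addr_eq0 => /eqP ->; congr (- _).
rewrite !fsbig_finite//=; apply/eqP; rewrite -subr_eq0 -sumrB; apply/eqP.
under eq_bigr do rewrite -scalerBr opprB addrC subrK.
apply/colP => i; rewrite summxE mxE.
rewrite -[RHS](sum_area_normal mesh a0 (\row_alpha f alpha (u k K) i 0) cK).
rewrite fsbig_finite//; apply: eq_bigr => L _; rewrite !mxE; congr (_ * _).
by rewrite /fluxdot summxE; apply: eq_bigr => alpha _; rewrite !mxE mulrC.
Qed.

Lemma sum_entropydot v K : cells K ->
  \sum_(L \in neighbours cells K) sigma K L * entropydot xi v (nu K L) = 0.
Proof.
move=> cK; rewrite -[RHS](sum_area_normal mesh a0 (\row_alpha xi alpha v) cK).
apply: eq_fsbigr => L _; congr (_ * _); apply: eq_bigr => alpha _.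
by rewrite mxE mulrC.
Qed.

(** The convexity of [eta] yields a dissipation with the factor
    [1 - zeta / 2], and the quadratic remainder of the time step costs at most
    the factor [1 - zeta] by the CFL condition; half of [zeta] is left. *)
Lemma cell_entropy_inequality k K : cells K ->
  vol K / dt * (eta (u k.+1 K) - eta (u k K)) +
  zeta * b0 / (4 * lambda_star) *
    \sum_(L \in neighbours cells K) sigma K L * enorm (gap K L (u k K) (u k L)) ^+ 2 <=
  - \sum_(L \in neighbours cells K) sigma K L * X K L (u k K) (u k L).
Proof.
move=> cK; have fN := finite_neighbours mesh a0 cK.
have h0 := mesh_size_gt0 mesh.
have vK := cell_vol_gt0 mesh a0 cK.
have Ou j L : cells L -> Omega (u j L) := scheme_domain scheme j (K := L).
set v := u k K; set v' := u k.+1 K.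
have Ov : Omega v := Ou k K cK.
have Ov' : Omega v' := Ou k.+1 K cK.
pose g L := gap K L v (u k L).
set D := \sum_(L \in _) _ * _ ^+ 2; set SX := \sum_(L \in _) _ * X _ _ _ _.
pose S := \sum_(L \in neighbours cells K) sigma K L *: g L.
have upd : (vol K / dt) *: (v' - v) = - S := cell_update k cK.
have vdt : 0 < vol K / dt by rewrite divr_gt0.
have D0 : 0 <= D.
  by apply: fsumr_ge0 => L _; rewrite mulr_ge0 ?sqr_ge0 ?area_ge0.
(* the entropy fluxes *)
have flux : SX <= (Deta v *m S) 0 0 - b0 / (2 * lambda_star) * (1 - zeta / 2) * D.
  rewrite -[SX]subr0 -(sum_entropydot v cK) /SX /S /D !fsbig_finite//= -sumrB.
  rewrite mulmx_sumr summxE mulr_sumr -sumrB big_seq [leRHS]big_seq.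
  apply: ler_sum => L; rewrite in_fset_set// => /set_mem KL.
  have [cL _ _] := KL.
  rewrite -mulrBr -scalemxAr mxE mulrCA -mulrBr.
  rewrite ler_wpM2l ?area_ge0//.
  exact: entropy_flux_gap (Ou k L cL).
(* the quadratic remainder of the time step *)
have rem : vol K / dt * (b1 / 2 * enorm (v' - v) ^+ 2) <=
    b0 / (2 * lambda_star) * (1 - zeta) * D.
  have S2 : enorm S ^+ 2 <= h ^+ d.-1 / a * D.
    apply: (@le_trans _ _ ((\sum_(L \in neighbours cells K) sigma K L) * D)).
      rewrite /S /D !fsbig_finite//; apply: enorm_weighted_sum => L _; exact: area_ge0.
    by rewrite ler_wpM2r//; exact: mesh_perimeter mesh _ cK.
  have eS : enorm S = vol K / dt * enorm (v' - v).
    by rewrite -enormN -upd enormZ gtr0_norm.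
  have -> : vol K / dt * (b1 / 2 * enorm (v' - v) ^+ 2) =
      b1 / 2 * (dt / vol K) * enorm S ^+ 2.
    by rewrite eS; field; rewrite !gt_eqF.
  apply: (@le_trans _ _ (b1 / 2 * (dt / vol K) * (h ^+ d.-1 / a * D))).
    by rewrite ler_wpM2l// !mulr_ge0 ?invr_ge0 ?ltW.
  have hd : h ^+ d = h * h ^+ d.-1 by rewrite -exprS prednK// (mesh_dim_gt0 mesh).
  have hd0 : 0 < h ^+ d.-1 by rewrite exprn_gt0.
  apply: (@le_trans _ _ (b1 / 2 * (dt / (a * h ^+ d)) * (h ^+ d.-1 / a * D))).
    apply: ler_wpM2r; first by rewrite mulr_ge0// divr_ge0 ?ltW.
    apply: ler_wpM2l; first by rewrite divr_ge0 ?ltW.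
    rewrite ler_pM2l// lef_pV2 ?posrE ?mulr_gt0 ?exprn_gt0//.
    exact: mesh_volume mesh _ cK.
  rewrite mulrA ler_wpM2r// hd.
  have -> : b1 / 2 * (dt / (a * (h * h ^+ d.-1))) * (h ^+ d.-1 / a) =
      dt * (b1 / (2 * a ^+ 2 * h)).
    by field; rewrite !gt_eqF.
  rewrite -ler_pdivlMr; last by rewrite divr_gt0// !mulr_gt0// exprn_gt0.
  apply: (le_trans cfl); rewrite le_eqVlt; apply/orP; left; apply/eqP.
  by field; rewrite !gt_eqF.
have T := taylor_le etaC2 (inO Ov Ov') spec_le.
have {}T : vol K / dt * (eta v' - eta v) <= - (Deta v *m S) 0 0 +
    b0 / (2 * lambda_star) * (1 - zeta) * D.
  have -> : - (Deta v *m S) 0 0 = vol K / dt * (Deta v *m (v' - v)) 0 0.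
    transitivity ((Deta v *m - S) 0 0); first by rewrite mulmxN [RHS]mxE.
    by rewrite -upd -scalemxAr mxE.
  rewrite -lerBlDl -mulrBr; apply: le_trans rem.
  by rewrite ler_pM2l.
have -> : zeta * b0 / (4 * lambda_star) = b0 / (2 * lambda_star) * (1 - zeta / 2) -
   b0 / (2 * lambda_star) * (1 - zeta).
  by field; rewrite gt_eqF.
by move: T flux; rewrite mulrBl; lra.
Qed.

End cell_entropy.

(** * The weighted dissipation estimate *)

Section main_estimate.
Context {R : realType} {d m : nat}.
Local Notation E := 'rV[R]_d.
Local Notation V := 'cV[R]_m.

Section neighbour_distance.
Variables (cells : set (set E)) (nu : set E -> set E -> E) (h a : R).
Hypotheses (mesh : is_mesh cells nu h a).

Lemma neighbour_dist K L x y : cells K -> neighbours cells K L -> K x -> L y ->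
  enorm (x - y) <= 2 * h.
Proof.
move=> cK [cL _ [z [n _ /separatesP[e e0 sz]]]] Kx Ly.
have := sz z; rewrite subrr enorm0 dot0l lexx => /(_ e0)[/(_ isT) zK /(_ isT) zL].
apply/ler_addgt0Pr => r r0; have r2 : 0 < r / 2 by rewrite divr_gt0.
have /closureP_enorm/(_ _ r2)[x' Kx' x'z] := zK.
have /closureP_enorm/(_ _ r2)[y' Ly' y'z] := zL.
have := ler_enorm_dist x x' y; have := ler_enorm_dist x' z y; have := ler_enorm_dist z y' y.
have := cell_diam mesh cK Kx Kx'; have := cell_diam mesh cL Ly' Ly.
by rewrite (enorm_distC z y'); lra.
Qed.

End neighbour_distance.

Lemma norm_entropydot (xi : 'I_d -> V -> R) v n : enorm n = 1 ->
  `|entropydot xi v n| <= \sum_alpha `|xi alpha v|.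
Proof.
move=> n1; apply: (le_trans (ler_norm_sum _ _ _)); apply: ler_sum => alpha _.
by rewrite normrM ler_piMl// -n1 enorm_entry.
Qed.

Section estimate.
Variables (Omega : set V) (eta : V -> R) (Deta : V -> 'rV[R]_m) (D2eta : V -> 'M[R]_m)
  (xi : 'I_d -> V -> R) (f : 'I_d -> V -> V) (cells : set (set E))
  (nu : set E -> set E -> E) (h a b0 b1 zeta lambda_star dt T r Meta Mxi : R)
  (G : set E -> set E -> V -> V -> V) (X : set E -> set E -> V -> V -> R)
  (u0 : E -> V) (u : nat -> set E -> V) (Er : set (set E * set E)).
Hypotheses (cO : convex_set Omega) (etaC2 : is_C2_on (closure Omega) eta Deta D2eta)
  (eta_ge0 : forall v, Omega v -> 0 <= eta v) (eta_le : forall v, Omega v -> eta v <= Meta)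
  (xi_le : forall v, Omega v -> \sum_alpha `|xi alpha v| <= Mxi)
  (Meta0 : 0 <= Meta) (Mxi0 : 0 <= Mxi)
  (T0 : 0 < T)
  (a0 : 0 < a) (zeta01 : 0 < zeta < 1) (l0 : 0 < lambda_star) (b0_gt0 : 0 < b0)
  (b1_gt0 : 0 < b1)
  (spec_ge : forall v l, closure Omega v -> eigenvalue (D2eta v) l -> b0 <= l)
  (spec_le : forall v l, closure Omega v -> eigenvalue (D2eta v) l -> l <= b1)
  (mesh : is_mesh cells nu h a)
  (inv : flux_invariant cells nu Omega f lambda_star G)
  (ent : is_entropy_flux cells nu Omega f eta xi lambda_star G X)
  (dt0 : 0 < dt) (scheme : is_scheme cells nu Omega G dt u0 u)
  (cfl : dt <= b0 / b1 * (a ^+ 2 / lambda_star) * (1 - zeta) * h)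
  (dt_le : dt <= a ^+ 2 / lambda_star)
  (orient : oriented_interfaces cells r Er).
Implicit Types (K L : set E) (v w : V).

Local Notation sigma K L := (area (nu K L) (interface K L)).
Local Notation gap2 k K L :=
  (enorm (G K L (u k K) (u k L) - fluxdot f (u k K) (nu K L)) ^+ 2).

Let c0 := zeta * b0 / (4 * lambda_star).
Let lambda := relaxed_lambda zeta lambda_star.
Let Xmax := Mxi + lambda * Meta.
Let vol_ball := vol (cube (r + 3) : set E).

Let lambda_gt0 : 0 < lambda.
Proof. exact: lt_trans l0 (relaxed_lambda_gt zeta01 l0). Qed.

(** The entropy inequality bounds the entropy flux from above, as [eta] is
    nonnegative; the lower bound in [entropy_flux_norm] is the upper bound seen
    from the other cell. *)
Lemma entropy_flux_le K L v w : cells K -> neighbours cells K L ->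
  Omega v -> Omega w -> X K L v w <= Xmax.
Proof.
move=> cK KL Ov Ow; have lgt := relaxed_lambda_gt zeta01 l0.
have [n1 _ _] := mesh_normal mesh cK KL.
have := entropy_flux_inequality ent cK KL (ltW lgt) Ov Ow.
rewrite -/lambda; have := eta_ge0 (inv cK KL lgt Ov Ow); rewrite -/lambda.
set p := eta _ => p0 le_X; rewrite -(subrK (entropydot xi v (nu K L)) (X _ _ _ _)).
rewrite addrC /Xmax lerD//.
  exact: le_trans (ler_norm _) (le_trans (norm_entropydot xi v n1) (xi_le Ov)).
apply: (le_trans le_X); rewrite mulNr -mulrN opprB ler_pM2l//.
by rewrite lerBlDl (le_trans (eta_le Ov))// lerDr.
Qed.

Lemma entropy_flux_norm K L v w : cells K -> neighbours cells K L ->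
  Omega v -> Omega w -> `|X K L v w| <= Xmax.
Proof.
move=> cK KL Ov Ow; rewrite ler_norml entropy_flux_le// andbT.
rewrite (entropy_flux_conservative ent cK KL Ov Ow) lerN2.
by apply: entropy_flux_le => //; [case: KL | exact: neighbours_sym cK KL].
Qed.

(** A Lipschitz cut-off in place of the indicator of the ball: the flux through
    the boundary is spread over a layer of unit width, whose cells are counted by
    the volume of a larger ball. It is evaluated at a chosen point of the cell. *)
Definition cutoff K : R := Num.max 0 (Num.min 1 (r + 1 - enorm (xget 0 K))).

Lemma cutoff_itv K : 0 <= cutoff K <= 1.
Proof. by rewrite /cutoff le_max lexx/= ge_max ler01 ge_min lexx. Qed.

Lemma cutoff_lip K L :
  `|cutoff K - cutoff L| <= enorm (xget 0 K - xget 0 L : E).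
Proof.
rewrite /cutoff; set x : E := xget 0 K; set y : E := xget 0 L.
have := ler_enormD (x - y) y; rewrite subrK => h1.
have := ler_enormD (y - x) x; rewrite subrK (enorm_distC y x) => h2.
have := enorm_ge0 (x - y); move: h1 h2.
move: (enorm x) (enorm y) (enorm (x - y)) => p q s h1 h2 s0.
case: (leP 1 (r + 1 - p)) => a1; case: (leP 1 (r + 1 - q)) => a2;
  case: (leP 0 (r + 1 - p)) => a3; case: (leP 0 (r + 1 - q)) => a4;
  by rewrite ?(max_r ler01) ler_norml; lra.
Qed.

Lemma cellP K : cells K -> K (xget 0 K : E).
Proof. by move=> /(cell_nonempty mesh a0)[x Kx]; exact: xgetI Kx. Qed.

Lemma cutoff1 K : cells_in_ball cells r K -> cutoff K = 1.
Proof.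
move=> [cK Kr]; have := Kr _ (cellP cK); rewrite /eball/= => xr.
rewrite /cutoff; set q := enorm _ in xr *.
by rewrite min_l ?(max_r ler01)//; lra.
Qed.

Lemma cutoff_support K : cells K -> cutoff K != 0 -> cells_in_ball cells (r + 3) K /\
  forall L, neighbours cells K L -> cells_in_ball cells (r + 3) L.
Proof.
move=> cK; rewrite /cutoff => K0.
have xr : enorm (xget 0 K : E) < r + 1.
  by rewrite ltNge; apply: contraNN K0 => ?; rewrite max_l// ge_min subr_le0; apply/orP; right.
have [h0 h1] := andP (mesh_size_bounds mesh); have Kx := cellP cK.
split=> [|L KL]; split=> //; first 1 last.
- by case: KL.
- move=> y Ly; rewrite /eball/= -(subrK (xget 0 K) y).
  apply: (le_lt_trans (ler_enormD _ _)); rewrite enorm_distC.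
  by have := neighbour_dist mesh cK KL Kx Ly; lra.
- move=> y Ky; rewrite /eball/= -(subrK (xget 0 K) y).
  apply: (le_lt_trans (ler_enormD _ _)).
  by have := cell_diam mesh cK Ky Kx; lra.
Qed.

Let F := fset_set (cells_in_ball cells (r + 3)).
Let fin := finite_cells_in_ball mesh a0 (r + 3).

Let FP K : (K \in F) = `[< cells_in_ball cells (r + 3) K >].
Proof. by rewrite /F in_fset_set//; apply: asbool_equiv_eq. Qed.

Let Fcells K : K \in F -> cells K.
Proof. by rewrite FP => /asboolP[]. Qed.

Lemma sum_neighbours_ball K (P : set E -> R) : cells K ->
  (forall L, neighbours cells K L -> L \in F) ->
  \sum_(L \in neighbours cells K) P L =
  \sum_(L <- F) (if `[< neighbours cells K L >] then P L else 0).
Proof.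
move=> cK NF; have fN := finite_neighbours mesh a0 cK.
rewrite -[RHS]big_mkcond [LHS]fsbig_finite//.
rewrite -[RHS]big_filter; apply: perm_big.
apply: uniq_perm; [exact: fset_uniq|exact/filter_uniq/fset_uniq|move=> L].
rewrite in_fset_set// mem_filter.
apply/idP/andP => [/set_mem KL|[/asboolP KL _]]; last exact: mem_set.
by split; [apply/asboolP|exact: NF].
Qed.

Definition entropy_exchange k K L : R :=
  if `[< neighbours cells K L >] then sigma K L * X K L (u k K) (u k L) else 0.

(** The differences of the cut-off between neighbours are at most [2 h], which
    compensates for the total area [O(1 / h)] of the faces in the ball. *)
Lemma boundary_flux_le k :
  - \sum_(K <- F) cutoff K * \sum_(L \in neighbours cells K) sigma K L * X K L (u k K) (u k L)
  <= Xmax * vol_ball / a ^+ 2.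
Proof.
have [h0 h1] := andP (mesh_size_bounds mesh).
have Xmax0 : 0 <= Xmax by rewrite addr_ge0// mulr_ge0// ltW.
have bound_area K : cells K -> \sum_(L <- F) (if `[< neighbours cells K L >] then sigma K L else 0)
    <= h ^+ d.-1 / a.
  move=> cK; apply: le_trans (mesh_perimeter mesh cK).
  have fN := finite_neighbours mesh a0 cK.
  rewrite -[leLHS]big_mkcond [leRHS]fsbig_finite//= -[leLHS]big_filter.
  rewrite [leRHS](bigID (mem F))/= -[leLHS]addr0; apply: lerD; last first.
    by apply: sumr_ge0 => L _; exact: area_ge0.
  rewrite -[leRHS]big_filter le_eqVlt; apply/orP; left; apply/eqP/perm_big.
  apply: uniq_perm; [exact/filter_uniq/fset_uniq|exact/filter_uniq/fset_uniq|move=> L].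
  by rewrite !mem_filter andbC; congr (_ && _); rewrite in_fset_set.
rewrite big_seq.
rewrite (eq_bigr (fun K => cutoff K * \sum_(L <- F) entropy_exchange k K L)); last first.
  move=> K KF; have cK := Fcells KF.
  have [->|phi0] := eqVneq (cutoff K) 0; first by rewrite !mul0r.
  have [_ NF] := cutoff_support cK phi0.
  by congr (_ * _); apply: sum_neighbours_ball => // L /NF NL; rewrite FP asboolT.
rewrite -big_seq.
apply: le_trans (antisymmetric_sum_le (c := h) _ _) _.
- move=> K L /Fcells cK /Fcells cL; rewrite /entropy_exchange.
  have -> : `[< neighbours cells L K >] = `[< neighbours cells K L >].
    by apply: asbool_equiv_eq; split; exact: neighbours_sym.
  case: ifPn => [/asboolP KL|_]; last by rewrite oppr0.
  rewrite (area_sym mesh a0 cK KL) -mulrN; congr (_ * _).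
  by apply: (entropy_flux_conservative ent); rewrite //; exact: scheme_domain scheme _ _ _.
- move=> K L /Fcells cK /Fcells cL; rewrite /entropy_exchange.
  case: ifPn => [/asboolP KL _|_]; last by rewrite eqxx.
  apply: (le_trans (cutoff_lip K L)); apply: (neighbour_dist mesh cK KL); exact: cellP.
have rowle K : K \in F -> \sum_(L <- F) `|entropy_exchange k K L| <= Xmax * (h ^+ d.-1 / a).
  move=> /Fcells cK; apply: (@le_trans _ _ (Xmax *
      \sum_(L <- F) (if `[< neighbours cells K L >] then sigma K L else 0))).
    rewrite mulr_sumr big_seq [leRHS]big_seq; apply: ler_sum => L /Fcells cL.
    rewrite /entropy_exchange; case: ifPn => [/asboolP KL|_]; last by rewrite normr0 mulr0.
    rewrite normrM ger0_norm ?area_ge0// mulrC ler_wpM2r ?area_ge0//.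
    by apply: entropy_flux_norm => //; exact: scheme_domain scheme _ _ _.
  by rewrite ler_wpM2l// bound_area.
have card := card_cells mesh a0 fin (@subset_refl _ _).
rewrite -/F -/vol_ball in card.
apply: (@le_trans _ _ (h * (#|` F|%:R * (Xmax * (h ^+ d.-1 / a))))).
  rewrite ler_pM2l// mulr_natl.
  rewrite (_ : _ *+ _ = \sum_(K <- F) Xmax * (h ^+ d.-1 / a)); last first.
    by rewrite big_const_seq iter_addr_0 count_predT.
  by rewrite big_seq [leRHS]big_seq; apply: ler_sum.
have hd : h ^+ d = h * h ^+ d.-1 by rewrite -exprS prednK// (mesh_dim_gt0 mesh).
rewrite (_ : h * _ = Xmax / a ^+ 2 * (#|` F|%:R * (a * h ^+ d))); last first.
  by rewrite hd; field; rewrite gt_eqF.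
by rewrite [leRHS]mulrAC ler_wpM2l// mulr_ge0// invr_ge0 sqr_ge0.
Qed.

(** Sum of [cell_entropy_inequality] over the cells and the time steps; the
    entropies telescope and [eta] is nonnegative. *)
Lemma weighted_dissipation (N : nat) :
  c0 * \sum_(0 <= k < N) dt * \sum_(K <- F) cutoff K *
    \sum_(L \in neighbours cells K) sigma K L * gap2 k K L <=
  Meta * vol_ball + N%:R * dt * (Xmax * vol_ball / a ^+ 2).
Proof.
have cut K := andP (cutoff_itv K).
have step k : c0 * (dt * \sum_(K <- F) cutoff K *
      \sum_(L \in neighbours cells K) sigma K L * gap2 k K L) <=
    (\sum_(K <- F) cutoff K * vol K * eta (u k K) -
     \sum_(K <- F) cutoff K * vol K * eta (u k.+1 K)) + dt * (Xmax * vol_ball / a ^+ 2).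
  rewrite -lerBlDl; apply: (@le_trans _ _ (dt * (- \sum_(K <- F) cutoff K *
      \sum_(L \in neighbours cells K) sigma K L * X K L (u k K) (u k L)))); last first.
    by rewrite ler_pM2l//; exact: boundary_flux_le.
  rewrite opprB -sumrB.
  rewrite [leLHS](_ : _ = dt * \sum_(K <- F) cutoff K *
      (vol K / dt * (eta (u k.+1 K) - eta (u k K)) +
      c0 * \sum_(L \in neighbours cells K) sigma K L * gap2 k K L)).
    rewrite ler_pM2l// -sumrN big_seq [leRHS]big_seq; apply: ler_sum => K /Fcells cK.
    rewrite -mulrN; apply: ler_wpM2l; first by case: (cut K).
    exact: (cell_entropy_inequality cO etaC2 a0 zeta01 l0 b1_gt0 spec_ge
      spec_le mesh inv ent dt0 scheme cfl).
  rewrite !mulr_sumr addrC -big_split/=; apply: eq_bigr => K _.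
  by field; rewrite gt_eqF.
have : c0 * \sum_(0 <= k < N) dt * (\sum_(K <- F) cutoff K *
      \sum_(L \in neighbours cells K) sigma K L * gap2 k K L) <=
    (\sum_(K <- F) cutoff K * vol K * eta (u 0%N K) -
     \sum_(K <- F) cutoff K * vol K * eta (u N K)) + N%:R * dt * (Xmax * vol_ball / a ^+ 2).
  elim: N => [|N IH]; first by rewrite big_geq// mulr0 subrr !mul0r addr0.
  rewrite big_nat_recr//= mulrDr -natr1.
  by have := step N; move: IH; move: (Xmax * vol_ball / a ^+ 2) => C; lra.
move=> /le_trans; apply; rewrite lerD2r lerBlDr.
apply: ler_wpDr.
  rewrite big_seq sumr_ge0// => K /Fcells cK.
  rewrite !mulr_ge0 ?vol_ge0//; first by case: (cut K).
  by apply: eta_ge0; exact: scheme_domain scheme _ _ _.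
have := sum_vol_cells mesh a0 fin (@subset_refl _ _); rewrite fsbig_finite// -/F -/vol_ball.
move=> /(ler_wpM2l Meta0); apply: le_trans.
rewrite mulr_sumr big_seq [leRHS]big_seq; apply: ler_sum => K /Fcells cK.
rewrite [leRHS]mulrC; apply: ler_pM.
- by rewrite mulr_ge0 ?vol_ge0//; case: (cut K).
- by apply: eta_ge0; exact: scheme_domain scheme _ _ _.
- by rewrite ler_piMl ?vol_ge0//; case: (cut K).
- by apply: eta_le; exact: scheme_domain scheme _ _ _.
Qed.

(** An oriented interface is a pair of a cell of weight 1 and one of its
    neighbours, so it occurs in the weighted sum over all ordered pairs. *)
Lemma interior_dissipation_le k :
  \sum_(p \in Er) sigma p.1 p.2 * gap2 k p.1 p.2 <=
  \sum_(K <- F) cutoff K * \sum_(L \in neighbours cells K) sigma K L * gap2 k K L.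
Proof.
have [ErP _] := orient.
pose t K L := sigma K L * gap2 k K L.
have t0 K L : 0 <= t K L by rewrite mulr_ge0 ?area_ge0 ?sqr_ge0.
have cutP K : K \in F -> 0 <= cutoff K by move=> _; case/andP: (cutoff_itv K).
have sub_r K : cells_in_ball cells r K -> K \in F.
  move=> [cK Kr]; rewrite FP; apply/asboolP; split=> // x /Kr; rewrite /eball/=.
  by move=> /lt_le_trans; apply; rewrite lerDl.
have ErF p : Er p -> (p.1 \in F) && (p.2 \in F).
  by case: p => K L /ErP[Kr Lr _] /=; rewrite !sub_r.
have fE : finite_set Er.
  apply: (@sub_finite_set _ _ [set` allpairs pair F F]); last exact: finite_seq.
  move=> [K L] /ErF/andP[/= KF LF].
  by apply/allpairsP; exists (K, L).
have -> : \sum_(p \in Er) sigma p.1 p.2 * gap2 k p.1 p.2 =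
    \sum_(K <- F) \sum_(L <- F) (if `[< Er (K, L) >] then t K L else 0).
  rewrite fsbig_finite//=.
  rewrite -(@big_allpairs _ _ _ _ _ F F (fun p => if `[< Er p >] then t p.1 p.2 else 0)).
  rewrite -[RHS]big_mkcond -[RHS]big_filter; apply: perm_big.
  apply: uniq_perm; first exact: fset_uniq.
    by apply/filter_uniq/allpairs_uniq; [exact: fset_uniq|exact: fset_uniq|move=> [? ?] [? ?]].
  move=> [K L]; rewrite in_fset_set// mem_filter.
  apply/idP/andP => [/set_mem KL|[/asboolP KL _]]; last exact: mem_set.
  split; first exact/asboolP.
  by have /andP[/= KF LF] := ErF _ KL; apply/allpairsP; exists (K, L).
rewrite big_seq [leRHS]big_seq; apply: ler_sum => K KF.
have [Kr|nKr] := pselect (cells_in_ball cells r K); last first.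
  rewrite big1 => [|L _]; last by case: ifPn => // /asboolP/ErP[].
  by rewrite mulr_ge0 ?cutP//; apply: fsumr_ge0 => L _; exact: t0.
have cut1 := cutoff1 Kr; have [cK _] := Kr.
have [|_ NF] := cutoff_support cK; first by rewrite cut1 oner_eq0.
have NF' L : neighbours cells K L -> L \in F by move=> /NF KL; rewrite FP asboolT.
rewrite cut1 mul1r sum_neighbours_ball//.
apply: ler_sum => L _; case: ifPn => [/asboolP/ErP[_ _ KL]|_]; last by case: ifP => // _; exact: t0.
by rewrite ifT//; apply/asboolP.
Qed.

Lemma dissipation_le :
  \sum_(0 <= k < (last_step T dt).+1)
    dt * \sum_(p \in Er) sigma p.1 p.2 * gap2 k p.1 p.2
  <= (Meta * vol_ball + (T + 2 * (a ^+ 2 / lambda_star)) * (Xmax * vol_ball / a ^+ 2)) / c0.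
Proof.
have c0_gt0 : 0 < c0 by rewrite divr_gt0 ?mulr_gt0//; case/andP: zeta01.
rewrite ler_pdivlMr// mulrC.
apply: (@le_trans _ _ (c0 * \sum_(0 <= k < (last_step T dt).+1) dt * \sum_(K <- F)
    cutoff K * \sum_(L \in neighbours cells K) sigma K L * gap2 k K L)).
  rewrite ler_pM2l//; apply: ler_sum => k _.
  by rewrite ler_pM2l//; exact: interior_dissipation_le.
apply: (le_trans (weighted_dissipation _)).
rewrite lerD2l; apply: ler_wpM2r.
  rewrite divr_ge0 ?sqr_ge0// mulr_ge0 ?vol_ge0// addr_ge0// mulr_ge0//.
  exact: ltW.
have Tdt : 0 <= T / dt + 1 by rewrite addr_ge0// divr_ge0 ?ltW.
have /andP[+ _] := truncn_itv Tdt.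
rewrite -/(last_step T dt) -natr1 mulrDl mul1r => /(ler_wpM2r (ltW dt0)).
rewrite mulrDl divfK ?gt_eqF// mul1r.
by move: dt_le; lra.
Qed.

End estimate.
End main_estimate.

Lemma bounded_closure {R : realType} (W : normedModType R) (A : set W) :
  bounded_set A -> bounded_set (closure A).
Proof.
move=> [M [Mr MA]]; exists M; split=> // x /MA Ax y yA.
have cl : closed [set z : W | `|z| <= x].
  by apply: (@closed_comp _ _ (fun z : W => `|z|) [set r | r <= x]) => [z _|];
    [exact: norm_continuous|exact: closed_le].
by apply: cl; apply: closureS yA => z; exact: Ax.
Qed.

(** * The dissipation estimate *)

Theorem proposition2p4 (R : realType) (d m : nat)
    (Omega : set 'cV[R]_m)
    (eta : 'cV[R]_m -> R) (Deta : 'cV[R]_m -> 'rV[R]_m)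
    (D2eta : 'cV[R]_m -> 'M[R]_m)
    (xi : 'I_d -> 'cV[R]_m -> R) (Dxi : 'I_d -> 'cV[R]_m -> 'rV[R]_m)
    (T r a zeta lambda_star : R) :
  convex_set Omega -> bounded_set Omega ->
  is_C2_on (closure Omega) eta Deta D2eta ->
  (forall u, closure Omega u -> 0 <= eta u) ->
  (forall alpha, exists D2xi,
     is_C2_on (closure Omega) (xi alpha) (Dxi alpha) D2xi) ->
  0 < T -> 0 < r -> 0 < a -> 0 < zeta < 1 -> 0 < lambda_star ->
  exists C : R,
  forall (beta0 beta1 : R)
    (f : 'I_d -> 'cV[R]_m -> 'cV[R]_m) (Df : 'I_d -> 'cV[R]_m -> 'M[R]_m)
    (cells : set (set 'rV[R]_d)) (nu : set 'rV[R]_d -> set 'rV[R]_d -> 'rV[R]_d)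
    (h dt : R)
    (G : set 'rV[R]_d -> set 'rV[R]_d -> 'cV[R]_m -> 'cV[R]_m -> 'cV[R]_m)
    (u0 : 'rV[R]_d -> 'cV[R]_m) (u : nat -> set 'rV[R]_d -> 'cV[R]_m)
    (Er : set (set 'rV[R]_d * set 'rV[R]_d)),
  0 < beta0 <= beta1 ->
  (forall v l, closure Omega v -> eigenvalue (D2eta v) l ->
     beta0 <= l <= beta1) ->
  (forall alpha i, exists D2f,
     is_C2_on (closure Omega) (fun v => f alpha v i 0)
       (fun v => row i (Df alpha v)) D2f) ->
  (forall alpha v, Omega v -> diagonalizable (Df alpha v)) ->
  (forall alpha v, Omega v -> Dxi alpha v = Deta v *m Df alpha v) ->
  is_mesh cells nu h a ->
  is_numerical_flux cells nu Omega f G ->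
  flux_invariant cells nu Omega f lambda_star G ->
  (exists X, is_entropy_flux cells nu Omega f eta xi lambda_star G X) ->
  measurable_fun setT u0 -> (forall x, Omega (u0 x)) ->
  0 < dt ->
  is_scheme cells nu Omega G dt u0 u ->
  oriented_interfaces cells r Er ->
  dt <= beta0 / beta1 * (a ^+ 2 / lambda_star) * (1 - zeta) * h ->
  \sum_(0 <= k < (last_step T dt).+1)
    dt * \sum_(p \in Er)
      area (nu p.1 p.2) (interface p.1 p.2) *
      enorm (G p.1 p.2 (u k p.1) (u k p.2) -
             fluxdot f (u k p.1) (nu p.1 p.2)) ^+ 2
  <= C.
Proof.
move=> cO bO etaC2 eta_ge0 xiC2 T0 r0 a0 zeta01 l0.
have bcl := bounded_closure bO; have ccl := @closed_closure _ Omega.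
pose spectral_gap b := 0 < b /\
  forall v l, closure Omega v -> eigenvalue (D2eta v) l -> b <= l.
have [[b [b_gt0 bP]]|nogap] := pselect (exists b, spectral_gap b); last first.
  exists 0 => beta0 beta1 f Df cells nu h dt G u0 u Er /andP[beta0_gt0 _] spec *.
  exfalso; apply: nogap; exists beta0; split=> // v l Ov vl.
  by case/andP: (spec v l Ov vl).
have [Meta Meta0 etaM] := C2_bounded etaC2 bcl ccl.
have /choice[Mxi_ xiM] : forall alpha, exists M, 0 <= M /\
    forall v, closure Omega v -> `|xi alpha v| <= M.
  move=> alpha; have [D2xi xialpha] := xiC2 alpha.
  by have [M M0 HM] := C2_bounded xialpha bcl ccl; exists M.
pose Mxi := \sum_alpha Mxi_ alpha.
have Mxi0 : 0 <= Mxi by apply: sumr_ge0 => alpha _; case: (xiM alpha).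
pose vol_ball := vol (cube (r + 3) : set 'rV[R]_d).
pose flux := (Mxi + relaxed_lambda zeta lambda_star * Meta) * vol_ball / a ^+ 2.
pose B := Meta * vol_ball + (T + 2 * (a ^+ 2 / lambda_star)) * flux.
exists (B / (zeta * b / (4 * lambda_star))).
move=> beta0 beta1 f Df cells nu h dt G u0 u Er beta01 spec _ _ _ mesh _ inv [X ent] _ _
  dt0 scheme orient cfl.
have [beta0_gt0 beta_le] := andP beta01.
have beta1_gt0 : 0 < beta1 := lt_le_trans beta0_gt0 beta_le.
have [h0 h1] := andP (mesh_size_bounds mesh).
have [z0 z1] := andP zeta01.
have zl : relaxed_lambda zeta lambda_star > 0 := lt_trans l0 (relaxed_lambda_gt zeta01 l0).
have flux0 : 0 <= flux.
  by rewrite divr_ge0 ?sqr_ge0// mulr_ge0 ?vol_ge0// addr_ge0// mulr_ge0// ltW.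
have B0 : 0 <= B.
  apply: addr_ge0; first by rewrite mulr_ge0 ?vol_ge0.
  apply: mulr_ge0 => //; apply: addr_ge0; first exact: ltW.
  by rewrite mulr_ge0// divr_ge0 ?sqr_ge0// ltW.
(* the larger of the two lower bounds of the spectrum satisfies the CFL
   condition and gives a constant that does not depend on beta0 *)
pose b0 := Num.max beta0 b.
have b0_gt0 : 0 < b0 by rewrite lt_max beta0_gt0.
have spec_ge v l : closure Omega v -> eigenvalue (D2eta v) l -> b0 <= l.
  by move=> Ov vl; rewrite ge_max (bP v l)// andbT; case/andP: (spec v l Ov vl).
have spec_le v l : closure Omega v -> eigenvalue (D2eta v) l -> l <= beta1.
  by move=> Ov vl; case/andP: (spec v l Ov vl).
have al : 0 < a ^+ 2 / lambda_star by rewrite divr_gt0 ?exprn_gt0.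
have cfl' : dt <= b0 / beta1 * (a ^+ 2 / lambda_star) * (1 - zeta) * h.
  apply: (le_trans cfl); rewrite -!mulrA ler_wpM2r//; last first.
    by rewrite le_max lexx.
  by rewrite !mulr_ge0 ?invr_ge0 ?subr_ge0 ?ltW// ?exprn_gt0.
have dt_le : dt <= a ^+ 2 / lambda_star.
  have q0 : 0 <= beta0 / beta1 by rewrite divr_ge0 ?ltW.
  have q1 : beta0 / beta1 <= 1 by rewrite ler_pdivrMr// mul1r.
  have z1' : 0 <= 1 - zeta by rewrite subr_ge0 ltW.
  have zh0 : 0 <= (1 - zeta) * h by rewrite mulr_ge0// ltW.
  have zh1 : (1 - zeta) * h <= 1 by rewrite mulr_ile1 ?gerBl ?(ltW h0) ?(ltW z0).
  have qzh : beta0 / beta1 * ((1 - zeta) * h) <= 1 by rewrite mulr_ile1.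
  apply: (le_trans cfl).
  rewrite (_ : _ * h = a ^+ 2 / lambda_star * (beta0 / beta1 * ((1 - zeta) * h)));
    last by ring.
  by rewrite ler_piMr// ltW.
apply: le_trans (dissipation_le cO etaC2 _ _ _ Meta0 Mxi0 T0 a0 zeta01 l0 b0_gt0 beta1_gt0
  spec_ge spec_le mesh inv ent dt0 scheme cfl' dt_le orient) _.
- by move=> v Ov; apply: eta_ge0; exact: subset_closure.
- by move=> v Ov; apply: le_trans (ler_norm _) (etaM v _); exact: subset_closure.
- move=> v Ov; apply: ler_sum => alpha _; apply: (xiM alpha).2; exact: subset_closure.
rewrite -/vol_ball -/flux -/B ler_wpM2l// lef_pV2 ?posrE ?divr_gt0 ?mulr_gt0//.
by rewrite ler_pM2r ?invr_gt0 ?mulr_gt0// ler_pM2l// le_max lexx orbT.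
Qed.
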